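(* Let $(\mathcal{T}_1,\dots,\mathcal{T}_n)$, $\mathcal{T}_j=(T_{j,t})_{t\ge0}$, be a tuple of commuting normal contractive semigroups on a Hilbert space $\mathcal{H}$. Then it is jointly unitarily equivalent to a model $n$-normal contractive semigroup; that is, there exist a semifinite measure space $(X,\mu)$, functions $\psi_1,\dots,\psi_n\in L^\infty(X,\mu)$ with $\|\psi_j\|_\infty\le1$ and $\mu(\{x:\psi_j(x)=1\})=0$ for each $j$, and a unitary $\gamma:\mathcal{H}\to L^2(X,\mu)$ such that $T_{j,t}=\gamma^*M_{\varphi_t\circ\psi_j}\gamma$ for all $t\ge0$ and $j=1,\dots,n$.
   Context: A contractive semigroup is a strongly continuous one-parameter semigroup $(T_t)_{t\ge0}$ of contractions with $T_0=I$; it is normal if each $T_t$ is normal. Semigroups $(T_{i,t})$ and $(T_{j,t})$ commute if $T_{i,t}T_{j,t}=T_{j,t}T_{i,t}$ for all $t\ge0$. $\varphi_t(w)=e^{t\frac{w+1}{w-1}}$ for $w\in\overline{\mathbb{D}}\setminus\{1\}$, $(\varphi_t\circ\psi)(x)=\varphi_t(\psi(x))$, and $M_f$ is multiplication by $f$ on $L^2(X,\mu)$. *)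

(* Defs.v *)
(* mathcomp-analysis (measure theory, integration) +
   mathcomp-real-closed complex numbers R[i]. *)
From HB Require Import structures.
From mathcomp Require Import all_boot all_order all_algebra.
From mathcomp Require Import all_classical all_reals all_analysis.
From mathcomp Require Import complex.
Set Implicit Arguments. Unset Strict Implicit. Unset Printing Implicit Defensive.
Import Order.TTheory GRing.Theory Num.Theory.
Local Open Scope ring_scope.
Local Open Scope classical_set_scope.
Local Open Scope complex_scope.

Section Defs.
Variable R : realType.
Local Notation C := R[i].

(** squared modulus |z|^2 of a complex number *)
Definition cnorm2 (z : C) : R := (complex.Re z) ^+ 2 + (complex.Im z) ^+ 2.

(** complex exponential e^(a+ib) = e^a (cos b + i sin b) *)
Definition cexp (z : C) : C :=
  (expR (complex.Re z) * cos (complex.Im z)) +i* (expR (complex.Re z) * sin (complex.Im z)).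

(** phi_t(w) = exp(t (w+1)/(w-1)) for w <> 1; the value at w = 1 is
    irrelevant (set to 0), since it is only used on a.e.-sets avoiding 1 *)
Definition phi (t : R) (w : C) : C :=
  if w == 1 then 0 else cexp (t%:C * ((w + 1) / (w - 1))).

(** ---------- Complex Hilbert spaces ---------- *)
Section Hilbert.
Variable V : lmodType C.
Variable ip : V -> V -> C.

Definition is_inner_product : Prop :=
  [/\ (forall (a : C) (x y z : V), ip (a *: x + y) z = a * ip x z + ip y z),
      (forall x y : V, ip y x = (ip x y)^*),
      (forall x : V, complex.Im (ip x x) = 0 /\ 0 <= complex.Re (ip x x)) &
      (forall x : V, ip x x = 0 -> x = 0)].

Definition hnorm (x : V) : R := Num.sqrt (complex.Re (ip x x)).

Definition hcomplete : Prop :=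
  forall u : nat -> V,
    (forall e : R, 0 < e -> exists N : nat, forall m k : nat,
        (N <= m)%N -> (N <= k)%N -> hnorm (u m - u k) < e) ->
    exists l : V, forall e : R, 0 < e -> exists N : nat, forall k : nat,
        (N <= k)%N -> hnorm (u k - l) < e.

Definition is_hilbert : Prop := is_inner_product /\ hcomplete.

Definition linear_op (A : V -> V) : Prop :=
  forall (a : C) (x y : V), A (a *: x + y) = a *: A x + A y.

(** B is the (Hilbert) adjoint of A *)
Definition is_adjoint (A B : V -> V) : Prop :=
  forall x y : V, ip (A x) y = ip x (B y).

(** A is normal: A A^* = A^* A *)
Definition normal_op (A : V -> V) : Prop :=
  exists B : V -> V, is_adjoint A B /\ (forall x, A (B x) = B (A x)).

(** strongly continuous one-parameter semigroup of contractions, T_0 = I *)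
Definition contractive_semigroup (T : R -> V -> V) : Prop :=
  [/\ (forall t, 0 <= t -> linear_op (T t)),
      (forall t (h : V), 0 <= t -> hnorm (T t h) <= hnorm h),
      (forall h : V, T 0 h = h),
      (forall s t (h : V), 0 <= s -> 0 <= t -> T (s + t) h = T s (T t h)) &
      (forall (h : V) t, 0 <= t -> forall e : R, 0 < e ->
         exists2 d : R, 0 < d & forall s, 0 <= s -> `|s - t| < d ->
           hnorm (T s h - T t h) < e)].

Definition normal_contractive_semigroup (T : R -> V -> V) : Prop :=
  contractive_semigroup T /\ (forall t, 0 <= t -> normal_op (T t)).

Definition semigroups_commute (T1 T2 : R -> V -> V) : Prop :=
  forall t (h : V), 0 <= t -> T1 t (T2 t h) = T2 t (T1 t h).
End Hilbert.

(** ---------- Measure-theoretic side ---------- *)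
Section Meas.
Context {d : measure_display} {X : measurableType d}.
Variable mu : {measure set X -> \bar R}.

Definition semifinite : Prop :=
  forall A : set X, measurable A -> mu A = +oo%E ->
    exists B : set X, [/\ measurable B, B `<=` A & (0 < mu B < +oo)%E].

(** measurability of a complex-valued function (real and imaginary parts) *)
Definition cmeasurable (f : X -> C) : Prop :=
  measurable_fun setT (fun x => complex.Re (f x)) /\
  measurable_fun setT (fun x => complex.Im (f x)).

(** f is (a representative of) an element of L^2(X, mu) *)
Definition cL2 (f : X -> C) : Prop :=
  cmeasurable f /\ ((\int[mu]_x (cnorm2 (f x))%:E) < +oo)%E.

(** psi is an element of L^oo(X, mu) with ||psi||_oo <= 1 *)
Definition Linf_ball (psi : X -> C) : Prop :=
  cmeasurable psi /\ {ae mu, forall x, cnorm2 (psi x) <= 1}.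

(** gamma : H -> L^2(X,mu) is a unitary (functions taken up to a.e. equality) *)
Definition unitary_to_L2 (V : lmodType C) (ip : V -> V -> C)
    (gamma : V -> X -> C) : Prop :=
  [/\ (forall h : V, cL2 (gamma h)),
      (forall (a : C) (h k : V),
          {ae mu, forall x, gamma (a *: h + k) x = a * gamma h x + gamma k x}),
      (forall h : V,
          ((\int[mu]_x (cnorm2 (gamma h x))%:E) = ((hnorm ip h) ^+ 2)%:E)%E) &
      (forall f : X -> C, cL2 f -> exists h : V, {ae mu, forall x, gamma h x = f x})].
End Meas.
End Defs.

(* Main.v *)
(** The semigroups enter only through the countable commuting family of normal
    contractions T_{j,t} with t = 2^-m.  For a normal operator B, the closed
    subspace {x | |B^k x| <= D e^k for some D and all k} is invariant under every
    bounded operator commuting with B, and so is its orthogonal projection; it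
    is the spectral subspace of the disk of radius e.  Taking B = N - c for the
    operators N of the family and c = 0, 1, i yields countably many commuting
    projections P_k which generate the family as far as closed invariant
    subspaces are concerned, without Fuglede's theorem.

    By Zorn's lemma the space is an orthogonal sum of subspaces cyclic for the
    P_k.  The cyclic subspace of v is L^2 of the interval [0, |v|^2[ with Lebesgue
    measure on the sigma-algebra generated by a binary tree of intervals whose
    lengths are the |E v|^2, for E a product of P_k's and (1 - P_k)'s.
    The disjoint union of these intervals is a semifinite measure space on whose
    L^2 every contraction generated by the P_k in this sense is a multiplication.

    This applies to the T_{j,2^-m} and to the integrals B_j over [0, 1] of
    e^{-t} T_{j,t}, which equal (A_j - 1)^-1 (e^{-1} T_{j,1} - 1) for the generator
    A_j.  The quotient of the multipliers of B_j and e^{-1} T_{j,1} - 1 is thus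
    that of the resolvent, and psi_j is its Cayley transform.  Comparing the
    multipliers of the T_{j,2^-m} with the generator pointwise, along a
    subsequence, and then using strong continuity yields phi_t o psi_j for every
    t >= 0. *)
Require Import Defs.
From HB Require Import structures.
From mathcomp Require Import all_boot all_order all_algebra.
From mathcomp Require Import all_classical all_reals all_analysis.
From mathcomp Require Import measurable_realfun complex.
From mathcomp Require Import ring lra.
Set Implicit Arguments. Unset Strict Implicit. Unset Printing Implicit Defensive.
Import Order.TTheory GRing.Theory Num.Theory.
Import numFieldNormedType.Exports.
Local Open Scope ring_scope.
Local Open Scope classical_set_scope.
Local Open Scope complex_scope.

(** Three obstacles shape the construction. The space need not be separable, so uncountably many
    cyclic subspaces may occur. Measurability and nullity on the disjoint union are therefore tested
    fibre by fibre: arbitrary choices, one per fibre, then glue to measurable functions and null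
    sets. The price is a measure that may fail to be sigma-finite and is only semifinite. The
    semigroups are assumed to commute at equal times only. Dyadic times are singled out because any
    two of them are multiples of a common dyadic step, and because countably many a.e. statements
    can be combined into one. The generator is unbounded, so its values must be reached through
    bounded operators. The multipliers of the T_{j,2^-m} form a chain of square roots, and the
    semigroup law alone does not say which branch is taken at each step; comparison with the bounded
    B_j decides it. Damping by e^{-t} shifts the spectrum from Re <= 0 to Re <= -1, so that e^{-1}
    T_{j,1} - 1, hence also B_j, has a multiplier without zeros. *)

Section ComplexNumbers.
Variable R : realType.
Local Notation C := R[i].
Implicit Types z w : C.

Lemma cReD z w : complex.Re (z + w) = complex.Re z + complex.Re w.
Proof. by case: z w => [a b] [c d]. Qed.
Lemma cImD z w : complex.Im (z + w) = complex.Im z + complex.Im w.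
Proof. by case: z w => [a b] [c d]. Qed.
Lemma cReN z : complex.Re (- z) = - complex.Re z.
Proof. by case: z. Qed.
Lemma cImN z : complex.Im (- z) = - complex.Im z.
Proof. by case: z. Qed.
Lemma cReM z w : complex.Re (z * w) =
  complex.Re z * complex.Re w - complex.Im z * complex.Im w.
Proof. by case: z w => [a b] [c d]. Qed.
Lemma cImM z w : complex.Im (z * w) =
  complex.Re z * complex.Im w + complex.Im z * complex.Re w.
Proof. by case: z w => [a b] [c d]. Qed.
Lemma cRe_conj z : complex.Re (z^*) = complex.Re z.
Proof. by case: z. Qed.
Lemma cIm_conj z : complex.Im (z^*) = - complex.Im z.
Proof. by case: z. Qed.
Lemma cRe_real (r : R) : complex.Re r%:C = r. Proof. by []. Qed.
Lemma cIm_real (r : R) : complex.Im r%:C = 0. Proof. by []. Qed.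
Lemma complexP z w : complex.Re z = complex.Re w ->
  complex.Im z = complex.Im w -> z = w.
Proof. by case: z w => [a b] [c d] /= -> ->. Qed.

Lemma conj_realC (r : R) : (r%:C)^* = r%:C.
Proof. by apply: complexP => //=; rewrite oppr0. Qed.

Definition ReImE := (cReD, cImD, cReN, cImN, cReM, cImM, cRe_conj, cIm_conj, cRe_real, cIm_real).

Lemma cnorm2_ge0 z : 0 <= cnorm2 z.
Proof. by rewrite addr_ge0 ?sqr_ge0. Qed.
Lemma cnorm2M z w : cnorm2 (z * w) = cnorm2 z * cnorm2 w.
Proof. rewrite /cnorm2 !ReImE; ring. Qed.
Lemma cnorm2N z : cnorm2 (- z) = cnorm2 z.
Proof. by rewrite /cnorm2 !ReImE !sqrrN. Qed.
Lemma cnorm2_real (r : R) : cnorm2 r%:C = r ^+ 2.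
Proof. rewrite /cnorm2 /=; ring. Qed.
Lemma cnorm20 : cnorm2 (0 : C) = 0.
Proof. rewrite /cnorm2 /=; ring. Qed.
Lemma cnorm21 : cnorm2 (1 : C) = 1.
Proof. rewrite /cnorm2 /=; ring. Qed.
Lemma cnorm2_eq0 z : cnorm2 z = 0 -> z = 0.
Proof.
move/eqP; rewrite paddr_eq0 ?sqr_ge0// !sqrf_eq0 => /andP[/eqP a /eqP b].
exact: complexP.
Qed.
Lemma mulr_conj z : z * z^* = (cnorm2 z)%:C.
Proof. apply: complexP; rewrite !ReImE /cnorm2 /=; ring. Qed.
End ComplexNumbers.

(** * Inner product spaces: identities, Cauchy-Schwarz, convergence *)

Section InnerProduct.
Variables (R : realType) (V : lmodType R[i]) (ip : V -> V -> R[i]).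
Hypothesis ipP : is_inner_product ip.
Local Notation C := R[i].
Local Notation hn := (hnorm ip).

Definition nrm2 (x : V) : R := complex.Re (ip x x).
Definition rip (x y : V) : R := complex.Re (ip x y).

Lemma ripE x y : rip x y = complex.Re (ip x y). Proof. by []. Qed.
Lemma nrm2E x : nrm2 x = complex.Re (ip x x). Proof. by []. Qed.

Lemma ipDl x y z : ip (x + y) z = ip x z + ip y z.
Proof. by have [H _ _ _] := ipP; rewrite -{1}[x]scale1r H mul1r. Qed.
Lemma ip0l z : ip 0 z = 0.
Proof. by apply: (addrI (ip 0 z)); rewrite -ipDl !addr0. Qed.
Lemma ipZl a x z : ip (a *: x) z = a * ip x z.
Proof. by have [H _ _ _] := ipP; rewrite -[a *: x]addr0 H ip0l addr0. Qed.
Lemma ipNl x z : ip (- x) z = - ip x z.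
Proof. by rewrite -scaleN1r ipZl mulN1r. Qed.
Lemma ipBl x y z : ip (x - y) z = ip x z - ip y z.
Proof. by rewrite ipDl ipNl. Qed.
Lemma ipC x y : ip y x = (ip x y)^*.
Proof. by have [_ H _ _] := ipP. Qed.
Lemma ipDr x y z : ip x (y + z) = ip x y + ip x z.
Proof. by rewrite ipC ipDl (ipC y x) (ipC z x) -rmorphD. Qed.
Lemma ip0r z : ip z 0 = 0.
Proof. by rewrite ipC ip0l conjc0. Qed.
Lemma ipZr a x z : ip x (a *: z) = a^* * ip x z.
Proof. by rewrite ipC ipZl (ipC z x) -rmorphM. Qed.
Lemma ipNr x z : ip x (- z) = - ip x z.
Proof. by rewrite ipC ipNl (ipC z x) -rmorphN. Qed.
Lemma ipBr x y z : ip x (y - z) = ip x y - ip x z.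
Proof. by rewrite ipDr ipNr. Qed.
Lemma ip_eq0C x y : ip x y = 0 -> ip y x = 0.
Proof. by move=> e; rewrite ipC e conjc0. Qed.

Lemma ip_self x : ip x x = (nrm2 x)%:C.
Proof. by have [_ _ H _] := ipP; apply: complexP => //=; case: (H x). Qed.
Lemma nrm2_ge0 x : 0 <= nrm2 x.
Proof. by have [_ _ H _] := ipP; case: (H x). Qed.
Lemma nrm2_eq0 x : nrm2 x = 0 -> x = 0.
Proof. by have [_ _ _ H] := ipP; move=> e; apply: H; rewrite ip_self e. Qed.
Lemma nrm20 : nrm2 0 = 0. Proof. by rewrite /nrm2 ip0l. Qed.

Lemma ip_ext x y : (forall z, ip x z = ip y z) -> x = y.
Proof.
move=> H; apply/eqP; rewrite -subr_eq0; apply/eqP/nrm2_eq0.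
by rewrite /nrm2 ipBl H subrr.
Qed.
Lemma ip_extr x y : (forall z, ip z x = ip z y) -> x = y.
Proof. by move=> H; apply: ip_ext => z; rewrite ipC H [RHS]ipC. Qed.

Lemma ripC x y : rip x y = rip y x.
Proof. by rewrite /rip ipC cRe_conj. Qed.
Lemma nrm2D x y : nrm2 (x + y) = nrm2 x + nrm2 y + 2 * rip x y.
Proof.
rewrite /nrm2 ipDl !ipDr !cReD -!/(rip _ _) (ripC y x); ring.
Qed.
Lemma nrm2N x : nrm2 (- x) = nrm2 x.
Proof. by rewrite /nrm2 ipNl ipNr opprK. Qed.
Lemma ripNr x y : rip x (- y) = - rip x y.
Proof. by rewrite /rip ipNr cReN. Qed.
Lemma nrm2B x y : nrm2 (x - y) = nrm2 x + nrm2 y - 2 * rip x y.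
Proof. by rewrite nrm2D nrm2N ripNr mulrN. Qed.
Lemma nrm2Z a x : nrm2 (a *: x) = cnorm2 a * nrm2 x.
Proof. by rewrite /nrm2 ipZl ipZr mulrA mulr_conj cReM /= mul0r subr0. Qed.
Lemma nrm2BC x y : nrm2 (x - y) = nrm2 (y - x).
Proof. by rewrite -nrm2N opprB. Qed.
Lemma nrm2_pyth x y : ip x y = 0 -> nrm2 (x + y) = nrm2 x + nrm2 y.
Proof. by move=> e; rewrite nrm2D /rip e mulr0 addr0. Qed.
Lemma parallelogram x y : nrm2 (x + y) + nrm2 (x - y) = 2 * nrm2 x + 2 * nrm2 y.
Proof. rewrite nrm2D nrm2B; ring. Qed.
Lemma nrm2D_le x y : nrm2 (x + y) <= 2 * nrm2 x + 2 * nrm2 y.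
Proof. by rewrite -parallelogram lerDl nrm2_ge0. Qed.

Lemma rip_quad (r s : R) x y :
  0 <= r ^+ 2 * nrm2 x + s ^+ 2 * nrm2 y + 2 * r * s * rip x y.
Proof.
have := nrm2_ge0 (r%:C *: x + s%:C *: y).
rewrite nrm2D !nrm2Z !cnorm2_real /rip ipZl ipZr !cReM /= => /le_trans; apply.
rewrite le_eqVlt; apply/orP; left; apply/eqP; rewrite /= /rip; ring.
Qed.

Lemma rip_CS x y : rip x y ^+ 2 <= nrm2 x * nrm2 y.
Proof.
have [y0|yN0] := eqVneq (nrm2 y) 0.
  by rewrite y0 mulr0 (nrm2_eq0 y0) /rip ip0r expr0n.
have yp : 0 < nrm2 y by rewrite lt_neqAle eq_sym yN0 nrm2_ge0.
(* These weights minimise the quadratic form up to scaling; its value is [nrm2 y] times the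
   Cauchy-Schwarz defect. *)
have := rip_quad (nrm2 y) (- rip x y) x y => H.
rewrite -subr_ge0 -(pmulr_rge0 _ yp); apply: le_trans H _.
rewrite le_eqVlt; apply/orP; left; apply/eqP; ring.
Qed.

Lemma hnorm_ge0 x : 0 <= hn x. Proof. exact: sqrtr_ge0. Qed.
Lemma hnorm2 x : hn x ^+ 2 = nrm2 x.
Proof. by rewrite sqr_sqrtr ?nrm2_ge0. Qed.
Lemma hnorm0 : hn 0 = 0. Proof. by rewrite /hnorm ip0l sqrtr0. Qed.
Lemma hnorm_eq0 x : hn x = 0 -> x = 0.
Proof. by move=> e; apply: nrm2_eq0; rewrite -hnorm2 e expr0n. Qed.
Lemma hnormN x : hn (- x) = hn x. Proof. by rewrite /hnorm -!/(nrm2 _) nrm2N. Qed.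
Lemma hnormBC x y : hn (x - y) = hn (y - x). Proof. by rewrite -hnormN opprB. Qed.
Lemma hnorm_le x y : (hn x <= hn y) = (nrm2 x <= nrm2 y).
Proof. by rewrite /hnorm ler_sqrt ?nrm2_ge0. Qed.
Lemma hnorm_le_sqrt x (e : R) : 0 <= e -> (hn x <= e) = (nrm2 x <= e ^+ 2).
Proof. by move=> e0; rewrite -hnorm2 ler_sqr ?nnegrE ?hnorm_ge0. Qed.
Lemma hnorm_lt_sqrt x (e : R) : 0 <= e -> (hn x < e) = (nrm2 x < e ^+ 2).
Proof. by move=> e0; rewrite -hnorm2 ltr_sqr ?nnegrE ?hnorm_ge0. Qed.
Lemma hnormZr (r : R) x : hn (r%:C *: x) = `|r| * hn x.
Proof.
by rewrite /hnorm -!/(nrm2 _) nrm2Z cnorm2_real sqrtrM ?sqr_ge0 // sqrtr_sqr.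
Qed.
Lemma hnormZ a x : hn (a *: x) = Num.sqrt (cnorm2 a) * hn x.
Proof. by rewrite /hnorm -!/(nrm2 _) nrm2Z sqrtrM ?cnorm2_ge0. Qed.

Lemma rip_le x y : rip x y <= hn x * hn y.
Proof.
apply: le_trans (ler_norm _) _.
rewrite -(@ler_pXn2r _ 2) ?nnegrE ?normr_ge0 ?mulr_ge0 ?hnorm_ge0//.
by rewrite exprMn !hnorm2 real_normK ?num_real// rip_CS.
Qed.

Lemma hnorm_triangle x y : hn (x + y) <= hn x + hn y.
Proof.
rewrite hnorm_le_sqrt ?addr_ge0 ?hnorm_ge0// nrm2D sqrrD !hnorm2.
have := rip_le x y; rewrite -mulr_natl; lra.
Qed.
Lemma hnorm_triB x y z : hn (x - z) <= hn (x - y) + hn (y - z).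
Proof. by rewrite -{1}[x](subrK y) -addrA hnorm_triangle. Qed.
Lemma hnorm_subl x y : hn x - hn y <= hn (x - y).
Proof. by rewrite lerBlDr -{1}[x](subrK y) hnorm_triangle. Qed.
Lemma hnormB_le x y : hn (x - y) <= hn x + hn y.
Proof. by rewrite -(hnormN y) hnorm_triangle. Qed.

Lemma hnorm_small_eq0 x : (forall e : R, 0 < e -> hn x < e) -> x = 0.
Proof.
move=> H; apply: hnorm_eq0; apply/eqP; rewrite eq_le hnorm_ge0 andbT.
by apply/ler_addgt0Pl => e e0; rewrite addr0 ltW ?H.
Qed.

Definition hcvg (u : nat -> V) (l : V) : Prop :=
  forall e : R, 0 < e -> exists N : nat, forall k : nat, (N <= k)%N -> hn (u k - l) < e.

Lemma hcvg_unique u l l' : hcvg u l -> hcvg u l' -> l = l'.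
Proof.
move=> H H'; apply/eqP; rewrite -subr_eq0; apply/eqP/hnorm_small_eq0 => e e0.
have e2 : 0 < e / 2 by rewrite divr_gt0.
have [N HN] := H _ e2; have [N' HN'] := H' _ e2.
have := HN _ (leq_maxl N N'); have := HN' _ (leq_maxr N N').
set k := maxn N N' => h1 h2; apply: le_lt_trans (hnorm_triB l (u k) l') _.
rewrite (hnormBC l); lra.
Qed.

Lemma hcvg_cst l : hcvg (fun=> l) l.
Proof. by move=> e e0; exists 0%N => k _; rewrite subrr hnorm0. Qed.

Lemma hcvgD u u' l l' : hcvg u l -> hcvg u' l' -> hcvg (fun k => u k + u' k) (l + l').
Proof.
move=> H H' e e0; have e2 : 0 < e / 2 by rewrite divr_gt0.
have [N HN] := H _ e2; have [N' HN'] := H' _ e2.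
exists (maxn N N') => k; rewrite geq_max => /andP[/HN h1 /HN' h2].
rewrite opprD addrACA; apply: le_lt_trans (hnorm_triangle _ _) _; lra.
Qed.

Lemma hcvg_bounded (A : V -> V) (K : R) u l :
  (forall x y, A (x - y) = A x - A y) -> (forall x, hn (A x) <= K * hn x) ->
  hcvg u l -> hcvg (fun k => A (u k)) (A l).
Proof.
move=> AB AK H e e0; have K1 : 0 < `|K| + 1 by rewrite ltr_wpDl.
have [N HN] := H _ (divr_gt0 e0 K1).
exists N => k /HN h; rewrite -AB; apply: le_lt_trans (AK _) _.
apply: (@le_lt_trans _ _ ((`|K| + 1) * hn (u k - l))).
  by rewrite ler_wpM2r ?hnorm_ge0// (le_trans (ler_norm K))// lerDl.
by rewrite mulrC -ltr_pdivlMr.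
Qed.

Lemma hcvgZ a u l : hcvg u l -> hcvg (fun k => a *: u k) (a *: l).
Proof.
apply: (@hcvg_bounded (fun x => a *: x) (Num.sqrt (cnorm2 a))) => [x y|x].
  by rewrite scalerBr.
by rewrite hnormZ.
Qed.

Lemma hcvgN u l : hcvg u l -> hcvg (fun k => - u k) (- l).
Proof.
by apply: (@hcvg_bounded -%R 1) => [x y|x]; rewrite ?opprD // hnormN mul1r.
Qed.

Lemma hcvg_hnorm_le u l (K : R) : hcvg u l -> (forall k, hn (u k) <= K) -> hn l <= K.
Proof.
move=> H HK; apply/ler_addgt0Pl => e e0; have [N HN] := H _ e0.
rewrite -[l](subrK (u N)) (le_trans (hnorm_triangle _ _))//.
by rewrite lerD// hnormBC ltW// HN.
Qed.

Lemma hcvg_le_near u l (K : R) N : hcvg u l -> (forall k, (N <= k)%N -> hn (u k) <= K) -> hn l <= K.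
Proof.
move=> H HK; apply/ler_addgt0Pl => e e0; have [N' HN] := H _ e0.
have := HN _ (leq_maxl N' N); have := HK _ (leq_maxr N' N).
set k := maxn _ _ => h1 h2; rewrite -[l](subrK (u k)) (le_trans (hnorm_triangle _ _))//.
by rewrite lerD// hnormBC ltW.
Qed.

(** * Closed subspaces and orthogonal projections *)

Definition subspace (M : V -> Prop) : Prop :=
  M 0 /\ forall a x y, M x -> M y -> M (a *: x + y).
Definition hclosed (M : V -> Prop) : Prop :=
  forall u l, hcvg u l -> (forall k, M (u k)) -> M l.
Definition closed_subspace (M : V -> Prop) : Prop := subspace M /\ hclosed M.

Section Subspace.
Variable M : V -> Prop.
Hypothesis MP : subspace M.
Lemma subspace0 : M 0. Proof. by case: MP. Qed.
Lemma subspaceZ a x : M x -> M (a *: x).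
Proof. by move=> Mx; rewrite -[_ *: _]addr0; apply: MP.2 => //; exact: MP.1. Qed.
Lemma subspaceD x y : M x -> M y -> M (x + y).
Proof. by move=> Mx My; rewrite -[x]scale1r; apply: MP.2. Qed.
Lemma subspaceN x : M x -> M (- x).
Proof. by move=> Mx; rewrite -scaleN1r; exact: subspaceZ. Qed.
Lemma subspaceB x y : M x -> M y -> M (x - y).
Proof. by move=> Mx My; apply: subspaceD => //; exact: subspaceN. Qed.
End Subspace.

Lemma hclosed_approx M x : hclosed M ->
  (forall e : R, 0 < e -> exists2 y, M y & hn (x - y) < e) -> M x.
Proof.
move=> Mc H.
have hp k : (0 : R) < (k.+1%:R)^-1 by rewrite invr_gt0.
have /choice [u Hu] : forall k : nat, exists y, M y /\ hn (x - y) < k.+1%:R^-1.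
  by move=> k; have [y ? ?] := H _ (hp k); exists y.
apply: (Mc u) => [e e0|k]; last by case: (Hu k).
have [N _ HN] := near_infty_natSinv_lt (PosNum e0); exists N => k Nk.
rewrite hnormBC; apply: lt_trans (Hu k).2 _; exact: HN.
Qed.

Section LinearOp.
Variable A : V -> V.
Hypothesis HA : linear_op A.
Lemma linop0 : A 0 = 0.
Proof.
have := HA 1 0 0; rewrite !scale1r !addr0 => e.
by apply: (addrI (A 0)); rewrite -e addr0.
Qed.
Lemma linopD x y : A (x + y) = A x + A y.
Proof. by rewrite -{1}[x]scale1r HA scale1r. Qed.
Lemma linopZ a x : A (a *: x) = a *: A x.
Proof. by rewrite -[a *: x]addr0 HA linop0 addr0. Qed.
Lemma linopN x : A (- x) = - A x.
Proof. by rewrite -scaleN1r linopZ scaleN1r. Qed.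
Lemma linopB x y : A (x - y) = A x - A y.
Proof. by rewrite linopD linopN. Qed.
Lemma linop_iter k : linear_op (iter k A).
Proof. by elim: k => [|k IH] a x y //=; rewrite IH HA. Qed.
End LinearOp.

Lemma adjoint_linear A B : is_adjoint ip A B -> linear_op B.
Proof.
move=> H a x y; apply: ip_extr => z.
by rewrite -H !ipDr !ipZr -!H.
Qed.
Lemma adjoint_sym A B : is_adjoint ip A B -> is_adjoint ip B A.
Proof. by move=> H x y; rewrite ipC -H -ipC. Qed.

Hypothesis hcomp : hcomplete ip.

Lemma orth_of_min w y :
  (forall t : R, nrm2 w <= nrm2 (w - t%:C *: y)) -> rip w y = 0.
Proof.
move=> H; have n0 := nrm2_ge0 y; have n1 : 0 < nrm2 y + 1 by rewrite ltr_wpDl.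
(* The optimal t would have denominator [nrm2 y]; the extra 1 avoids a case distinction on y = 0 and
   still lowers the norm strictly unless [rip w y] vanishes. *)
have := H (rip w y / (nrm2 y + 1)).
rewrite nrm2B nrm2Z cnorm2_real /rip ipZr cReM /= oppr0 mul0r subr0 -/(rip w y).
set r := rip w y; set n := nrm2 y in n0 n1 *.
have -> : nrm2 w + (r / (n + 1)) ^+ 2 * n - 2 * (r / (n + 1) * r) =
   nrm2 w - r ^+ 2 * ((n + 2) / (n + 1) ^+ 2).
  by field; rewrite gt_eqF.
rewrite lerDl oppr_ge0 => h.
have k0 : 0 < (n + 2) / (n + 1) ^+ 2 by rewrite divr_gt0 ?exprn_gt0// ltr_wpDl.
move: h; rewrite pmulr_lle0// => h; apply/eqP; rewrite -sqrf_eq0 eq_le h /=.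
exact: sqr_ge0.
Qed.

Lemma proj_exists M x : closed_subspace M ->
  exists p, M p /\ forall y, M y -> ip (x - p) y = 0.
Proof.
move=> [Ms Mc]; pose D := [set r : R | exists2 y, M y & r = hn (x - y)].
have D0 : has_inf D.
  split; first by exists (hn (x - 0)); exists 0 => //; exact: (subspace0 Ms).
  by exists 0 => _ [y _ ->]; exact: hnorm_ge0.
have dle y : M y -> inf D <= hn (x - y).
  by move=> My; apply: ge_inf; [exact: D0.2|exists y].
have d0 : 0 <= inf D by apply: lb_le_inf D0.1 _ => _ [y _ ->]; exact: hnorm_ge0.
set d := inf D in dle d0.
have hp k : (0 : R) < (k.+1%:R)^-1 by rewrite invr_gt0.
have /choice [u Hu] : forall k : nat, exists y, M y /\ hn (x - y) < d + k.+1%:R^-1.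
  move=> k; have [_ [y My ->] h] := inf_adherent (hp k) D0.
  by exists y.
have par m k : nrm2 (u m - u k) + 4 * d ^+ 2 <= 2 * nrm2 (x - u m) + 2 * nrm2 (x - u k).
  rewrite -parallelogram addrC.
  have -> : x - u m - (x - u k) = - (u m - u k).
    by rewrite !opprB addrC addrA subrK.
  rewrite nrm2N lerD2r.
  have -> : x - u m + (x - u k) = (2 : R)%:C *: (x - (2^-1 : R)%:C *: (u m + u k)).
    rewrite scalerBr scalerA -rmorphM mulfV ?pnatr_eq0// scale1r.
    by rewrite rmorphD rmorph1 scalerDl scale1r opprD addrACA.
  rewrite nrm2Z cnorm2_real -natrX; apply: ler_wpM2l => //.
  rewrite -hnorm2 ler_sqr ?nnegrE ?hnorm_ge0//; apply: dle.
  apply: subspaceZ => //; apply: subspaceD => //; [exact: (Hu m).1|exact: (Hu k).1].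
have [p Hp] : exists l, hcvg u l.
  apply: hcomp => e e0.
  (* With f <= 1 one has (d + f)^2 <= d^2 + (2 d + 1) f, so the parallelogram bound leaves at most 4
     (2 d + 1) f, which is half of e^2. *)
  pose f := Num.min 1 (e ^+ 2 / (8 * (2 * d + 1))).
  have dd : 0 < 8 * (2 * d + 1) by rewrite mulr_gt0// ltr_wpDl// mulr_ge0.
  have f0 : 0 < f by rewrite lt_min ltr01 divr_gt0// exprn_gt0.
  have [N _ HN] := near_infty_natSinv_lt (PosNum f0).
  exists N => m k /HN /= Nm /HN /= Nk; rewrite hnorm_lt_sqrt ?ltW//.
  have f1 : f <= 1 by rewrite ge_min lexx.
  have f2 : 8 * (2 * d + 1) * f <= e ^+ 2.
    by rewrite mulrC -ler_pdivlMr// ge_min lexx orbT.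
  have bd j : j.+1%:R^-1 < f -> nrm2 (x - u j) < d ^+ 2 + (2 * d + 1) * f.
    move=> hj; rewrite -hnorm2.
    apply: (@lt_le_trans _ _ ((d + f) ^+ 2)).
      rewrite ltr_sqr ?nnegrE ?hnorm_ge0 ?addr_ge0 ?(ltW f0)//.
      by apply: lt_le_trans (Hu j).2 _; rewrite lerD2l ltW.
    nra.
  have := bd _ Nm; have := bd _ Nk; have := par m k; have := sqr_ge0 e; lra.
have Mp : M p by apply: (Mc _ _ Hp) => k; exact: (Hu k).1.
have pd : hn (x - p) <= d.
  apply/ler_addgt0Pl => e e0; have [N _ HN] := near_infty_natSinv_lt (PosNum e0).
  apply: (@hcvg_le_near (fun k => x - u k) _ _ N).
    by apply: hcvgD; [exact: hcvg_cst|exact: hcvgN].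
  by move=> k /HN /= hk; apply: ltW; apply: lt_trans (Hu k).2 _; rewrite addrC ltrD2r.
exists p; split=> //.
(* Minimality along real multiples controls the real part only; the imaginary part follows by
   testing against i y. *)
have ort y : M y -> rip (x - p) y = 0.
  move=> My; apply: orth_of_min => t; rewrite -hnorm_le -addrA -opprD.
  apply: le_trans pd _; apply: dle; apply: subspaceD => //; exact: subspaceZ.
move=> y My; apply: complexP; first exact: ort.
have := ort ('i%C *: y) (subspaceZ Ms _ My); rewrite /rip ipZr cReM /=; lra.
Qed.

(** Total in M, so that projections can be named before closedness is established; the default 0 is
    returned when no nearest point exists. *)
Definition proj (M : V -> Prop) (x : V) : V :=
  xget 0 [set p | M p /\ forall y, M y -> ip (x - p) y = 0].

Section Projection.
Variable M : V -> Prop.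
Hypothesis Mcl : closed_subspace M.
Let Ms := Mcl.1.

Lemma projP x : M (proj M x) /\ forall y, M y -> ip (x - proj M x) y = 0.
Proof.
have [p Hp] := proj_exists x Mcl.
by have := @xgetI _ 0 [set p | M p /\ forall y, M y -> ip (x - p) y = 0] p Hp.
Qed.
Lemma proj_in x : M (proj M x). Proof. exact: (projP x).1. Qed.
Lemma proj_orth x y : M y -> ip (x - proj M x) y = 0.
Proof. exact: (projP x).2. Qed.
Lemma proj_uniq x p : M p -> (forall y, M y -> ip (x - p) y = 0) -> proj M x = p.
Proof.
move=> Mp Hp; apply/eqP; rewrite -subr_eq0; apply/eqP/nrm2_eq0.
have Md : M (proj M x - p) by apply: subspaceB => //; exact: proj_in.
rewrite /nrm2 {1}(_ : proj M x - p = (x - p) - (x - proj M x)).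
  by rewrite ipBl Hp// proj_orth// subr0.
by rewrite opprB [RHS]addrC addrA subrK.
Qed.
Lemma proj_id x : M x -> proj M x = x.
Proof. by move=> Mx; apply: proj_uniq => // y _; rewrite subrr ip0l. Qed.
Lemma proj_idem x : proj M (proj M x) = proj M x.
Proof. exact/proj_id/proj_in. Qed.
Lemma proj_linear : linear_op (proj M).
Proof.
move=> a x y; apply: proj_uniq; first by apply: Ms.2; exact: proj_in.
move=> z Mz; rewrite opprD addrACA -scalerBr ipDl ipZl !proj_orth//.
by rewrite mulr0 addr0.
Qed.
Lemma proj_sym : is_adjoint ip (proj M) (proj M).
Proof.
move=> x y; have H1 := proj_orth x (proj_in y); have H2 := proj_orth y (proj_in x).
move: H1; rewrite ipBl => /eqP; rewrite subr_eq0 => /eqP ->.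
by move: (ip_eq0C H2); rewrite ipBr => /eqP; rewrite subr_eq0 => /eqP ->.
Qed.
(** Invariance of M under the adjoint means that N preserves the orthogonal complement, so N
    respects the whole decomposition. *)
Lemma proj_comm N N' : linear_op N -> is_adjoint ip N N' ->
  (forall x, M x -> M (N x)) -> (forall x, M x -> M (N' x)) ->
  forall x, proj M (N x) = N (proj M x).
Proof.
move=> lN aN HN HN' x; apply: proj_uniq; first exact/HN/proj_in.
by move=> y My; rewrite -linopB// aN proj_orth//; exact: HN'.
Qed.
End Projection.

Definition is_oproj (P : V -> V) : Prop :=
  [/\ linear_op P, forall x, P (P x) = P x & is_adjoint ip P P].

Lemma proj_oproj M : closed_subspace M -> is_oproj (proj M).
Proof. by move=> Mc; split; [exact: proj_linear|exact: proj_idem|exact: proj_sym]. Qed.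

Section OProj.
Variable P : V -> V.
Hypothesis HP : is_oproj P.
Let PL : linear_op P. Proof. by case: HP. Qed.
Lemma oproj_orth x y : ip (P x) (y - P y) = 0.
Proof. by case: HP => _ Pi Ps; rewrite Ps linopB// Pi subrr ip0r. Qed.
Lemma oproj_nrm2 x : nrm2 x = nrm2 (P x) + nrm2 (x - P x).
Proof. by rewrite -nrm2_pyth ?oproj_orth// addrC subrK. Qed.
Lemma oproj_le x : hn (P x) <= hn x.
Proof. by rewrite hnorm_le (oproj_nrm2 x) lerDl nrm2_ge0. Qed.
Lemma oprojC : is_oproj (fun x => x - P x).
Proof.
case: HP => _ Pi Ps; split=> [a x y|x|x y].
- by rewrite PL scalerBr opprD addrACA.
- by rewrite linopB// Pi subrr subr0.
- by rewrite ipBl ipBr Ps.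
Qed.
End OProj.

End InnerProduct.

(** * Square roots of positive operators *)

Section SquareRoot.
Variables (R : realType) (V : lmodType R[i]) (ip : V -> V -> R[i]).
Hypothesis ipP : is_inner_product ip.
Hypothesis hcomp : hcomplete ip.
Local Notation hn := (hnorm ip).
Local Notation rip := (rip ip).
Local Notation nrm2 := (nrm2 ip).
Local Notation hcvg := (hcvg ip).

Lemma hcvg_rip u l z : hcvg u l -> forall e : R, 0 < e ->
  exists N, forall k, (N <= k)%N -> `|rip (u k) z - rip l z| < e.
Proof.
move=> H e e0; have w1 : 0 < hn z + 1 by rewrite ltr_wpDl ?hnorm_ge0.
have [N HN] := H _ (divr_gt0 e0 w1); exists N => k /HN hk.
have -> : rip (u k) z - rip l z = rip (u k - l) z.
  by rewrite !ripE (ipBl ipP) cReD cReN.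
have h : `|rip (u k - l) z| <= hn (u k - l) * hn z.
  rewrite ler_norml (rip_le ipP) andbT lerNl -(ripNr ipP).
  by apply: le_trans (rip_le ipP _ _) _; rewrite (hnormN ipP).
apply: le_lt_trans h _; rewrite ltr_pdivlMr// in hk; apply: le_lt_trans hk.
by rewrite ler_wpM2l ?hnorm_ge0// lerDl.
Qed.

(** Limits are taken in real parts. The imaginary part is the real part against i times a vector,
    and exchanging the arguments of the inner product produces the sign [sgn]. *)
Lemma hcvg_adjoint u w x z l m : hcvg u l -> hcvg w m ->
  (forall k, ip (u k) z = ip x (w k)) -> ip l z = ip x m.
Proof.
move=> ul wm H.
have aux a b (sgn : R) : (forall k, rip (u k) a = sgn * rip (w k) b) -> `|sgn| = 1 ->
   rip l a = sgn * rip m b.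
  move=> Hab s1; apply/eqP; rewrite -subr_eq0 -normr_le0.
  apply/ler_addgt0Pl => e e0; rewrite addr0.
  have e2 : 0 < e / 2 by rewrite divr_gt0.
  have [N HN] := hcvg_rip a ul e2; have [N' HN'] := hcvg_rip b wm e2.
  have := HN _ (leq_maxl N N'); have := HN' _ (leq_maxr N N').
  set k := maxn _ _ => h1 h2.
  have -> : rip l a - sgn * rip m b =
     - (rip (u k) a - rip l a) + sgn * (rip (w k) b - rip m b).
    by rewrite Hab; ring.
  apply: le_trans (ler_normD _ _) _; rewrite normrN normrM s1 mul1r; lra.
apply: complexP.
  rewrite -!ripE (aux z x 1) ?normr1// ?mul1r; first exact: ripC.
  by move=> k; rewrite mul1r ripE H -ripE (ripC ipP).
have ImipE a b : complex.Im (ip a b) = rip a ('i%C *: b).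
  by rewrite ripE ipZr// cReM /=; lra.
rewrite ImipE (ipC ipP) cIm_conj ImipE (aux _ ('i%C *: x) (-1)) ?normrN1 ?mulN1r// => k.
by rewrite mulN1r -!ImipE H (ipC ipP) cIm_conj.
Qed.

Variable Z : V -> V.
Hypothesis Zlin : linear_op Z.
Hypothesis Zadj : is_adjoint ip Z Z.
Hypothesis Zle : forall x, hn (Z x) <= hn x.

Local Fixpoint Yn (k : nat) (x : V) : V :=
  if k is k'.+1 then (2^-1 : R)%:C *: (Z x + Yn k' (Yn k' x)) else 0.
Local Fixpoint yn (k : nat) : R := if k is k'.+1 then 2^-1 * (1 + yn k' ^+ 2) else 0.

Let yn01 k : 0 <= yn k <= 1.
Proof. by elim: k => [|k /andP[h1 h2]] /=; [rewrite lexx ler01|apply/andP; split; nra]. Qed.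
Let yn_ge0 k : 0 <= yn k. Proof. by case/andP: (yn01 k). Qed.
Let yn_nd k : yn k <= yn k.+1.
Proof. by have /andP[h1 h2] := yn01 k; rewrite /=; nra. Qed.

Let Yn_lin k : linear_op (Yn k).
Proof.
elim: k => [|k IH] a x y /=; first by rewrite scaler0 addr0.
rewrite !IH Zlin addrACA -[a *: _ + a *: _]scalerDr [LHS]scalerDr; congr (_ + _).
by rewrite !scalerA mulrC.
Qed.

Let Yn_le k x : hn (Yn k x) <= yn k * hn x.
Proof.
elim: k x => [|k IH] x /=; first by rewrite mul0r (hnorm0 ipP).
rewrite (hnormZr ipP) ger0_norm ?invr_ge0// -mulrA ler_pM2l ?invr_gt0//.
apply: le_trans (hnorm_triangle ipP _ _) _.
rewrite mulrDl mul1r lerD// expr2 -mulrA.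
by apply: le_trans (IH _) _; rewrite ler_wpM2l.
Qed.

Let Yn_step k x : hn (Yn k.+1 x - Yn k x) <= (yn k.+1 - yn k) * hn x.
Proof.
elim: k x => [|k IH] x.
  by rewrite /= !subr0 addr0 expr0n addr0 mulr1 (hnormZr ipP) ger0_norm ?invr_ge0// ler_pM2l ?invr_gt0.
have E n : Yn n.+1 x = (2^-1 : R)%:C *: (Z x + Yn n (Yn n x)) by [].
have e n : yn n.+1 = 2^-1 * (1 + yn n ^+ 2) by [].
rewrite 2!E -scalerBr (hnormZr ipP) ger0_norm ?invr_ge0//.
rewrite 2!e -mulrBr -mulrA ler_pM2l ?invr_gt0//.
(* Difference of squares written as a (a - b) + (a - b) b, which needs no commutation; the scalar
   sequence [yn] satisfies the same identity and so dominates the increments. *)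
have -> : Z x + Yn k.+1 (Yn k.+1 x) - (Z x + Yn k (Yn k x)) =
   Yn k.+1 (Yn k.+1 x - Yn k x) + (Yn k.+1 (Yn k x) - Yn k (Yn k x)).
  by rewrite opprD addrACA subrr add0r (linopB (@Yn_lin _)) addrA subrK.
apply: le_trans (hnorm_triangle ipP _ _) _.
have h1 : hn (Yn k.+1 (Yn k.+1 x - Yn k x)) <= yn k.+1 * ((yn k.+1 - yn k) * hn x).
  by apply: le_trans (Yn_le _ _) _; rewrite ler_wpM2l.
have h2 : hn (Yn k.+1 (Yn k x) - Yn k (Yn k x)) <= (yn k.+1 - yn k) * (yn k * hn x).
  by apply: le_trans (IH _) _; rewrite ler_wpM2l ?subr_ge0.
move: (lerD h1 h2); rewrite -!e; nra.
Qed.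

Let Yn_dist k m x : (k <= m)%N -> hn (Yn m x - Yn k x) <= (yn m - yn k) * hn x.
Proof.
elim: m => [|m IH]; first by rewrite leqn0 => /eqP ->; rewrite !subrr (hnorm0 ipP) mul0r.
rewrite leq_eqVlt => /orP[/eqP ->|km]; first by rewrite !subrr (hnorm0 ipP) mul0r.
apply: le_trans (hnorm_triB ipP _ (Yn m x) _) _.
apply: le_trans (lerD (Yn_step _ _) (IH km)) _.
by rewrite -mulrDl addrA subrK.
Qed.

Let Yn_cvg x : exists l, hcvg (fun k => Yn k x) l.
Proof.
apply: hcomp => e e0; have w1 : 0 < hn x + 1 by rewrite ltr_wpDl ?hnorm_ge0.
have hs : has_sup (range yn).
  by split; [exists (yn 0); exists 0%N|exists 1 => _ [k _ <-]; case/andP: (yn01 k)].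
have [_ [N _ <-] hN] := sup_adherent (divr_gt0 e0 w1) hs.
have nd : {homo yn : m k / (m <= k)%N >-> m <= k} by apply: homo_leq => //; exact: le_trans.
have half m k : (N <= m)%N -> (m <= k)%N -> hn (Yn k x - Yn m x) < e.
  move=> Nm mk; apply: le_lt_trans (Yn_dist _ mk) _.
  have h1 : yn k - yn m < e / (hn x + 1).
    have := nd _ _ Nm; have : yn k <= sup (range yn) by apply: sup_upper_bound => //; exists k.
    lra.
  rewrite ltr_pdivlMr// in h1; apply: le_lt_trans h1.
  by rewrite ler_wpM2l ?lerDl// subr_ge0 nd.
exists N => m k Nm Nk; have [mk|/ltnW km] := leqP m k; last exact: half.
by rewrite (hnormBC ipP); exact: half.
Qed.

(* [1 - Y] is the square root of [1 - Z]; [Y] is the limit of the iteration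
   Y <- (Z + Y^2) / 2, whose increments are dominated by those of the scalar
   iteration started at Z = 1 *)
Lemma sqrt_op : exists Y : V -> V,
  [/\ linear_op Y, is_adjoint ip Y Y, forall x, hn (Y x) <= hn x,
      forall x, Y x + Y x = Z x + Y (Y x) &
      forall S (K : R), linear_op S -> (forall x, hn (S x) <= K * hn x) ->
        (forall x, S (Z x) = Z (S x)) -> forall x, S (Y x) = Y (S x)].
Proof.
have /choice [Y HY] := Yn_cvg.
have Yle x : hn (Y x) <= hn x.
  apply: (hcvg_hnorm_le ipP (HY x)) => k; apply: le_trans (Yn_le _ _) _.
  by rewrite ler_piMl ?hnorm_ge0//; case/andP: (yn01 k).
have Ynle k x : hn (Yn k x) <= hn x.
  apply: le_trans (Yn_le _ _) _.
  by rewrite ler_piMl ?hnorm_ge0//; case/andP: (yn01 k).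
have Ylin : linear_op Y.
  move=> a x y; apply: (hcvg_unique ipP (HY _)).
  have := hcvgD ipP (hcvgZ ipP a (HY x)) (HY y).
  by rewrite (_ : (fun k => _) = (fun k => Yn k (a *: x + y)))//; apply/funext => k; rewrite Yn_lin.
exists Y; split=> //.
- move=> x y; apply: (hcvg_adjoint (HY x) (HY y)) => k.
  elim: k x y => [|k IH] x y /=; first by rewrite (ip0l ipP) (ip0r ipP).
  rewrite (ipZl ipP) (ipZr ipP) (ipDl ipP) (ipDr ipP) Zadj !IH.
  by congr (_ * _); exact/esym/conj_realC.
- move=> x.
  have H1 : hcvg (fun k => Yn k.+1 x) (Y x).
    by move=> e e0; have [N HN] := HY x e e0; exists N => k Nk; apply: HN; exact: leqW.
  have H2 : hcvg (fun k => Z x + Yn k (Yn k x)) (Z x + Y (Y x)).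
    apply: (hcvgD ipP); first exact: (hcvg_cst ipP).
    move=> e e0; have e2 : 0 < e / 2 by rewrite divr_gt0.
    have [N HN] := HY x _ e2; have [N' HN'] := HY (Y x) _ e2.
    exists (maxn N N') => k; rewrite geq_max => /andP[/HN h1 /HN' h2].
    apply: le_lt_trans (hnorm_triB ipP _ (Yn k (Y x)) _) _.
    have : hn (Yn k (Yn k x) - Yn k (Y x)) <= hn (Yn k x - Y x).
      by rewrite -(linopB (@Yn_lin _)).
    lra.
  have E := hcvg_unique ipP H1 (hcvgZ ipP (2^-1 : R)%:C H2); rewrite {1 2}E.
  rewrite -scalerDl [X in X *: _](_ : _ = 1) ?scale1r//.
  by apply: complexP => /=; lra.
- move=> S K Slin SK SZ x; apply: (hcvg_unique ipP (u := fun k => S (Yn k x))).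
    exact: (hcvg_bounded (linopB Slin) SK (HY x)).
  have -> : (fun k => S (Yn k x)) = (fun k => Yn k (S x)); last exact: HY.
  apply/funext => k; elim: k x => [|k IH] x /=; first exact: linop0.
  by rewrite (linopZ Slin) (linopD Slin) SZ !IH.
Qed.

End SquareRoot.

(** If r > e > 0, Bernoulli's inequality makes (r / e)^k grow at least linearly, beyond D. The case
    e = 0 is decided by k = 1. *)
Lemma pow_le_ratio (R : realType) (r e D : R) : 0 <= r -> 0 <= e ->
  (forall k, r ^+ k <= D * e ^+ k) -> r <= e.
Proof.
move=> r0 e0 H; rewrite leNgt; apply/negP => er.
have [ez|eN] := eqVneq e 0.
  by have := H 1%N; rewrite ez expr1 expr0n /= mulr0 leNgt -{1}ez er.
have ep : 0 < e by rewrite lt_neqAle eq_sym eN.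
pose q := r / e; have q1 : 0 < q - 1 by rewrite subr_gt0 ltr_pdivlMr// mul1r.
have bern k : 1 + k%:R * (q - 1) <= q ^+ k.
  elim: k => [|k IH]; first by rewrite mul0r addr0.
  have : 0 <= k%:R * (q - 1) ^+ 2 by rewrite mulr_ge0// sqr_ge0.
  move=> h; rewrite exprS -natr1.
  have qk : q * (1 + k%:R * (q - 1)) <= q * q ^+ k by rewrite ler_wpM2l// divr_ge0.
  by apply: le_trans qk; lra.
have qD k : q ^+ k <= D by rewrite expr_div_n ler_pdivrMr ?exprn_gt0.
have [k hk] : exists k : nat, D / (q - 1) < k%:R.
  by exists (Num.trunc (`|D / (q - 1)|)).+1; rewrite (le_lt_trans (ler_norm _))// truncnS_gt.
rewrite ltr_pdivrMr// in hk.
have := qD k; have := bern k; lra.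
Qed.

(** * Spectral subspaces of a normal operator *)

Section Normal.
Variables (R : realType) (V : lmodType R[i]) (ip : V -> V -> R[i]).
Hypothesis ipP : is_inner_product ip.
Hypothesis hcomp : hcomplete ip.
Local Notation hn := (hnorm ip).
Local Notation rip := (rip ip).
Local Notation nrm2 := (nrm2 ip).
Local Notation hcvg := (hcvg ip).

(* For a normal B this is the range of the spectral projection of the closed
   disk of radius e; unlike the projection, the condition is visibly stable
   under every bounded operator commuting with B. *)
Definition specsub (B : V -> V) (e : R) (x : V) : Prop :=
  exists D : R, forall k, hn (iter k B x) <= D * e ^+ k.

Lemma specsub_comm B S (K e : R) x : 0 <= K ->
  (forall x, hn (S x) <= K * hn x) -> (forall x, S (B x) = B (S x)) ->
  specsub B e x -> specsub B e (S x).
Proof.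
move=> K0 SK SB [D HD]; exists (K * D) => k.
have -> : iter k B (S x) = S (iter k B x) by elim: k => //= k ->; rewrite SB.
by apply: le_trans (SK _) _; rewrite -mulrA ler_wpM2l.
Qed.

Variables B B' : V -> V.
Hypothesis Blin : linear_op B.
Hypothesis Badj : is_adjoint ip B B'.
Hypothesis Bnorm : forall x, B (B' x) = B' (B x).
Variable K : R.
Hypothesis K0 : 0 <= K.
Hypothesis BK : forall x, hn (B x) <= K * hn x.

Let B'lin : linear_op B'. Proof. exact: (adjoint_linear ipP Badj). Qed.
Let B'adj : is_adjoint ip B' B. Proof. exact: (adjoint_sym ipP Badj). Qed.

Lemma normal_hn x : hn (B' x) = hn (B x).
Proof. by rewrite /hnorm -Badj Bnorm B'adj. Qed.

Let B'K x : hn (B' x) <= K * hn x. Proof. by rewrite normal_hn. Qed.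

Lemma normal_iter_hn k x : hn (iter k B' x) = hn (iter k B x).
Proof.
elim: k x => //= k IH x; rewrite normal_hn.
have -> : B (iter k B' x) = iter k B' (B x).
  by elim: k {IH} => //= k <-; rewrite Bnorm.
by rewrite IH -iterSr.
Qed.

(** An operator S commuting with B need not obviously commute with B', but its adjoint commutes with
    B'. Since B and B' have the same growth subspaces, these are invariant under S and its adjoint
    alike. *)
Lemma specsub_adj e x : specsub B' e x <-> specsub B e x.
Proof. by split=> -[D HD]; exists D => k; have := HD k; rewrite normal_iter_hn. Qed.

Lemma rip_gram x y : rip (B' (B x)) y = rip (B x) (B y).
Proof. by rewrite !ripE B'adj. Qed.

(** Cauchy-Schwarz for the pair B' B x and x, together with |B' B x| = |B B x|. *)
Lemma normal_logconvex x : hn (B x) ^+ 2 <= hn x * hn (B (B x)).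
Proof.
rewrite (hnorm2 ipP) nrm2E -ripE -rip_gram mulrC -(normal_hn (B x)).
exact: (rip_le ipP).
Qed.

Lemma specsub_B e x : specsub B e x -> specsub B e (B x).
Proof. exact: (specsub_comm K0 BK). Qed.
Lemma specsub_B' e x : specsub B e x -> specsub B e (B' x).
Proof. by apply: (specsub_comm K0 B'K) => y; rewrite Bnorm. Qed.

(** The norms a_k = |B^k x| are log-convex, so their successive ratios increase and a_k >= a_0 (a_1
    / a_0)^k. Growth at most D e^k then forces a_1 / a_0 <= e. *)
Lemma specsub_le e x : 0 <= e -> specsub B e x -> hn (B x) <= e * hn x.
Proof.
move=> e0 [D HD]; pose a k := hn (iter k B x).
have a0 k : 0 <= a k by exact: hnorm_ge0.
have lc k : a k.+1 ^+ 2 <= a k * a k.+2 by exact: normal_logconvex.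
have [z|nz] := eqVneq (a 0%N) 0.
  have -> : x = 0 by exact: (hnorm_eq0 ipP z).
  by rewrite (linop0 Blin) (hnorm0 ipP) mulr0.
have ap : 0 < a 0%N by rewrite lt_neqAle eq_sym nz a0.
have cl k : a 1%N * a k <= a 0%N * a k.+1.
  elim: k => [|k IH]; first by rewrite mulrC.
  have [z|nz'] := eqVneq (a k.+1) 0; first by rewrite z mulr0 mulr_ge0.
  have ak : 0 < a k.+1 by rewrite lt_neqAle eq_sym nz' a0.
  rewrite -(ler_pM2r ak) -mulrA -expr2.
  apply: (@le_trans _ _ (a 1%N * (a k * a k.+2))); first by rewrite ler_wpM2l.
  have := ler_wpM2r (a0 k.+2) IH; lra.
rewrite -ler_pdivrMr// -/(a 0%N) -/(a 1%N).
apply: (@pow_le_ratio _ _ _ (D / a 0%N)) => // [|k]; first by rewrite divr_ge0.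
apply: (@le_trans _ _ (a k / a 0%N)); last first.
  by rewrite mulrAC ler_pM2r ?invr_gt0// HD.
elim: k => [|k IH]; first by rewrite expr0 divff.
rewrite exprS; apply: (@le_trans _ _ (a 1%N / a 0%N * (a k / a 0%N))).
  by rewrite ler_wpM2l// divr_ge0.
by rewrite mulrA ler_pM2r ?invr_gt0// mulrAC ler_pdivrMr// [leRHS]mulrC cl.
Qed.

Lemma specsub_iter e x : 0 <= e -> specsub B e x ->
  forall k, hn (iter k B x) <= hn x * e ^+ k.
Proof.
move=> e0 Hx k; have Hk j : specsub B e (iter j B x).
  by elim: j => //= j; exact: specsub_B.
elim: k => [|k IH]; first by rewrite mulr1.
rewrite iterS; apply: le_trans (specsub_le e0 (Hk k)) _.
by rewrite exprS mulrCA ler_wpM2l.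
Qed.

Lemma iter_bounded k x : hn (iter k B x) <= K ^+ k * hn x.
Proof.
elim: k => [|k IH]; first by rewrite mul1r.
by rewrite exprS -mulrA; apply: le_trans (BK _) _; rewrite ler_wpM2l.
Qed.

(** The mere existence of a constant D would not survive limits. By [specsub_iter] the constant can
    be taken to be |x|, which stays bounded along a convergent sequence. *)
Lemma specsub_closed e : 0 <= e -> closed_subspace ip (specsub B e).
Proof.
move=> e0; split.
  split.
    exists 0 => k; rewrite mul0r (linop0 (linop_iter Blin k)) (hnorm0 ipP) //.
  move=> a x y [D HD] [D' HD']; exists (Num.sqrt (cnorm2 a) * D + D') => k.
  rewrite (linop_iter Blin); apply: le_trans (hnorm_triangle ipP _ _) _.
  rewrite mulrDl lerD// (hnormZ ipP) -mulrA ler_wpM2l//; exact: sqrtr_ge0.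
move=> u l ul Hu; exists (hn l + 1) => k.
have h : hcvg (fun n => iter k B (u n)) (iter k B l).
  exact: (hcvg_bounded (linopB (linop_iter Blin k)) (iter_bounded k) ul).
have [N HN] := ul 1 ltr01.
apply: (hcvg_le_near ipP (N := N) h) => n /HN un.
apply: le_trans (specsub_iter e0 (Hu n) k) _.
apply: ler_wpM2r; first by rewrite exprn_ge0.
by have := hnorm_subl ipP (u n) l; lra.
Qed.

Lemma specsub_bound x : specsub B K x.
Proof. by exists (hn x) => k; rewrite mulrC iter_bounded. Qed.

Lemma specsub_mono e e' x : 0 <= e -> e <= e' -> specsub B e x -> specsub B e' x.
Proof.
move=> e0 ee Hx; exists (hn x) => k; apply: le_trans (specsub_iter e0 Hx k) _.
rewrite ler_wpM2l ?hnorm_ge0// lerXn2r// nnegrE//; exact: le_trans ee.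
Qed.

(** Let A1 be a small multiple of e^2 - B' B. The operator |A1| + A1, twice the positive part, maps
    everything into [specsub B e]. Being self-adjoint it kills every x orthogonal to that subspace,
    so A1 x = - |A1| x and the form of A1 is nonpositive at x. *)
Lemma specsub_perp e x : 0 <= e -> (forall y, specsub B e y -> ip x y = 0) ->
  e ^+ 2 * nrm2 x <= nrm2 (B x).
Proof.
move=> e0 Hx.
(* Scales e^2 - B' B, of norm at most e^2 + K^2, to a contraction; the 1 keeps the denominator
   positive. *)
pose c : R := (e ^+ 2 + K ^+ 2 + 1)^-1.
have cp : 0 < c by rewrite invr_gt0 ltr_wpDl// addr_ge0 ?sqr_ge0.
pose A1 y := c%:C *: ((e ^+ 2)%:C *: y - B' (B y)).
have A1lin : linear_op A1.
  move=> a y z; rewrite /A1 Blin B'lin.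
  rewrite [(e ^+ 2)%:C *: (_ + _)]scalerDr opprD addrACA.
  rewrite [_ *: (a *: y)]scalerA [_ * a]mulrC -[(a * _) *: y]scalerA -scalerBr [LHS]scalerDr.
  by congr (_ + _); rewrite !scalerA [_ * a]mulrC.
have A1adj : is_adjoint ip A1 A1.
  move=> y z; rewrite /A1 (ipZl ipP) (ipZr ipP) (ipBl ipP) (ipBr ipP) (ipZl ipP) (ipZr ipP).
  rewrite B'adj Badj; congr (_ * _ ); first exact/esym/conj_realC.
  by congr (_ * _ - _); exact/esym/conj_realC.
have A1le y : hn (A1 y) <= hn y.
  rewrite /A1 (hnormZr ipP) gtr0_norm// /c ler_pdivrMl; last first.
    by rewrite ltr_wpDl// addr_ge0 ?sqr_ge0.
  apply: le_trans (hnormB_le ipP _ _) _.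
  rewrite (hnormZr ipP) ger0_norm ?sqr_ge0//.
  have : hn (B' (B y)) <= K * (K * hn y) by apply: le_trans (B'K _) _; rewrite ler_wpM2l.
  have := hnorm_ge0 ip y; nra.
(* Chosen so that (1 - Y)^2 = 1 - Z = A1^2. *)
pose Z y := y - A1 (A1 y).
have Zlin : linear_op Z.
  by move=> a y z; rewrite /Z A1lin A1lin opprD addrACA scalerBr.
have Zadj : is_adjoint ip Z Z.
  by move=> y z; rewrite /Z (ipBl ipP) (ipBr ipP) !A1adj.
have Zle y : hn (Z y) <= hn y.
  rewrite (hnorm_le ipP) /Z (nrm2B ipP).
  have -> : rip y (A1 (A1 y)) = nrm2 (A1 y) by rewrite ripE -A1adj.
  have : nrm2 (A1 (A1 y)) <= nrm2 (A1 y) by rewrite -(hnorm_le ipP).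
  have := nrm2_ge0 ipP (A1 y); lra.
have [Y [Ylin Yadj Yle YY Ycomm]] := sqrt_op ipP hcomp Zlin Zadj Zle.
(* S is |A1|: it is positive because Y is a contraction. *)
pose S y := y - Y y.
have SS y : S (S y) = A1 (A1 y).
  rewrite /S (linopB Ylin) opprB.
  rewrite addrACA -opprD YY opprD addrACA subrr addr0 /Z opprB.
  by rewrite addrC subrK.
have S0 y : 0 <= rip (S y) y.
  rewrite ripE (ipBl ipP) cReD cReN -nrm2E -ripE subr_ge0.
  apply: le_trans (rip_le ipP _ _) _; rewrite -(hnorm2 ipP) expr2.
  by rewrite ler_wpM2r ?hnorm_ge0.
have YA1 y : A1 (Y y) = Y (A1 y).
  apply: (Ycomm A1 1) => //; first by move=> w; rewrite mul1r.
  by move=> w; rewrite /Z (linopB A1lin).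
have BA1 y : B (A1 y) = A1 (B y).
  by rewrite /A1 (linopZ Blin) (linopB Blin) (linopZ Blin) Bnorm.
have YB y : B (Y y) = Y (B y).
  by apply: (Ycomm B K) => // w; rewrite /Z (linopB Blin) !BA1.
have f1 y : rip (A1 y) y = c * (e ^+ 2 * nrm2 y - nrm2 (B y)).
  rewrite ripE /A1 (ipZl ipP) (ipBl ipP) (ipZl ipP) B'adj cReM !cReD cReN !cReM /=.
  rewrite -!nrm2E; ring.
have W_sub y : S y = A1 y -> specsub B e y.
  have Wle w : S w = A1 w -> hn (B w) <= e * hn w.
    move=> E; have := S0 w; rewrite E f1 pmulr_rge0// subr_ge0 => h.
    rewrite (hnorm_le_sqrt ipP) ?mulr_ge0 ?hnorm_ge0//.
    by rewrite exprMn (hnorm2 ipP).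
  move=> E; have E' k : S (iter k B y) = A1 (iter k B y).
    by elim: k => //= k IH; rewrite -BA1 -IH /S (linopB Blin) YB.
  exists (hn y) => k; elim: k => [|k IH]; first by rewrite mulr1.
  rewrite iterS; apply: le_trans (Wle _ (E' k)) _.
  by rewrite exprS mulrCA ler_wpM2l.
(* (S + A1) z lies in the subspace for every z, because S^2 = A1^2 gives S (S + A1) = A1 (S +
   A1). *)
have Sx : S x + A1 x = 0.
  apply: (ip_ext ipP) => z; rewrite (ip0l ipP).
  have Slin : linear_op S by move=> a u w; rewrite /S Ylin scalerBr opprD addrACA.
  have Sadj : is_adjoint ip S S by move=> u w; rewrite /S (ipBl ipP) (ipBr ipP) Yadj.
  rewrite (ipDl ipP) Sadj A1adj -(ipDr ipP); apply: Hx; apply: W_sub.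
  rewrite (linopD Slin) SS (linopD A1lin) addrC; congr (_ + _).
  by rewrite /S (linopB A1lin) YA1.
have := S0 x; have -> : S x = - A1 x by apply/eqP; rewrite -addr_eq0 Sx.
rewrite ripE (ipNl ipP) cReN -ripE f1 oppr_ge0 pmulr_rle0// subr_le0 //.
Qed.

Let gramadj x y : ip (B' (B x)) y = ip x (B' (B y)).
Proof. by rewrite B'adj Badj. Qed.

(** On the part of [specsub B e'] orthogonal to [specsub B e], the form of D = B' B - e^2 lies
    between 0 and k = e'^2 - e^2; a self-adjoint operator with such a form has norm at most k. *)
Lemma gram_block e e' q : 0 <= e -> e < e' -> specsub B e' q ->
  (forall y, specsub B e y -> ip q y = 0) ->
  nrm2 (B' (B q) - (e ^+ 2)%:C *: q) <= (e' ^+ 2 - e ^+ 2) ^+ 2 * nrm2 q.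
Proof.
move=> e0 ee Hq Pq; have e'0 : 0 <= e' by rewrite (le_trans e0)// ltW.
pose k := e' ^+ 2 - e ^+ 2.
have k0 : 0 < k by rewrite /k subr_gt0 ltrXn2r.
pose D z := B' (B z) - (e ^+ 2)%:C *: z.
pose Q z := specsub B e' z /\ forall y, specsub B e y -> ip z y = 0.
have [Ms _] := specsub_closed e'0.
have QZ a z w : Q z -> Q w -> Q (a *: z + w).
  move=> [h1 h2] [h3 h4]; split=> [|y Hy]; first exact: Ms.2.
  by rewrite (ipDl ipP) (ipZl ipP) h2// h4// mulr0 addr0.
have QD z : Q z -> Q (D z).
  move=> Hz; rewrite /D addrC -scaleNr; apply: QZ => //.
  split=> [|y Hy]; first by apply: specsub_B'; apply: specsub_B; case: Hz.
  by rewrite gramadj; apply: Hz.2; apply: specsub_B'; exact: specsub_B.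
have fE z : rip (D z) z = nrm2 (B z) - e ^+ 2 * nrm2 z.
  rewrite ripE (ipBl ipP) (ipZl ipP) B'adj cReD cReN cReM /= -!nrm2E; ring.
have f0 z : Q z -> 0 <= rip (D z) z.
  by move=> [_ h]; rewrite fE subr_ge0; exact: specsub_perp.
have fk z : Q z -> rip (D z) z <= k * nrm2 z.
  move=> [h _]; rewrite fE mulrBl lerB//.
  by have := specsub_le e'0 h; rewrite (hnorm_le_sqrt ipP) ?mulr_ge0 ?hnorm_ge0// exprMn (hnorm2 ipP).
have Dadj z w : ip (D z) w = ip z (D w).
  rewrite (ipBl ipP) (ipBr ipP) (ipZl ipP) (ipZr ipP) gramadj; congr (_ - _ * _).
  exact/esym/conj_realC.
have Qq : Q q by [].
have Qp := QD _ Qq; rewrite -/(D q).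
have [p pE] : exists p, D q = p by exists (D q).
rewrite pE in Qp *.
(* Positivity of the form at (D - k) q reads 2 k |D q|^2 <= <D p, p> + k^2 <p, q> with p = D q. Both
   terms on the right are then bounded by the upper estimate of the form. *)
have Qw : Q ((- k)%:C *: q + p) by exact: QZ.
have := f0 _ Qw.
have -> : D ((- k)%:C *: q + p) = (- k)%:C *: p + D p.
  have Dlin : linear_op D.
    move=> a z w; rewrite /D Blin B'lin scalerDr opprD addrACA scalerBr.
    by congr (_ - _ + _); rewrite !scalerA mulrC.
  by rewrite Dlin pE.
have -> : rip ((- k)%:C *: p + D p) ((- k)%:C *: q + p) =
    rip (D p) p - 2 * k * nrm2 p + k ^+ 2 * rip p q.
  rewrite ripE (ipDl ipP) !(ipDr ipP) !(ipZl ipP) !(ipZr ipP) (Dadj p q) pE.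
  rewrite !cReD !cReM /= !ripE -!nrm2E; ring.
have := fk _ Qq; rewrite pE => h1; have := fk _ Qp => h2 h3.
have k2 : 0 <= k ^+ 2 by exact: sqr_ge0.
have : k * nrm2 p <= k * (k ^+ 2 * nrm2 q).
  have := ler_wpM2l k2 h1; lra.
by rewrite ler_pM2l.
Qed.

(** B' B is the norm limit of Riemann sums of r^2 against the spectral projections of B for the
    disks of radius i / (k + 1), and each such sum preserves W. *)
Lemma gram_invariant (W : V -> Prop) : closed_subspace ip W ->
  (forall k i x, W x -> W (proj ip (specsub B (i%:R / k.+1%:R)) x)) ->
  forall x, W x -> W (B' (B x)).
Proof.
move=> [Ws Wc] HW x Wx.
have [M HM] : exists M : nat, K <= M%:R.
  by exists (Num.trunc K).+1; rewrite ltW// truncnS_gt.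
have approx k : exists2 y, W y & hn (B' (B x) - y) <= 2 * M%:R / k.+1%:R * hn x.
  pose e i : R := i%:R / k.+1%:R; pose P i := proj ip (specsub B (e i)).
  have e0 i : 0 <= e i by rewrite divr_ge0.
  have Mc i := specsub_closed (e0 i).
  have eS i : e i < e i.+1 by rewrite ltr_pM2r ?invr_gt0// ltr_nat.
  pose m := (k.+1 * M)%N.
  have em : e m = M%:R by rewrite /e /m natrM mulrC mulKf// pnatr_eq0.
  (* The variation of r^2 over one step of length 1 / (k + 1) inside [0, M]. *)
  pose kap : R := 2 * M%:R / k.+1%:R.
  have kap0 : 0 <= kap by rewrite divr_ge0// mulr_ge0.
  have ek i : (i < m)%N -> e i.+1 ^+ 2 - e i ^+ 2 <= kap.
    move=> im; rewrite subr_sqr.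
    have -> : e i.+1 - e i = k.+1%:R^-1 by rewrite /e -mulrBl -natrB// subSnn mul1r.
    rewrite mulrC ler_pM2r ?invr_gt0//.
    have h : e i.+1 <= M%:R by rewrite -em ler_pM2r ?invr_gt0// ler_nat.
    have := eS i; lra.
  (* The errors of the single blocks are mutually orthogonal, so their squares add up instead of
     accumulating. Keeping y in [specsub B (e i)] is what makes the next error orthogonal. At i = 0
     the subspace is the kernel of B. *)
  have step i : (i <= m)%N -> exists y, [/\ W y, specsub B (e i) y &
      nrm2 (B' (B (P i x)) - y) <= kap ^+ 2 * nrm2 (P i x)].
    elim: i => [_|i IH im].
      have Bz : B (P 0%N x) = 0.
        apply: (hnorm_eq0 ipP); apply/eqP; rewrite eq_le hnorm_ge0 andbT.
        by have := specsub_le (e0 0%N) (proj_in ipP hcomp (Mc 0%N) x); rewrite -/(P 0%N x) {1}/e !mul0r.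
      exists 0; split; [exact: subspace0 Ws|exact: subspace0 (Mc 0%N).1|].
      rewrite Bz (linop0 B'lin) subr0 (nrm20 ipP) mulr_ge0 ?sqr_ge0//; exact: nrm2_ge0.
    have [y [Wy My Hy]] := IH (ltnW im).
    pose q := P i.+1 x - P i x.
    have Mi : specsub B (e i) (P i x) by exact: proj_in.
    have Mi1 z : specsub B (e i) z -> specsub B (e i.+1) z by apply: specsub_mono => //; exact/ltW.
    have Mq : specsub B (e i.+1) q.
      by apply: (subspaceB (Mc _).1); [exact: proj_in|exact: Mi1].
    have Oq z : specsub B (e i) z -> ip q z = 0.
      move=> Mz; rewrite (_ : q = (x - P i x) - (x - P i.+1 x)).
        by rewrite (ipBl ipP) !proj_orth ?subr0//; exact: Mi1.
      by rewrite /q opprB [RHS]addrC addrA subrK.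
    exists (y + (e i ^+ 2)%:C *: q); split.
    - apply: (subspaceD Ws) => //; apply: (subspaceZ Ws).
      by apply: (subspaceB Ws); exact: HW.
    - by apply: (subspaceD (Mc _).1); [exact: Mi1|exact: (subspaceZ (Mc _).1)].
    - have E : P i.+1 x = P i x + q by rewrite /q addrC subrK.
      rewrite [in leRHS]E [nrm2 (P i x + q)](nrm2_pyth ipP); last by apply: (ip_eq0C ipP); apply: Oq.
      rewrite E (linopD Blin) (linopD B'lin) opprD addrACA (nrm2_pyth ipP); last first.
        apply: (ip_eq0C ipP).
        have Ma : specsub B (e i) (B' (B (P i x)) - y).
          by apply: (subspaceB (Mc _).1) => //; apply: specsub_B'; exact: specsub_B.
        rewrite (ipBl ipP) (ipZl ipP) (Oq _ Ma) mulr0 subr0 gramadj; apply: Oq.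
        by apply: specsub_B'; exact: specsub_B.
      rewrite mulrDr lerD//; apply: le_trans (gram_block (e0 i) (eS i) Mq Oq) _.
      rewrite ler_wpM2r ?nrm2_ge0// ler_sqr ?nnegrE//; first exact: ek.
      by rewrite subr_ge0 lerXn2r ?nnegrE// ltW.
  have [y [Wy _ Hy]] := step m (leqnn m).
  (* The last radius is M >= K, where the growth condition holds for every vector. *)
  exists y => //; move: Hy; rewrite /P (proj_id ipP hcomp (Mc m)); last first.
    by rewrite em; apply: specsub_mono HM _ => //; exact: specsub_bound.
  by rewrite (hnorm_le_sqrt ipP) ?mulr_ge0 ?hnorm_ge0// [(_ * hn x) ^+ 2]exprMn (hnorm2 ipP).
apply: (hclosed_approx ipP Wc) => e e0.
pose c := 2 * M%:R * hn x; have c0 : 0 <= c by rewrite !mulr_ge0 ?hnorm_ge0.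
have [k hk] : exists k : nat, c / e < k.+1%:R by exists (Num.trunc (c / e)); rewrite truncnS_gt.
have [y Wy hy] := approx k; exists y => //; apply: le_lt_trans hy _.
rewrite mulrAC ltr_pdivrMr//; move: hk; rewrite ltr_pdivrMr//.
by rewrite mulrC.
Qed.

End Normal.

(** * Recovering a normal operator from the squares of its shifts *)

Section NormalContraction.
Variables (R : realType) (V : lmodType R[i]) (ip : V -> V -> R[i]).
Hypothesis ipP : is_inner_product ip.
Hypothesis hcomp : hcomplete ip.
Local Notation hn := (hnorm ip).

Variables N N' : V -> V.
Hypothesis Nlin : linear_op N.
Hypothesis Nadj : is_adjoint ip N N'.
Hypothesis Nnorm : forall x, N (N' x) = N' (N x).
Hypothesis Nle : forall x, hn (N x) <= hn x.

Definition shift_op (A : V -> V) (c : R[i]) (x : V) : V := A x - c *: x.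

Lemma shift_linear c : linear_op (shift_op N c).
Proof.
move=> a x y; rewrite /shift_op Nlin scalerDr opprD addrACA scalerBr.
by rewrite !scalerA mulrC.
Qed.
Lemma shift_adj c : is_adjoint ip (shift_op N c) (shift_op N' c^*).
Proof.
by move=> x y; rewrite /shift_op (ipBl ipP) (ipBr ipP) (ipZl ipP) (ipZr ipP) Nadj; congr (_ - _ * _); apply: complexP; rewrite !ReImE ?opprK.
Qed.
Let N'lin : linear_op N'. Proof. exact: (adjoint_linear ipP Nadj). Qed.
Lemma shift_normal c x :
  shift_op N c (shift_op N' c^* x) = shift_op N' c^* (shift_op N c x).
Proof.
rewrite /shift_op (linopB Nlin) (linopB N'lin) Nnorm (linopZ Nlin) (linopZ N'lin).
rewrite !scalerBr !scalerA -!addrA; congr (_ + _); rewrite !opprB !addrA [_ * c]mulrC.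
by rewrite -!addrA addrCA addrA addrC.
Qed.
Lemma shift_bound c x : hn (shift_op N c x) <= (1 + Num.sqrt (cnorm2 c)) * hn x.
Proof.
rewrite mulrDl mul1r; apply: le_trans (hnormB_le ipP _ _) _.
by rewrite (hnormZ ipP) lerD.
Qed.

Definition spec_shift (k : 'I_3) : R[i] := nth 0 [:: 0; 1; 'i%C] k.

(* N is a combination of 1 and the |N - c|^2 with c = 0, 1, i. *)
Lemma normal_invariant (W : V -> Prop) : closed_subspace ip W ->
  (forall (c : 'I_3) k i x, W x ->
     W (proj ip (specsub ip (shift_op N (spec_shift c)) (i%:R / k.+1%:R)) x)) ->
  forall x, W x -> W (N x).
Proof.
move=> Wc HW x Wx; have Ws := Wc.1.
have G (c : 'I_3) : W (shift_op N' (spec_shift c)^* (shift_op N (spec_shift c) x)).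
  have K0 : 0 <= 1 + Num.sqrt (cnorm2 (spec_shift c)) by rewrite addr_ge0// sqrtr_ge0.
  exact: (gram_invariant ipP hcomp (shift_linear _) (shift_adj _) (shift_normal _)
    K0 (shift_bound _) Wc (HW c)).
have G0 := G (inord 0); have G1 := G (inord 1); have G2 := G (inord 2).
move: G0 G1 G2; rewrite /spec_shift !inordK// /=.
set g0 := shift_op _ _ _; set g1 := shift_op _ _ _; set g2 := shift_op _ _ _ => G0 G1 G2.
have E0 : g0 = N' (N x).
  rewrite /g0 /shift_op scale0r subr0 [X in _ - X *: _](_ : _ = 0) ?scale0r ?subr0//.
  by apply: complexP => /=; rewrite ?oppr0.
have E1 : g1 = g0 - N' x - N x + x.
  rewrite /g1 E0 /shift_op scale1r (linopB N'lin) [X in _ - X *: _](_ : _ = 1).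
    by rewrite scale1r opprB addrA addrAC.
  by apply: complexP => /=; rewrite ?oppr0.
have E2 : g2 = g0 - 'i%C *: N' x + 'i%C *: N x + x.
  rewrite /g2 E0 /shift_op (linopB N'lin) (linopZ N'lin).
  rewrite [X in _ - X *: _](_ : _ = - 'i%C); last by apply: complexP => /=; rewrite ?oppr0.
  rewrite scaleNr opprK scalerBr scalerA.
  rewrite (_ : 'i%C * 'i%C = -1); last by apply: complexP => /=; lra.
  by rewrite scaleN1r opprK addrA.
clearbody g0 g1 g2.
have -> : N x = (2^-1 : R)%:C *: ((g0 - g1 + x) + (- 'i%C) *: (g2 - g0 - x)).
  have -> : g0 - g1 + x = N' x + N x.
    by rewrite E1 !opprD !opprK !addrA subrr add0r subrK.
  have -> : g2 - g0 - x = 'i%C *: N x - 'i%C *: N' x.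
    rewrite E2 addrAC addrK -!addrA addrC -!addrA addNr addr0.
    by rewrite addrC.
  rewrite scalerBr !scalerA (_ : - 'i%C * 'i%C = 1); last by apply: complexP => /=; lra.
  rewrite !scale1r [N' x + N x]addrC addrACA subrr addr0 -mulr2n -[N x *+ 2]scaler_nat scalerA.
  rewrite (_ : _ * _ = 1) ?scale1r//.
  by apply: complexP => /=; lra.
apply: (subspaceZ Ws); apply: (subspaceD Ws).
  by apply: (subspaceD Ws) => //; exact: (subspaceB Ws).
by apply: (subspaceZ Ws); apply: (subspaceB Ws) => //; exact: (subspaceB Ws).
Qed.

End NormalContraction.

(** * A countable commuting family of spectral projections *)

Section SpectralFamily.
Variables (R : realType) (V : lmodType R[i]) (ip : V -> V -> R[i]).
Hypothesis ipP : is_inner_product ip.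
Hypothesis hcomp : hcomplete ip.
Local Notation hn := (hnorm ip).

Lemma specproj_comm N N' S S' (c : R[i]) (e : R) :
  linear_op N -> is_adjoint ip N N' -> (forall x, N (N' x) = N' (N x)) ->
  (forall x, hn (N x) <= hn x) ->
  linear_op S -> is_adjoint ip S S' -> (forall x, hn (S x) <= hn x) ->
  (forall x, hn (S' x) <= hn x) -> (forall x, S (N x) = N (S x)) -> 0 <= e ->
  forall x, proj ip (specsub ip (shift_op N c) e) (S x) =
            S (proj ip (specsub ip (shift_op N c) e) x).
Proof.
move=> Nl Na Nn Nle Sl Sa Sle S'le SN e0.
have K0 : 0 <= 1 + Num.sqrt (cnorm2 c) by rewrite addr_ge0// sqrtr_ge0.
have Mc := specsub_closed ipP (shift_linear Nl c) (shift_adj ipP Na c)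
  (shift_normal ipP Nl Na Nn c) K0 (shift_bound ipP Nle c) e0.
apply: (proj_comm ipP hcomp Mc Sl Sa) => x Mx.
  apply: (specsub_comm ler01 _ _ Mx) => y; first by rewrite mul1r.
  by rewrite /shift_op (linopB Sl) (linopZ Sl) SN.
have adjE := specsub_adj ipP (shift_adj ipP Na c) (shift_normal ipP Nl Na Nn c).
apply/(adjE e); move/(adjE e): Mx.
have S'l := adjoint_linear ipP Sa.
apply: (specsub_comm ler01) => y; first by rewrite mul1r.
rewrite /shift_op (linopB S'l) (linopZ S'l); congr (_ - _).
by apply: (ip_extr ipP) => z; rewrite -Sa -!Na -Sa SN.
Qed.

Variable I : countType.
Variable N : I -> V -> V.
Hypothesis Nlin : forall i, linear_op (N i).
Hypothesis Nnor : forall i, normal_op ip (N i).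
Hypothesis Nle : forall i x, hn (N i x) <= hn x.
Hypothesis Ncomm : forall i j x, N i (N j x) = N j (N i x).

Lemma spectral_family : exists P : nat -> V -> V,
  [/\ forall k, is_oproj ip (P k),
      forall k l x, P k (P l x) = P l (P k x),
      forall k i x, P k (N i x) = N i (P k x) &
      forall W, closed_subspace ip W -> (forall k x, W x -> W (P k x)) ->
        forall i x, W x -> W (N i x)].
Proof.
have /choice [N' HN'] := Nnor.
have Nadj i : is_adjoint ip (N i) (N' i) by case: (HN' i).
have Nn i x : N i (N' i x) = N' i (N i x) by case: (HN' i).
have N'le i x : hn (N' i x) <= hn x by rewrite (normal_hn ipP (Nadj i) (Nn i)).
pose M (t : I * 'I_3 * nat * nat) :=
  let: (i, c, q, j) := t in specsub ip (shift_op (N i) (spec_shift R c)) (j%:R / q.+1%:R).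
have e0 (q j : nat) : (0 : R) <= j%:R / q.+1%:R by rewrite divr_ge0.
have Mc t : closed_subspace ip (M t).
  case: t => [[[i c] q] j]; set z := spec_shift R c.
  have K0 : 0 <= 1 + Num.sqrt (cnorm2 z) by rewrite addr_ge0// sqrtr_ge0.
  exact: (specsub_closed ipP (shift_linear (Nlin i) _) (shift_adj ipP (Nadj i) _)
    (shift_normal ipP (Nlin i) (Nadj i) (Nn i) _) K0 (shift_bound ipP (Nle i) _)).
have MN t i x : proj ip (M t) (N i x) = N i (proj ip (M t) x).
  case: t => [[[j c] q] k].
  by apply: (specproj_comm (N' := N' j) (S' := N' i)).
have MM t s x : proj ip (M t) (proj ip (M s) x) = proj ip (M s) (proj ip (M t) x).
  have Os := proj_oproj ipP hcomp (Mc s); have [Ol _ Oa] := Os.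
  case: t => [[[j c] q] k].
  apply: (specproj_comm (N' := N' j) (S' := proj ip (M s))) => //.
  - exact: (oproj_le ipP Os).
  - exact: (oproj_le ipP Os).
(* Numbers that code no parameter receive the identity, which is harmless for every clause. *)
pose P k x := if unpickle k is Some t then proj ip (M t) x else x.
exists P; split.
- move=> k; rewrite /P; case: unpickle => [t|]; first exact: proj_oproj.
  by split.
- by move=> k l x; rewrite /P; case: unpickle => [t|//]; case: unpickle => [s|//].
- by move=> k i x; rewrite /P; case: unpickle.
- move=> W Wc HW i x Wx.
  apply: (normal_invariant ipP hcomp (Nlin i) (Nadj i) (Nn i) (Nle i) Wc) => // c q j y Wy.
  by have := HW (pickle (i, c, q, j)) y Wy; rewrite /P pickleK.
Qed.

End SpectralFamily.

(** * The tree of products of projections and its interval model *)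

Section Tree.
Variables (R : realType) (V : lmodType R[i]) (ip : V -> V -> R[i]).
Hypothesis ipP : is_inner_product ip.
Local Notation hn := (hnorm ip).
Local Notation nrm2 := (nrm2 ip).

Variable P : nat -> V -> V.
Hypothesis Pproj : forall k, is_oproj ip (P k).
Hypothesis Pcomm : forall k l x, P k (P l x) = P l (P k x).

Definition branch (k : nat) (b : bool) (x : V) : V := if b then P k x else x - P k x.

(** The parameter k is the depth of the root, so that a subtree is an instance of the same
    definition. *)
Fixpoint treeproj (k : nat) (p : seq bool) (x : V) : V :=
  if p is b :: q then treeproj k.+1 q (branch k b x) else x.

(* [treeproj k p x] is represented by the indicator of a subinterval of
   [0, |x|^2[ of length |treeproj k p x|^2: the left child of a node gets the
   left part of the interval of the node. *)
Fixpoint tree_start (k : nat) (p : seq bool) (x : V) : R :=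
  if p is b :: q then
    (if b then nrm2 (branch k false x) else 0) + tree_start k.+1 q (branch k b x)
  else 0.

Definition tree_itv (k : nat) (p : seq bool) (x : V) : set R :=
  [set r : R | tree_start k p x <= r < tree_start k p x + nrm2 (treeproj k p x)].

Local Notation E := treeproj.
Local Notation br := branch.

Let PL k : linear_op (P k). Proof. by case: (Pproj k). Qed.

Lemma branch_oproj k b : is_oproj ip (br k b).
Proof. by case: b; [exact: Pproj|exact: (oprojC ipP)]. Qed.
Let brL k b : linear_op (br k b). Proof. by case: (branch_oproj k b). Qed.

Lemma branch_comm S k b x : linear_op S -> (forall k x, P k (S x) = S (P k x)) ->
  br k b (S x) = S (br k b x).
Proof. by move=> Sl H; case: b => //=; rewrite /br (linopB Sl) H. Qed.

Lemma treeproj_comm S k p x : linear_op S -> (forall k x, P k (S x) = S (P k x)) ->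
  E k p (S x) = S (E k p x).
Proof. by move=> Sl H; elim: p k x => //= b p IH k x; rewrite branch_comm// IH. Qed.

Lemma branchP k b l x : P l (br k b x) = br k b (P l x).
Proof. by rewrite (branch_comm (S := P l))//; exact: PL. Qed.

Lemma branch_treeproj k b l p x : E l p (br k b x) = br k b (E l p x).
Proof. by apply: treeproj_comm => // j y; exact: branchP. Qed.

Lemma treeproj_oproj k p : is_oproj ip (E k p).
Proof.
elim: p k => [|b p IH] k; first by split.
have [l i a] := IH k.+1; have [bl bi ba] := branch_oproj k b.
split=> [c x y|x|x y] /=.
- by rewrite bl l.
- by rewrite !branch_treeproj i bi.
- by rewrite a ba branch_treeproj.
Qed.

Lemma branch_nrm2 k x : nrm2 x = nrm2 (br k false x) + nrm2 (br k true x).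
Proof. by rewrite addrC (oproj_nrm2 ipP (Pproj k)). Qed.

Lemma branch_orth k b x : br k b (br k (~~ b) x) = 0.
Proof.
have [_ i _] := Pproj k.
by case: b; rewrite /br /= ?(linopB (PL k)) i subrr ?subr0.
Qed.

Lemma tree_start_ge0 k p x : 0 <= tree_start k p x.
Proof.
elim: p k x => //= b p IH k x; rewrite addr_ge0//.
by case: b => //; exact: nrm2_ge0.
Qed.

Lemma tree_end_le k p x : tree_start k p x + nrm2 (E k p x) <= nrm2 x.
Proof.
elim: p k x => [|b p IH] k x /=; first by rewrite add0r.
rewrite (branch_nrm2 k x) -addrA; apply: le_trans (lerD (lexx _) (IH _ _)) _.
by case: b; rewrite ?add0r// lerDl; exact: nrm2_ge0.
Qed.

Lemma tree_itvP k p x r :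
  tree_itv k p x r <-> tree_start k p x <= r < tree_start k p x + nrm2 (E k p x).
Proof. by []. Qed.

Lemma tree_itv_cons k b p x r : tree_itv k (b :: p) x r <->
  tree_itv k.+1 p (br k b x) (r - (if b then nrm2 (br k false x) else 0)).
Proof.
rewrite !tree_itvP /=; set c := if b then _ else _.
by split=> /andP[h1 h2]; apply/andP; split; lra.
Qed.

Lemma tree_itv_sub k p x r : tree_itv k p x r -> 0 <= r < nrm2 x.
Proof.
move=> /tree_itvP/andP[h1 h2]; have := tree_start_ge0 k p x; have := tree_end_le k p x.
by move=> h3 h4; apply/andP; split; lra.
Qed.

(** Either one path is a prefix of the other, or at their first disagreement they use complementary
    projections and disjoint parts of an interval. Products of projections thus follow intersections
    of intervals, which is what makes inner products equal to measures. *)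
Lemma tree_trichotomy k p q x :
  [\/ tree_itv k p x `<=` tree_itv k q x /\ E k p (E k q x) = E k p x,
      tree_itv k q x `<=` tree_itv k p x /\ E k p (E k q x) = E k q x |
      tree_itv k p x `&` tree_itv k q x = set0 /\ E k p (E k q x) = 0].
Proof.
elim: p k q x => [|b p IH] k q x.
  apply: Or32; split=> // r /tree_itv_sub h; apply/tree_itvP.
  by rewrite /= add0r.
case: q => [|b' q].
  apply: Or31; split=> // r /tree_itv_sub h; apply/tree_itvP.
  by rewrite /= add0r.
have [<-|bb] := eqVneq b b'.
  have EE : E k (b :: p) (E k (b :: q) x) = E k.+1 p (E k.+1 q (br k b x)).
    by rewrite /= -branch_treeproj; case: (branch_oproj k b) => _ -> _.
  rewrite EE /=; set y := br k b x.
  have [[h1 h2]|[h1 h2]|[h1 h2]] := IH k.+1 q y.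
  - by apply: Or31; split=> // r /tree_itv_cons h; apply/tree_itv_cons; exact: h1.
  - by apply: Or32; split=> // r /tree_itv_cons h; apply/tree_itv_cons; exact: h1.
  - apply: Or33; split=> //; rewrite -subset0 => r [/tree_itv_cons a1 /tree_itv_cons a2].
    by have : set0 (r - (if b then nrm2 (br k false x) else 0)) by rewrite -h1.
apply: Or33; split.
  rewrite -subset0 => r [/tree_itv_cons/tree_itv_sub a1 /tree_itv_cons/tree_itv_sub a2].
  case: b b' bb a1 a2 => -[] //= _ /andP[h1 h2] /andP[h3 h4].
  - by move: h1 h4; rewrite !subr0; lra.
  - by move: h2 h3; rewrite !subr0; lra.
rewrite /= -branch_treeproj (_ : b' = ~~ b) ?branch_orth; last by case: b b' bb => -[].
have [l1 _ _] := treeproj_oproj k.+1 q; have [l2 _ _] := treeproj_oproj k.+1 p.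
by rewrite (linop0 l1) (linop0 l2).
Qed.

(* Zorn: a maximal family of vectors generating mutually orthogonal cyclic subspaces. *)
Lemma max_orth_family : exists S : set V,
  (forall u v p, S u -> S v -> u != v -> ip u (E 0 p v) = 0) /\
  (forall w, (forall v p, S v -> ip w (E 0 p v) = 0) -> w = 0).
Proof.
pose good (S : set V) := forall u v p, S u -> S v -> u != v -> ip u (E 0 p v) = 0.
have [S [gS mS]] : exists S, good S /\ forall B, S `<` B -> ~ good B.
  apply: Zorn_bigcup => F gF totF u v p [A FA Au] [B FB Bv] uv.
  have [AB|BA] := totF _ _ FA FB.
  - by apply: (gF B) => //; exact: AB.
  - by apply: (gF A) => //; exact: BA.
exists S; split=> // w Hw.
(* If w is already in S, the empty path gives <w, w> = 0; otherwise adjoining w would contradict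
   maximality. *)
have [Sw|Sw] := pselect (S w).
  apply: (nrm2_eq0 ipP); rewrite nrm2E.
  by rewrite (_ : ip w w = 0)//; exact: (Hw w [::] Sw).
exfalso; apply: (mS (S `|` [set w])).
  split; first by move=> v; left.
  by move=> H; apply: Sw; apply: H; right.
have sym v p : S v -> ip v (E 0 p w) = 0.
  move=> Sv; have [_ _ a] := treeproj_oproj 0 p.
  by rewrite -a; apply: (ip_eq0C ipP); exact: Hw.
move=> u v p [Su|->] [Sv|->] uv.
- exact: gS.
- exact: sym.
- exact: Hw.
- by rewrite eqxx in uv.
Qed.

End Tree.

(** * Disjoint unions of Lebesgue spaces *)

(* The disjoint union over j of copies of R, the j-th one being equipped with
   the sub-sigma-algebra <<s G j>> of the Borel sets *)
Definition bundle (J : choiceType) (j0 : J) (R : realType) (G : J -> set (set R)) : Type :=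
  (J * R)%type.

Section Bundle.
Variables (J : choiceType) (j0 : J) (R : realType) (G : J -> set (set R)).
Local Notation X := (bundle j0 G).

HB.instance Definition _ := Choice.copy X (J * R)%type.
HB.instance Definition _ := isPointed.Build X (j0, 0).

Definition slice (A : set X) (j : J) : set R := [set r | A (j, r)].

Definition bundle_measurable : set (set X) := [set A | forall j, <<s G j >> (slice A j)].

Let bm0 : bundle_measurable set0.
Proof. by move=> j; exact: sigma_algebra0. Qed.
Let bmC A : bundle_measurable A -> bundle_measurable (~` A).
Proof.
move=> mA j; rewrite (_ : slice (~` A) j = setT `\` slice A j); last by rewrite setTD.
by apply: sigma_algebraCD; exact: mA.
Qed.
Let bmU (F : (set X)^nat) : (forall i, bundle_measurable (F i)) ->
  bundle_measurable (\bigcup_i (F i)).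
Proof.
move=> mF j; rewrite (_ : slice _ j = \bigcup_i slice (F i) j).
  by apply: sigma_algebra_bigcup => i; exact: mF.
by apply/seteqP; split=> r [i _ h]; exists i.
Qed.

HB.instance Definition _ := @isMeasurable.Build default_measure_display X
  bundle_measurable bm0 bmC bmU.

Lemma bundle_measurableE (A : set X) : measurable A = forall j, <<s G j >> (slice A j).
Proof. by []. Qed.

(** Measurability imposes no condition linking different fibres, so one function per index can be
    glued along the fibres even when there are uncountably many indices. *)
Lemma measurable_diag d (T : measurableType d) (F : J -> X -> T) :
  (forall j, measurable_fun setT (F j)) -> measurable_fun setT (fun x : X => F x.1 x).
Proof.
move=> mF _ Y mY; rewrite setTI bundle_measurableE => j.
have := mF j measurableT Y mY; rewrite setTI bundle_measurableE => /(_ j).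
by congr (<<s G j >> _); apply/seteqP.
Qed.

Hypothesis Gmeas : forall j A, G j A -> measurable (A : set (measurableTypeR R)).

Lemma slice_measurable (A : set X) j : measurable A ->
  measurable (slice A j : set (measurableTypeR R)).
Proof.
move=> /(_ j); apply: smallest_sub; last by move=> B; exact: Gmeas.
exact: sigma_algebra_measurable.
Qed.

Variable S : set J.
Variable D : J -> set R.
Hypothesis GD : forall j, G j (D j).

(** Every fibre is a full copy of R, which keeps the carrier a plain product; mass is carried only
    by the indices in S and, over each of them, by [D j]. *)
Definition bundle_measure (A : set X) : \bar R :=
  \esum_(j in S) lebesgue_measure (slice A j `&` D j).

Let mu0 : bundle_measure set0 = 0%E.
Proof.
rewrite /bundle_measure esum1// => j _.
by rewrite (_ : slice set0 j = set0)// set0I measure0.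
Qed.
Let mu_ge0 A : (0 <= bundle_measure A)%E.
Proof. by apply: esum_ge0 => j _; exact: measure_ge0. Qed.
Let mu_sigma : semi_sigma_additive bundle_measure.
Proof.
move=> F mF tF mU.
have -> : bundle_measure (\bigcup_n F n) = (\sum_(n <oo) bundle_measure (F n))%E.
  rewrite nneseries_esumT// /bundle_measure esum_esum; last by move=> *; exact: measure_ge0.
  (* Swapping the pairs exchanges the countable sum with the possibly uncountable one; all terms are
     nonnegative. *)
  rewrite (reindex_esum (S `*`` (fun=> [set: nat])) _ (fun p => (p.2, p.1))); last first.
    split=> [[j n] []//|[j n] [j' n'] _ _ /= [-> ->]//|[n j] [] /= _ Sj].
    by exists (j, n).
  rewrite -(esum_esum (J := fun=> setT)
    (a := fun j n => lebesgue_measure (slice (F n) j `&` D j))); last by move=> *; exact: measure_ge0.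
  apply: eq_esum => j Sj; rewrite -nneseries_esumT; last by move=> n; exact: measure_ge0.
  rewrite (_ : slice _ j `&` D j = \bigcup_n (slice (F n) j `&` D j)); last first.
    by apply/seteqP; split=> [r [[i _ h] h']|r [i _ [h h']]]; [exists i|split=> //; exists i].
  rewrite measure_bigcup//.
  - by apply: eq_eseriesl => i; rewrite in_setT.
  - by move=> n _; apply: measurableI; [exact: slice_measurable|exact: (Gmeas (GD j))].
  - apply/trivIsetP => i k _ _ ik; have /trivIsetP/(_ i k Logic.I Logic.I ik) h := tF.
    rewrite -subset0 => r [[h1 _] [h2 _]].
    by have : (F i `&` F k) (j, r) by []; rewrite h.
exact: is_cvg_nneseries.
Qed.

HB.instance Definition _ := isMeasure.Build _ _ _ bundle_measure mu0 mu_ge0 mu_sigma.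

Definition bundle_mu : {measure set X -> \bar R} := bundle_measure.

Hypothesis Dfin : forall j, (lebesgue_measure (D j) < +oo)%E.

Lemma bundle_measure_fiber j (A : set R) : S j -> <<s G j >> A ->
  bundle_measure ([set j] `*` A) = lebesgue_measure (A `&` D j).
Proof.
move=> Sj mA; rewrite /bundle_measure (esumID [set j]); last by move=> *; exact: measure_ge0.
have -> : S `&` [set j] = [set j] by apply/setIidPr => _ ->.
rewrite esum_set1 ?measure_ge0// (_ : slice _ j = A); last first.
  by apply/seteqP; split=> [r []|r].
rewrite esum1 ?adde0// => i [_ /= ij].
by rewrite (_ : slice _ i = set0) ?set0I ?measure0// -subset0 => r [] /= /ij.
Qed.

Lemma measurable_fiber j (A : set R) : <<s G j >> A -> measurable ([set j] `*` A : set X).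
Proof.
move=> mA; rewrite bundle_measurableE => i; have [->|ij] := eqVneq i j.
  by rewrite (_ : slice _ j = A)//; apply/seteqP; split=> [r []|r].
rewrite (_ : slice _ i = set0); first exact: sigma_algebra0.
by rewrite -subset0 => r [] /= e _; rewrite e eqxx in ij.
Qed.

Lemma bundle_measure0P (A : set X) : (bundle_measure A = 0%E) <->
  forall j, S j -> lebesgue_measure (slice A j `&` D j) = 0%E.
Proof.
split=> [A0 j Sj|H]; last by rewrite /bundle_measure esum1.
apply/eqP; rewrite eq_le measure_ge0 andbT -A0; apply: esum_ge.
exists [set j]; first by split=> // _ ->.
by rewrite fsbig_set1.
Qed.

(** A set of nonzero measure has a slice of nonzero measure, and a single fibre has finite mass. *)
Lemma bundle_semifinite : semifinite bundle_mu.
Proof.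
move=> A mA Aoo.
have [j [Sj Aj]] : exists j, S j /\ lebesgue_measure (slice A j `&` D j) != 0%E.
  apply: contrapT => /forallNP H.
  have : bundle_measure A = 0%E.
    by apply/bundle_measure0P => j Sj; apply/eqP/negPn/negP => h; apply: (H j).
  by rewrite Aoo.
exists ([set j] `*` slice A j); split.
- exact: measurable_fiber.
- by move=> [i r] [] /= -> .
- suff: (0 < bundle_measure ([set j] `*` slice A j) < +oo)%E by [].
  rewrite bundle_measure_fiber// lt_neqAle eq_sym Aj measure_ge0 /=.
  apply: le_lt_trans (Dfin j); apply: le_measure; rewrite ?inE.
  + by apply: measurableI; [exact: slice_measurable|exact: (Gmeas (GD j))].
  + exact: (Gmeas (GD j)).
  + exact: subIsetr.
Qed.

(** A finite sum of nonnegative terms is nearly exhausted by finitely many indices; this reduces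
    surjectivity onto L^2 to finitely many fibres. *)
Lemma bundle_measure_finite_approx (A : set X) (e : R) : measurable A -> 0 < e ->
  (bundle_measure A < +oo)%E -> exists2 F : set J, finite_set F /\ F `<=` S &
    (bundle_measure (A `\` (F `*` setT)) < e%:E)%E.
Proof.
move=> mA e0 Afin; pose a j := lebesgue_measure (slice A j `&` D j).
have a0 j : (0 <= a j)%E by exact: measure_ge0.
have fA : bundle_measure A \is a fin_num by rewrite ge0_fin_numE.
have [_ [F [Ff FS] <-] hF] := ub_ereal_sup_adherent e0 fA.
have {}hF : (bundle_measure A - e%:E < \sum_(j \in F) a j)%E by exact: hF.
exists F => //.
have E1 : bundle_measure A = (\esum_(j in S `&` F) a j + \esum_(j in S `&` ~` F) a j)%E.
  by rewrite /bundle_measure (esumID F).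
have E2 : bundle_measure (A `\` (F `*` setT)) = \esum_(j in S `&` ~` F) a j.
  rewrite esum_mkcondr; apply: eq_esum => j Sj; case: ifPn; rewrite ?inE ?notin_setE /= => jF.
    rewrite /a; congr (lebesgue_measure (_ `&` _)); apply/seteqP; split=> [r []//|r h].
    by split=> // -[].
  rewrite (_ : slice _ j = set0) ?set0I ?measure0// -subset0 => r [_ h]; apply: h.
  by split=> //=; exact: contrapT.
have E3 : \esum_(j in S `&` F) a j = (\sum_(j \in F) a j)%E.
  by rewrite (_ : S `&` F = F) ?esum_fset//; apply/setIidPr.
rewrite E2; move: hF; rewrite E1 E3.
have f1 : (\sum_(j \in F) a j)%E \is a fin_num.
  rewrite -E3 ge0_fin_numE ?esum_ge0//; apply: le_lt_trans Afin; rewrite E1.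
  by rewrite leeDl// esum_ge0.
have f2 : \esum_(j in S `&` ~` F) a j \is a fin_num.
  rewrite ge0_fin_numE ?esum_ge0//; apply: le_lt_trans Afin; rewrite E1.
  by rewrite leeDr// esum_ge0.
rewrite -(fineK f1) -(fineK f2) -!EFinD !lte_fin; lra.
Qed.

End Bundle.

(** * Square-integrable functions *)

(** With w_n = 2 C 2^-n, whose decrements are C 2^-n, the intervals [u_n - w_n, u_n + w_n] are
    nested; the limit is the supremum of their left ends. *)
Lemma geometric_limit (R : realType) (u : nat -> R) (C : R) :
  (forall n, `|u n.+1 - u n| <= C * 2^-1 ^+ n) ->
  exists l, forall n, `|u n - l| <= 2 * C * 2^-1 ^+ n.
Proof.
move=> H.
have C0 : 0 <= C by have := le_trans (normr_ge0 _) (H 0%N); rewrite expr0 mulr1.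
pose w n : R := 2 * C * 2^-1 ^+ n.
have wS n : w n.+1 = w n - C * 2^-1 ^+ n by rewrite /w exprS; field.
have w0 n : 0 <= w n by rewrite /w mulr_ge0 ?mulr_ge0 ?exprn_ge0 ?invr_ge0.
have hn n : - (C * 2^-1 ^+ n) <= u n.+1 - u n <= C * 2^-1 ^+ n by rewrite -ler_norml.
have lo m n : (m <= n)%N -> u m - w m <= u n - w n.
  elim: n => [|n IH]; first by rewrite leqn0 => /eqP ->.
  rewrite leq_eqVlt => /orP[/eqP -> //|mn]; apply: le_trans (IH mn) _.
  have /andP[] := hn n; rewrite wS; lra.
have hi m n : (m <= n)%N -> u n + w n <= u m + w m.
  elim: n => [|n IH]; first by rewrite leqn0 => /eqP ->.
  rewrite leq_eqVlt => /orP[/eqP -> //|mn]; apply: le_trans (IH mn).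
  have /andP[] := hn n; rewrite wS; lra.
have lohi m n : u m - w m <= u n + w n.
  have := lo _ _ (leq_maxl m n); have := hi _ _ (leq_maxr m n).
  have := w0 (maxn m n); lra.
pose S := [set u n - w n | n in [set: nat]].
have S1 : has_sup S.
  split; first by exists (u 0%N - w 0%N); exists 0%N.
  by exists (u 0%N + w 0%N) => _ [n _ <-].
exists (sup S) => n; rewrite ler_norml.
have h1 : u n - w n <= sup S by apply: sup_upper_bound => //; exists n.
have h2 : sup S <= u n + w n by apply: ge_sup; [exact: S1.1|move=> _ [m _ <-]].
by rewrite -/(w n); apply/andP; split; lra.
Qed.

Lemma geometric_limit_cvg (R : realType) (u : nat -> R) (l C : R) :
  (forall n, `|u n - l| <= C * 2^-1 ^+ n) -> u @ \oo --> l.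
Proof.
move=> H; apply/cvgrPdistC_lt => e e0.
have c0 : geometric C 2^-1 @ \oo --> (0 : R).
  by apply: cvg_geometric; rewrite ger0_norm ?invr_ge0// invf_lt1// ltr1n.
move/cvgrPdistC_lt : c0 => /(_ _ e0); apply: filterS => n /=; rewrite subr0 => h.
by apply: le_lt_trans (H n) _; apply: le_lt_trans h; exact: ler_norm.
Qed.

Section L2.
Context {d : measure_display} {X : measurableType d} {R : realType}.
Variable mu : {measure set X -> \bar R}.
Local Notation C := R[i].
Implicit Types f g : X -> C.

Definition l2 f : \bar R := (\int[mu]_x (cnorm2 (f x))%:E)%E.

Lemma cmeas_cst (a : C) : cmeasurable (fun _ : X => a).
Proof. by split; exact: measurable_cst. Qed.
Lemma cmeasD f g : cmeasurable f -> cmeasurable g -> cmeasurable (fun x => f x + g x).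
Proof.
move=> [f1 f2] [g1 g2]; split.
- by under eq_fun do rewrite cReD; exact: measurable_funD.
- by under eq_fun do rewrite cImD; exact: measurable_funD.
Qed.
Lemma cmeasM f g : cmeasurable f -> cmeasurable g -> cmeasurable (fun x => f x * g x).
Proof.
move=> [f1 f2] [g1 g2]; split.
- by under eq_fun do rewrite cReM; apply: measurable_funB; exact: measurable_funM.
- by under eq_fun do rewrite cImM; apply: measurable_funD; exact: measurable_funM.
Qed.
Lemma cmeasZ a f : cmeasurable f -> cmeasurable (fun x => a * f x).
Proof. by move=> mf; apply: cmeasM => //; exact: cmeas_cst. Qed.
Lemma cmeasN f : cmeasurable f -> cmeasurable (fun x => - f x).
Proof. by move=> /(cmeasZ (-1)); under eq_fun do rewrite mulN1r. Qed.
Lemma cmeasB f g : cmeasurable f -> cmeasurable g -> cmeasurable (fun x => f x - g x).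
Proof. by move=> mf mg; apply: cmeasD => //; exact: cmeasN. Qed.
Lemma cmeas_real (u : X -> R) : measurable_fun setT u -> cmeasurable (fun x => (u x)%:C).
Proof. by move=> mu_; split => //=; exact: measurable_cst. Qed.
Lemma cmeas_indic (A : set X) : measurable A -> cmeasurable (fun x => (\1_A x : R)%:C).
Proof. by move=> mA; apply: cmeas_real; exact: measurable_indic. Qed.
Lemma measurable_cnorm2 f : cmeasurable f -> measurable_fun setT (fun x => cnorm2 (f x)).
Proof. by move=> [f1 f2]; apply: measurable_funD; exact: measurable_funX. Qed.
Lemma measurable_ecnorm2 f : cmeasurable f -> measurable_fun setT (fun x => (cnorm2 (f x))%:E).
Proof. by move=> /measurable_cnorm2 h; exact/measurable_EFinP. Qed.

Lemma ae_and (P Q : X -> Prop) : {ae mu, forall x, P x} -> {ae mu, forall x, Q x} ->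
  {ae mu, forall x, P x /\ Q x}.
Proof. by move=> hP hQ; apply: filterI. Qed.

Lemma l2_ge0 f : (0 <= l2 f)%E.
Proof. by apply: integral_ge0 => x _; rewrite lee_fin cnorm2_ge0. Qed.

Lemma l2_ae_le f g : cmeasurable f -> cmeasurable g ->
  {ae mu, forall x, cnorm2 (f x) <= cnorm2 (g x)} -> (l2 f <= l2 g)%E.
Proof.
move=> mf mg H; apply: ae_ge0_le_integral => //.
- by move=> x _; rewrite lee_fin cnorm2_ge0.
- exact: measurable_ecnorm2.
- by move=> x _; rewrite lee_fin cnorm2_ge0.
- exact: measurable_ecnorm2.
- by apply: filterS H => x h _; rewrite lee_fin.
Qed.

Lemma l2_ae f g : cmeasurable f -> cmeasurable g ->
  {ae mu, forall x, f x = g x} -> l2 f = l2 g.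
Proof.
by move=> mf mg H; apply/eqP; rewrite eq_le; apply/andP; split; apply: l2_ae_le => //;
  apply: filterS H => x ->.
Qed.

Lemma l2_scale a f : cmeasurable f -> l2 (fun x => a * f x) = ((cnorm2 a)%:E * l2 f)%E.
Proof.
move=> mf; rewrite -ge0_integralZl_EFin//; last 3 first.
- by move=> x _; rewrite lee_fin cnorm2_ge0.
- exact: measurable_ecnorm2.
- exact: cnorm2_ge0.
by apply: eq_integral => x _; rewrite cnorm2M EFinM.
Qed.

Lemma l2BC f g : l2 (fun x => f x - g x) = l2 (fun x => g x - f x).
Proof. by apply: eq_integral => x _; rewrite -cnorm2N opprB. Qed.

(** A triangle inequality for squared norms: it comes from (h a - b)^2 / h >= 0, and letting h tend
    to 0 recovers sharp constants without square roots. *)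
Lemma cnorm2D_le (h : R) (z w : C) : 0 < h ->
  cnorm2 (z + w) <= (1 + h) * cnorm2 z + (1 + h^-1) * cnorm2 w.
Proof.
move=> h0; rewrite /cnorm2 !ReImE.
have aux (a b : R) : (a + b) ^+ 2 <= (1 + h) * a ^+ 2 + (1 + h^-1) * b ^+ 2.
  have : 0 <= h^-1 * (h * a - b) ^+ 2 by rewrite mulr_ge0 ?invr_ge0 ?sqr_ge0 ?ltW.
  have -> : h^-1 * (h * a - b) ^+ 2 = h * a ^+ 2 - 2 * a * b + h^-1 * b ^+ 2.
    by field; rewrite gt_eqF.
  lra.
have := aux (complex.Re z) (complex.Re w); have := aux (complex.Im z) (complex.Im w); lra.
Qed.

Lemma l2D_eta (h : R) f g : 0 < h -> cmeasurable f -> cmeasurable g ->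
  (l2 (fun x => f x + g x)%R <= (1 + h)%:E * l2 f + (1 + h^-1)%:E * l2 g)%E.
Proof.
move=> h0 mf mg.
have h1 : 0 <= 1 + h by rewrite addr_ge0// ltW.
have h2 : 0 <= 1 + h^-1 by rewrite addr_ge0// ?invr_ge0 ltW.
have Z (k : R) u : 0 <= k -> cmeasurable u ->
    (k%:E * l2 u = \int[mu]_x (k%:E * (cnorm2 (u x))%:E))%E.
  move=> k0 mu_; rewrite ge0_integralZl_EFin//.
  - by move=> x _; rewrite lee_fin cnorm2_ge0.
  - exact: measurable_ecnorm2.
have p (k : R) (u : X -> C) x : 0 <= k -> (0 <= k%:E * (cnorm2 (u x))%:E)%E.
  by move=> k0; rewrite -EFinM lee_fin mulr_ge0// cnorm2_ge0.
have m (k : R) (u : X -> C) : cmeasurable u ->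
    measurable_fun setT (fun x => (k%:E * (cnorm2 (u x))%:E)%E).
  by move=> mu_; apply: measurable_funeM; exact: measurable_ecnorm2.
rewrite !Z// -ge0_integralD//; [|by move=> x _; exact: p|exact: m|
  by move=> x _; exact: p|exact: m].
apply: ge0_le_integral => //.
- by move=> x _; rewrite lee_fin cnorm2_ge0.
- exact/measurable_ecnorm2/cmeasD.
- by apply: emeasurable_funD; exact: m.
- by move=> x _; rewrite -!EFinM -EFinD lee_fin cnorm2D_le.
Qed.

Lemma l2D_le f g : cmeasurable f -> cmeasurable g ->
  (l2 (fun x => f x + g x)%R <= 2%:E * l2 f + 2%:E * l2 g)%E.
Proof.
by move=> mf mg; have := l2D_eta ltr01 mf mg; rewrite invr1 (_ : 1 + 1 = 2 :> R)//; lra.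
Qed.

Lemma l2_eq0 f : cmeasurable f -> l2 f = 0%E -> {ae mu, forall x, f x = 0}.
Proof.
move=> mf f0.
have : ae_eq mu setT (fun x => (cnorm2 (f x))%:E) (cst 0%E).
  apply/ae_eq_integral_abs => //; first exact: measurable_ecnorm2.
  rewrite -[RHS]f0; apply: eq_integral => x _.
  by rewrite gee0_abs ?lee_fin ?cnorm2_ge0.
apply: filterS => x /(_ Logic.I) /= /eqP; rewrite eqe => /eqP; exact: cnorm2_eq0.
Qed.

Lemma l2_cst0 : l2 (fun=> 0) = 0%E.
Proof. by rewrite /l2 (_ : (fun _ => _) = cst 0%E) ?integral0//; apply/funext => x; rewrite cnorm20. Qed.

Lemma l2_indic (A : set X) : measurable A -> l2 (fun x => (\1_A x : R)%:C) = mu A.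
Proof.
move=> mA; rewrite -[in RHS](setIT A) -integral_indic//; apply: eq_integral => x _.
by rewrite cnorm2_real indicE; case: (_ \in _); rewrite ?expr1n ?expr0n.
Qed.

(** The rate is chosen so that F = sum of 4^n |f_{n+1} - f_n|^2 has integral at most 1. Where F is
    finite the increments are at most sqrt F * 2^-n. The real and imaginary errors each contribute 4
    * 4^-n F to the final bound, hence the 8. *)
Lemma l2_complete (f : nat -> X -> C) : (forall n, cmeasurable (f n)) ->
  (forall n, (l2 (fun x => f n.+1 x - f n x)%R <= (2^-1 ^+ n.+1 * 4^-1 ^+ n)%:E)%E) ->
  exists g, cmeasurable g /\ forall n, (l2 (fun x => f n x - g x)%R <= (8 * 4^-1 ^+ n)%:E)%E.
Proof.
move=> mf Hf.
pose h n x := (4 ^+ n * cnorm2 (f n.+1 x - f n x))%:E.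
have mh n : measurable_fun setT (h n).
  apply/measurable_EFinP/measurable_funM => //; apply: measurable_cnorm2; exact: cmeasB.
have h0 n x : (0 <= h n x)%E by rewrite lee_fin mulr_ge0 ?exprn_ge0 ?cnorm2_ge0.
pose F x := (\sum_(n <oo) h n x)%E.
have F0 x : (0 <= F x)%E by apply: nneseries_ge0.
have mF : measurable_fun setT F by apply: ge0_emeasurable_sum.
have iF : (\int[mu]_x F x <= 1)%E.
  rewrite integral_nneseries//.
  apply: (le_trans _ (@epsilon_trick0 R 1 xpredT ler01)).
  apply: lee_nneseries => [n _ _|n _]; first by apply: integral_ge0 => x _.
  rewrite /h; under eq_integral do rewrite EFinM.
  rewrite ge0_integralZl_EFin//; last 2 first.
  - by move=> x _; rewrite lee_fin cnorm2_ge0.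
  - by apply: measurable_ecnorm2; exact: cmeasB.
  apply: le_trans (lee_wpmul2l _ (Hf n)) _; first by rewrite lee_fin exprn_ge0.
  rewrite -EFinM lee_fin mulrCA -exprMn mulfV ?pnatr_eq0// expr1n mulr1 div1r.
  by rewrite natrX exprVn.
pose A := [set x | (F x < +oo)%E].
have mA : measurable A by rewrite -[A]setTI; exact: emeasurable_fun_infty_o.
have aeA : {ae mu, forall x, A x}.
  have iFi : mu.-integrable setT F.
    apply/integrableP; split=> //; under eq_integral do rewrite gee0_abs//.
    exact: le_lt_trans iF (ltry _).
  apply: filterS (integrable_ae measurableT iFi) => x /(_ Logic.I).
  by rewrite ge0_fin_numE.
pose Cx x := Num.sqrt (fine (F x)).
have bd n x : A x -> cnorm2 (f n.+1 x - f n x) <= (Cx x * 2^-1 ^+ n) ^+ 2.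
  move=> Ax; rewrite exprMn sqr_sqrtr ?fine_ge0//.
  have h1 : (h n x <= F x)%E.
    apply: le_trans (nneseries_lim_ge n.+1 _) => //=.
    by rewrite big_nat_recr//= leeDr// sume_ge0.
  have fF : F x \is a fin_num by rewrite ge0_fin_numE.
  move: h1; rewrite /h -(fineK fF) lee_fin mulrC => h1.
  rewrite -exprM mulnC exprM exprVn -[_ ^+ n]/((2 ^+ 2)^-1 ^+ n) -natrX exprVn.
  by rewrite ler_pdivlMr// exprn_gt0.
have /choice [l Hl] : forall x, exists z : C, A x -> forall n,
    `|complex.Re (f n x) - complex.Re z| <= 2 * Cx x * 2^-1 ^+ n /\
    `|complex.Im (f n x) - complex.Im z| <= 2 * Cx x * 2^-1 ^+ n.
  move=> x; have [Ax|nAx] := pselect (A x); last by exists 0.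
  have C0 n : 0 <= Cx x * 2^-1 ^+ n by rewrite mulr_ge0 ?sqrtr_ge0 ?exprn_ge0 ?invr_ge0.
  have [|a Ha] := @geometric_limit R (fun n => complex.Re (f n x)) (Cx x).
    move=> n; rewrite -(@ler_pXn2r _ 2) ?nnegrE// real_normK ?num_real//.
    apply: le_trans (bd n x Ax); rewrite /cnorm2 cReD cReN lerDl; exact: sqr_ge0.
  have [|b Hb] := @geometric_limit R (fun n => complex.Im (f n x)) (Cx x).
    move=> n; rewrite -(@ler_pXn2r _ 2) ?nnegrE// real_normK ?num_real//.
    apply: le_trans (bd n x Ax); rewrite /cnorm2 cImD cImN lerDr; exact: sqr_ge0.
  by exists (a +i* b) => _ n; split; [exact: Ha|exact: Hb].
(* Cutting off outside A makes g an everywhere pointwise limit of measurable functions. *)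
pose g x := (\1_A x : R)%:C * l x.
have mg : cmeasurable g.
  have mfA n : cmeasurable (fun x => (\1_A x : R)%:C * f n x).
    by apply: cmeasM => //; exact: cmeas_indic.
  split.
  - apply: (@measurable_fun_cvg _ _ _ _ (fun n x => complex.Re ((\1_A x : R)%:C * f n x))).
      by move=> n; case: (mfA n).
    move=> x _; have [Ax|nAx] := pselect (A x).
      apply: (@geometric_limit_cvg _ _ _ (2 * Cx x)) => n.
      rewrite /g indicE mem_set//= !mul1r.
      exact: (Hl x Ax n).1.
    rewrite /g indicE memNset//= mul0r; apply: (@geometric_limit_cvg _ _ _ 0) => n.
    by rewrite mul0r subrr normr0 mul0r.
  - apply: (@measurable_fun_cvg _ _ _ _ (fun n x => complex.Im ((\1_A x : R)%:C * f n x))).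
      by move=> n; case: (mfA n).
    move=> x _; have [Ax|nAx] := pselect (A x).
      apply: (@geometric_limit_cvg _ _ _ (2 * Cx x)) => n.
      rewrite /g indicE mem_set//= !mul1r.
      exact: (Hl x Ax n).2.
    rewrite /g indicE memNset//= mul0r; apply: (@geometric_limit_cvg _ _ _ 0) => n.
    by rewrite mul0r subrr normr0 mul0r.
exists g; split=> // n.
have c0 : (0 : R) <= 8 * 4^-1 ^+ n by rewrite mulr_ge0// exprn_ge0// invr_ge0.
apply: (@le_trans _ _ (\int[mu]_x ((8 * 4^-1 ^+ n)%:E * F x))%E); last first.
  rewrite ge0_integralZl_EFin// -[leRHS]mule1.
  by apply: lee_wpmul2l => //; rewrite lee_fin.
apply: ae_ge0_le_integral => //.
- by move=> x _; rewrite lee_fin cnorm2_ge0.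
- by apply: measurable_ecnorm2; exact: cmeasB.
- by move=> x _; rewrite mule_ge0// lee_fin.
- exact: measurable_funeM.
apply: filterS aeA => x Ax _.
have fF : F x \is a fin_num by rewrite ge0_fin_numE.
rewrite -(fineK fF) -EFinM lee_fin /g indicE mem_set//= mul1r.
have [a b] := Hl x Ax n; rewrite /cnorm2 !ReImE.
have sq : (2 * Cx x * 2^-1 ^+ n) ^+ 2 = 4 * 4^-1 ^+ n * fine (F x).
  have q : (2^-1 ^+ n) ^+ 2 = 4^-1 ^+ n :> R.
    by rewrite -exprM mulnC exprM; congr (_ ^+ n); field.
  rewrite exprMn q exprMn sqr_sqrtr ?fine_ge0//; ring.
have w0 : 0 <= 2 * Cx x * 2^-1 ^+ n by rewrite !mulr_ge0 ?sqrtr_ge0 ?exprn_ge0 ?invr_ge0.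
have sqle (u : R) : `|u| <= 2 * Cx x * 2^-1 ^+ n -> u ^+ 2 <= 4 * 4^-1 ^+ n * fine (F x).
  by move=> hu; rewrite -sq -(real_normK (num_real u)) lerXn2r ?nnegrE.
have := sqle _ a; have := sqle _ b; lra.
Qed.

Lemma l2_dominated (f : nat -> X -> C) (g : X -> C) (G : X -> C) :
  (forall n, cmeasurable (f n)) -> cmeasurable g -> cmeasurable G -> (l2 G < +oo)%E ->
  {ae mu, forall x n, cnorm2 (f n x - g x) <= cnorm2 (G x)} ->
  {ae mu, forall x, (fun n => cnorm2 (f n x - g x)) @ \oo --> (0 : R)} ->
  forall e : R, 0 < e -> exists N, forall n, (N <= n)%N ->
    (l2 (fun x => f n x - g x)%R < e%:E)%E.
Proof.
move=> mf mg mG Gfin dom cv e e0.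
have A1 : {ae mu, forall x, setT x ->
    (fun n => (cnorm2 (f n x - g x))%:E) @ \oo --> (cst 0%E x : \bar R)}.
  by apply: filterS cv => x h _; apply: cvg_EFin => //; exact: nearW.
have A2 : mu.-integrable setT (fun x => (cnorm2 (G x))%:E).
  apply/integrableP; split; first exact: measurable_ecnorm2.
  by under eq_integral do rewrite gee0_abs ?lee_fin ?cnorm2_ge0//.
have A3 : {ae mu, forall x n, setT x -> (`|(cnorm2 (f n x - g x))%:E| <= (cnorm2 (G x))%:E)%E}.
  by apply: filterS dom => x h n _; rewrite gee0_abs ?lee_fin ?cnorm2_ge0.
have [_ _] := dominated_convergence measurableT
  (fun n => measurable_ecnorm2 (cmeasB (mf n) mg)) (measurable_cst _) A1 A2 A3.
rewrite integral0 => H.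
have /= [N _ HN] : \forall n \near \oo, (l2 (fun x => f n x - g x)%R < e%:E)%E.
  move: H => /fine_cvgP[Hf /cvgrPdistC_lt/(_ _ e0) H].
  near=> n.
  have fn : l2 (fun x => f n x - g x)%R \is a fin_num by near: n; exact: Hf.
  rewrite -(fineK fn) lte_fin; apply: le_lt_trans (ler_norm _) _.
  rewrite -[X in `|X|]subr0; near: n; exact: H.
by exists N => n Nn; exact: HN.
Unshelve. all: by end_near. Qed.

End L2.

(** * Isometries from a Hilbert space to an L2 space *)

(** Let e tend to 0 for fixed h, then h to 0. *)
Lemma le_of_eta (R : realType) (a b : R) : 0 <= b ->
  (forall h e : R, 0 < h -> 0 < e ->
    a <= (1 + h) * ((1 + h) * b + (1 + h^-1) * e) + (1 + h^-1) * e) -> a <= b.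
Proof.
move=> b0 H.
have H1 h : 0 < h -> a <= (1 + h) ^+ 2 * b.
  move=> h0; apply/ler_addgt0Pl => e e0.
  have i0 : 0 < h^-1 by rewrite invr_gt0.
  pose c := (1 + h) * (1 + h^-1) + (1 + h^-1).
  have c0 : 0 < c by rewrite addr_gt0 ?mulr_gt0 ?addr_gt0.
  have := H h (e / c) h0 (divr_gt0 e0 c0).
  have -> : (1 + h) * ((1 + h) * b + (1 + h^-1) * (e / c)) + (1 + h^-1) * (e / c) =
      c * (e / c) + (1 + h) ^+ 2 * b by rewrite /c; ring.
  by rewrite mulrCA mulfV ?gt_eqF// mulr1.
apply/ler_addgt0Pl => e e0.
(* For h <= 1, (1 + h)^2 b <= b + 3 h b, and 3 h b <= e. *)
pose h := Num.min 1 (e / (3 * b + 1)).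
have d0 : 0 < 3 * b + 1 by rewrite ltr_wpDl// mulr_ge0.
have h0 : 0 < h by rewrite lt_min ltr01 divr_gt0.
have h1 : h <= 1 by rewrite ge_min lexx.
have h2 : h * (3 * b + 1) <= e by rewrite -ler_pdivlMr// ge_min lexx orbT.
have hb : h * (h * b) <= h * b by rewrite ler_wpM2l ?ler_piMl// ltW.
apply: le_trans (H1 h h0) _; lra.
Qed.

Section Isometry.
Variables (R : realType) (V : lmodType R[i]) (ip : V -> V -> R[i]).
Hypothesis ipP : is_inner_product ip.
Hypothesis hcomp : hcomplete ip.
Local Notation C := R[i].
Local Notation nrm2 := (nrm2 ip).
Context {d : measure_display} {X : measurableType d}.
Variable mu : {measure set X -> \bar R}.
Local Notation l2 := (l2 mu).

Lemma nrm2D_eta (h : R) x y : 0 < h ->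
  nrm2 (x + y) <= (1 + h) * nrm2 x + (1 + h^-1) * nrm2 y.
Proof.
move=> h0; rewrite (nrm2D ipP).
have := rip_quad ipP h (-1) x y.
have i0 : 0 < h^-1 by rewrite invr_gt0.
move=> q; have := mulr_ge0 (ltW i0) q.
have -> : h^-1 * (h ^+ 2 * nrm2 x + (-1) ^+ 2 * nrm2 y + 2 * h * -1 * rip ip x y) =
  h * nrm2 x + h^-1 * nrm2 y - 2 * rip ip x y by field; rewrite gt_eqF.
lra.
Qed.

Variables (K : Type) (vec : K -> V) (A : K -> set X) (m : K -> K -> R).
Hypothesis mA : forall k, measurable (A k).
Hypothesis ipE : forall k l, ip (vec k) (vec l) = (m k l)%:C.
Hypothesis muE : forall k l, mu (A k `&` A l) = (m k l)%:E.

(** Formal combinations are lists, evaluated separately on the Hilbert side and on the function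
    side, so no well-definedness has to be checked when passing from one to the other. *)
Definition lvec (s : seq (C * K)) : V := \sum_(t <- s) t.1 *: vec t.2.
Definition lfun (s : seq (C * K)) (x : X) : C := \sum_(t <- s) t.1 * (\1_(A t.2) x : R)%:C.

Lemma lfun_meas s : cmeasurable (lfun s).
Proof.
rewrite /lfun; elim: s => [|t s IH].
  by under eq_fun do rewrite big_nil; exact: cmeas_cst.
under eq_fun do rewrite big_cons.
by apply: cmeasD => //; apply: cmeasZ; exact: cmeas_indic.
Qed.
Lemma lvec_cat s t : lvec (s ++ t) = lvec s + lvec t.
Proof. by rewrite /lvec big_cat. Qed.
Lemma lfun_cat s t x : lfun (s ++ t) x = lfun s x + lfun t x.
Proof. by rewrite /lfun big_cat. Qed.
Definition lscale (a : C) (s : seq (C * K)) := [seq (a * t.1, t.2) | t <- s].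
Lemma lvec_scale a s : lvec (lscale a s) = a *: lvec s.
Proof.
rewrite /lvec big_map scaler_sumr; apply: eq_bigr => t _.
by rewrite scalerA.
Qed.
Lemma lfun_scale a s x : lfun (lscale a s) x = a * lfun s x.
Proof.
rewrite /lfun big_map mulr_sumr; apply: eq_bigr => t _.
by rewrite mulrA.
Qed.

Let RE (a b : C) := complex.Re (a * b^*).

Lemma lvec_nrm2 s : nrm2 (lvec s) =
  \sum_(t <- s) \sum_(t' <- s) RE t.1 t'.1 * m t.2 t'.2.
Proof.
have ipl x (r : seq (C * K)) : ip (lvec r) x = \sum_(t <- r) t.1 * ip (vec t.2) x.
  rewrite /lvec; elim: r => [|t r IH]; first by rewrite !big_nil (ip0l ipP).
  by rewrite !big_cons (ipDl ipP) (ipZl ipP) IH.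
have ipr x (r : seq (C * K)) : ip x (lvec r) = \sum_(t <- r) t.1^* * ip x (vec t.2).
  rewrite /lvec; elim: r => [|t r IH]; first by rewrite !big_nil (ip0r ipP).
  by rewrite !big_cons (ipDr ipP) (ipZr ipP) IH.
have Resum (I : Type) (r : seq I) (F : I -> C) :
    complex.Re (\sum_(i <- r) F i) = \sum_(i <- r) complex.Re (F i).
  by apply: (big_morph _ (@cReD R)).
rewrite nrm2E ipl Resum; apply: eq_bigr => t _.
rewrite ipr mulr_sumr Resum; apply: eq_bigr => t' _.
by rewrite ipE mulrA cReM /= mulr0 subr0.
Qed.

Lemma lfun_cnorm2 s x : cnorm2 (lfun s x) =
  \sum_(t <- s) \sum_(t' <- s) RE t.1 t'.1 * \1_(A t.2 `&` A t'.2) x.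
Proof.
have Resum (I : Type) (r : seq I) (F : I -> C) :
    complex.Re (\sum_(i <- r) F i) = \sum_(i <- r) complex.Re (F i).
  by apply: (big_morph _ (@cReD R)).
have cE : (lfun s x)^* = \sum_(t' <- s) (t'.1^* * (\1_(A t'.2) x : R)%:C).
  rewrite /lfun rmorph_sum; apply: eq_bigr => t' _.
  by rewrite rmorphM; congr (_ * _); exact: conj_realC.
have -> : cnorm2 (lfun s x) =
    complex.Re (lfun s x * \sum_(t' <- s) (t'.1^* * (\1_(A t'.2) x : R)%:C)).
  by rewrite -cE mulr_conj.
rewrite {1}/lfun mulr_suml Resum; apply: eq_bigr => t _.
rewrite mulr_sumr Resum; apply: eq_bigr => t' _.
rewrite indicI /RE !(cReM, cImM) /=; ring.
Qed.

(** Both sides are the same quadratic form in the coefficients, with matrix [m]: it is the Gram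
    matrix of the vectors and the matrix of measures of the intersections. *)
Lemma lin_isom s : l2 (lfun s) = (nrm2 (lvec s))%:E.
Proof.
have fin k l : (mu (A k `&` A l) < +oo)%E by rewrite muE ltry.
have mI k l : measurable (A k `&` A l) by exact: measurableI.
have ii k l : mu.-integrable setT (fun x => (\1_(A k `&` A l) x : R)%:E).
  apply/integrableP; split; first exact/measurable_EFinP/measurable_indic.
  rewrite (eq_integral (fun x => (\1_(A k `&` A l) x : R)%:E)); last first.
    by move=> t _; rewrite gee0_abs// lee_fin.
  by rewrite integral_indic// setIT.
have iiZ (r : R) k l : mu.-integrable setT (fun x => (r%:E * (\1_(A k `&` A l) x)%:E)%E).
  exact: (integrableZl measurableT).
rewrite /l2 lvec_nrm2.
transitivity (\int[mu]_x (\sum_(t <- s) \sum_(t' <- s)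
   ((RE t.1 t'.1)%:E * (\1_(A t.2 `&` A t'.2) x)%:E)))%E.
  apply: eq_integral => x _; rewrite lfun_cnorm2 -sumEFin; apply: eq_bigr => t _.
  by rewrite -sumEFin; apply: eq_bigr => t' _; rewrite EFinM.
rewrite integral_sum//; last by move=> t; apply: integrable_sum.
rewrite -sumEFin; apply: eq_bigr => t _.
rewrite integral_sum// -sumEFin; apply: eq_bigr => t' _.
by rewrite integralZl// integral_indic// setIT muE EFinM.
Qed.

(** The closure of the isometry on formal combinations, kept as a relation: h and f are approximated
    by the same combination. Domain and range are treated alike, and f is determined only up to null
    sets, so no representative has to be chosen. *)
Definition graph (h : V) (f : X -> C) : Prop := cmeasurable f /\
  forall e : R, 0 < e -> exists s,
    nrm2 (h - lvec s) < e /\ (l2 (fun x => f x - lfun s x)%R < e%:E)%E.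

Lemma graph_meas h f : graph h f -> cmeasurable f. Proof. by case. Qed.

Lemma graph_gen k : graph (vec k) (fun x => (\1_(A k) x : R)%:C).
Proof.
split; first exact: cmeas_indic.
move=> e e0; exists [:: (1, k)]; rewrite /lvec big_seq1 scale1r subrr (nrm20 ipP); split=> //.
under [X in l2 X]eq_fun do rewrite /lfun big_seq1 mul1r subrr.
by rewrite l2_cst0.
Qed.

Lemma lte_2sum (a b : \bar R) (e : R) : (a < (e / 4)%:E)%E -> (b < (e / 4)%:E)%E ->
  (2%:E * a + 2%:E * b < e%:E)%E.
Proof.
have h x : (x < (e / 4)%:E)%E -> (2%:E * x < (e / 2)%:E)%E.
  move=> hx; have -> : (e / 2)%:E = (2%:E * (e / 4)%:E)%E by rewrite -EFinM; congr EFin; field.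
  by rewrite lte_pmul2l.
move=> /h ha /h hb; have -> : e%:E = ((e / 2)%:E + (e / 2)%:E)%E by rewrite -EFinD -splitr.
exact: lteD.
Qed.

Lemma graphD h f k g : graph h f -> graph k g -> graph (h + k) (fun x => f x + g x).
Proof.
move=> [mf Hf] [mg Hg]; split; first exact: cmeasD.
move=> e e0; have e4 : 0 < e / 4 by rewrite divr_gt0.
have [s [s1 s2]] := Hf _ e4; have [t [t1 t2]] := Hg _ e4; exists (s ++ t); split.
  rewrite lvec_cat opprD addrACA; apply: le_lt_trans (nrm2D_le ipP _ _) _; lra.
under [X in l2 X]eq_fun do rewrite lfun_cat opprD addrACA.
apply: le_lt_trans (l2D_le _ _ _) _; [exact/cmeasB/lfun_meas|exact/cmeasB/lfun_meas|].
exact: lte_2sum.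
Qed.

Lemma graphZ a h f : graph h f -> graph (a *: h) (fun x => a * f x).
Proof.
move=> [mf Hf]; split; first exact: cmeasZ.
move=> e e0; have c0 : 0 < cnorm2 a + 1 by rewrite ltr_wpDl// cnorm2_ge0.
have [s [s1 s2]] := Hf _ (divr_gt0 e0 c0); exists (lscale a s).
have bd (x : R) : 0 <= x -> x < e / (cnorm2 a + 1) -> cnorm2 a * x < e.
  move=> x0; rewrite ltr_pdivlMr// => hx; apply: le_lt_trans hx.
  by rewrite mulrDr mulr1 mulrC lerDl.
split; first by rewrite lvec_scale -scalerBr (nrm2Z ipP) bd// nrm2_ge0.
under [X in l2 X]eq_fun do rewrite lfun_scale -mulrBr.
have ml := cmeasB mf (lfun_meas s); rewrite l2_scale//.
have fl : l2 (fun x => f x - lfun s x) \is a fin_num.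
  by rewrite ge0_fin_numE ?l2_ge0//; apply: lt_trans s2 _; rewrite ltry.
move: s2; rewrite -(fineK fl) -EFinM !lte_fin; apply: bd.
by rewrite fine_ge0// l2_ge0.
Qed.

Lemma graphB h f k g : graph h f -> graph k g -> graph (h - k) (fun x => f x - g x).
Proof.
move=> Gf /(graphZ (-1)); rewrite scaleN1r => /(graphD Gf).
by under eq_fun do rewrite mulN1r.
Qed.

Lemma graph0 : graph 0 (fun=> 0).
Proof.
split; first exact: cmeas_cst.
move=> e e0; exists [::]; rewrite /lvec big_nil subrr (nrm20 ipP); split=> //.
by under [X in l2 X]eq_fun do rewrite /lfun big_nil subrr; rewrite l2_cst0.
Qed.

(** An approximating combination has the same norm on both sides; two weighted triangle inequalities
    lead from one side to the other, and [le_of_eta] removes the slack. *)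
Lemma graph_isom h f : graph h f -> l2 f = (nrm2 h)%:E.
Proof.
move=> [mf Hf].
have lf : (l2 f < +oo)%E.
  have [s [_ s2]] := Hf 1 ltr01.
  have -> : f = (fun x => (f x - lfun s x) + lfun s x) by apply/funext => x; rewrite subrK.
  apply: le_lt_trans (l2D_le _ _ _) _; [exact/cmeasB/lfun_meas|exact: lfun_meas|].
  rewrite lin_isom -EFinM lte_add_pinfty ?ltry//.
  by rewrite lte_mul_pinfty// ?lee_fin//; exact: lt_trans s2 (ltry _).
have ff : l2 f \is a fin_num by rewrite ge0_fin_numE ?l2_ge0.
have key (h1 e : R) : 0 < h1 -> 0 < e ->
   fine (l2 f) <= (1 + h1) * ((1 + h1) * nrm2 h + (1 + h1^-1) * e) + (1 + h1^-1) * e /\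
   nrm2 h <= (1 + h1) * ((1 + h1) * fine (l2 f) + (1 + h1^-1) * e) + (1 + h1^-1) * e.
  move=> h0 e0; have [s [s1 s2]] := Hf e e0.
  have ms := cmeasB mf (lfun_meas s).
  have i0 : 0 < h1^-1 by rewrite invr_gt0.
  pose D := fine (l2 (fun x => f x - lfun s x)).
  have fD : l2 (fun x => f x - lfun s x) = D%:E.
    by rewrite fineK// ge0_fin_numE ?l2_ge0//; apply: lt_trans s2 (ltry _).
  have De : D < e by rewrite -lte_fin -fD.
  have nl : nrm2 (lvec s) <= (1 + h1) * nrm2 h + (1 + h1^-1) * nrm2 (h - lvec s).
    rewrite (nrm2BC ipP) -{1}(subrK h (lvec s)) addrC; exact: nrm2D_eta.
  have nh : nrm2 h <= (1 + h1) * nrm2 (lvec s) + (1 + h1^-1) * nrm2 (h - lvec s).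
    by rewrite -{1}(subrK (lvec s) h) addrC; exact: nrm2D_eta.
  have lf1 : fine (l2 f) <= (1 + h1) * nrm2 (lvec s) + (1 + h1^-1) * D.
    have := l2D_eta mu h0 (lfun_meas s) ms; rewrite lin_isom fD -!EFinM -EFinD => H1.
    rewrite -lee_fin (fineK ff); apply: le_trans H1.
    by rewrite le_eqVlt; apply/orP; left; apply/eqP; congr l2; apply/funext => x; rewrite addrC subrK.
  have lf2 : nrm2 (lvec s) <= (1 + h1) * fine (l2 f) + (1 + h1^-1) * D.
    have := l2D_eta mu h0 mf (cmeasB (lfun_meas s) mf).
    rewrite (l2BC mu (lfun s) f) fD -(fineK ff) -!EFinM -EFinD => H1.
    rewrite -lee_fin -lin_isom; apply: le_trans H1.
    by rewrite le_eqVlt; apply/orP; left; apply/eqP; congr l2; apply/funext => x; rewrite addrC subrK.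
  have g1 : 0 < 1 + h1 by rewrite addr_gt0.
  have g2 : 0 < 1 + h1^-1 by rewrite addr_gt0.
  have De' : (1 + h1^-1) * D <= (1 + h1^-1) * e by rewrite ler_pM2l// ltW.
  have se : (1 + h1^-1) * nrm2 (h - lvec s) <= (1 + h1^-1) * e by rewrite ler_pM2l// ltW.
  split.
    apply: le_trans lf1 _; apply: lerD => //; rewrite ler_pM2l//; lra.
  apply: le_trans nh _; apply: lerD => //; rewrite ler_pM2l//; lra.
rewrite -(fineK ff); congr EFin; apply/eqP; rewrite eq_le; apply/andP; split.
  by apply: le_of_eta; [exact: nrm2_ge0|move=> h1 e h0 e0; case: (key h1 e h0 e0)].
by apply: le_of_eta; [rewrite fine_ge0// l2_ge0|move=> h1 e h0 e0; case: (key h1 e h0 e0)].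
Qed.

Lemma graph_closed h f : cmeasurable f ->
  (forall e : R, 0 < e -> exists h' f', [/\ graph h' f', nrm2 (h - h') < e &
     (l2 (fun x => f x - f' x)%R < e%:E)%E]) -> graph h f.
Proof.
move=> mf H; split=> // e e0; have e4 : 0 < e / 4 by rewrite divr_gt0.
have [h' [f' [[mf' Hf'] h1 h2]]] := H _ e4; have [s [s1 s2]] := Hf' _ e4.
exists s; split.
  rewrite -(subrK h' h) -addrA; apply: le_lt_trans (nrm2D_le ipP _ _) _; lra.
have -> : (fun x => f x - lfun s x) = (fun x => (f x - f' x) + (f' x - lfun s x)).
  by apply/funext => x; rewrite addrA subrK.
apply: le_lt_trans (l2D_le _ _ _) _; [exact: cmeasB|exact/cmeasB/lfun_meas|].
exact: lte_2sum.
Qed.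

Lemma graph_ae h f g : graph h f -> cmeasurable g -> {ae mu, forall x, f x = g x} -> graph h g.
Proof.
move=> Gf mg fg; apply: graph_closed => // e e0; exists h, f; split=> //.
  by rewrite subrr (nrm20 ipP).
have mgf := cmeasB mg (graph_meas Gf).
have gf0 : {ae mu, forall x, g x - f x = 0}.
  by apply: filterS fg => x ->; rewrite subrr.
by rewrite (l2_ae mgf (cmeas_cst 0) gf0) l2_cst0 lte_fin.
Qed.

Lemma graph_fun_uniq h f g : graph h f -> graph h g -> {ae mu, forall x, f x = g x}.
Proof.
move=> Gf Gg; have G := graphB Gf Gg; have := graph_isom G.
rewrite subrr (nrm20 ipP) => /(l2_eq0 (graph_meas G)); apply: filterS => x /eqP.
by rewrite subr_eq0 => /eqP.
Qed.

Lemma graph_dist h f k g : graph h f -> graph k g ->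
  l2 (fun x => f x - g x) = (nrm2 (h - k))%:E.
Proof. by move=> Gf Gg; exact: graph_isom (graphB Gf Gg). Qed.

(** The domain of the relation is a closed subspace containing all [vec k]; closedness rests on
    completeness of L^2. *)
Lemma graph_total : (forall w, (forall k, ip w (vec k) = 0) -> w = 0) ->
  forall h, exists f, graph h f.
Proof.
move=> tot.
pose W h := exists f, graph h f.
have Wc : closed_subspace ip W.
  split; first split.
  - by exists (fun=> 0); exact: graph0.
  - by move=> a x y [f Gf] [g Gg]; exists (fun x => a * f x + g x); apply: graphD => //; exact: graphZ.
  move=> u l ul Wu.
  (* Small enough that 2 [ep n] + 2 [ep n.+1] is below 2^-1 * 8^-n, the rate that [l2_complete] asks
     for. *)
  pose ep n : R := 16^-1 * 8^-1 ^+ n.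
  have ep0 n : 0 < ep n by rewrite mulr_gt0 ?exprn_gt0 ?invr_gt0.
  have /choice [hf Hhf] : forall n, exists p : V * (X -> C), graph p.1 p.2 /\ nrm2 (p.1 - l) < ep n.
    move=> n; have sp : 0 < Num.sqrt (ep n) by rewrite sqrtr_gt0.
    have [N HN] := ul _ sp; have [f Gf] := Wu N; exists (u N, f); split=> //=.
    by have := HN _ (leqnn N); rewrite (hnorm_lt_sqrt ipP) ?sqrtr_ge0// sqr_sqrtr// ltW.
  have Gn n := (Hhf n).1; have Dn n := (Hhf n).2.
  have [||g [mg Hg]] := @l2_complete _ _ _ mu (fun n => (hf n).2).
  - by move=> n; exact: graph_meas (Gn n).
  - move=> n; rewrite (graph_dist (Gn n.+1) (Gn n)) lee_fin.
    have -> : (hf n.+1).1 - (hf n).1 = ((hf n.+1).1 - l) + (l - (hf n).1).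
      by rewrite addrA subrK.
    apply: le_trans (nrm2D_le ipP _ _) _; rewrite (nrm2BC ipP l).
    have -> : (2^-1 ^+ n.+1 * 4^-1 ^+ n : R) = 2^-1 * 8^-1 ^+ n.
      by rewrite exprS -mulrA -exprMn; congr (_ * _ ^+ n); field.
    have := Dn n; have := Dn n.+1; have := ep0 n; rewrite /ep exprS; lra.
  exists g; apply: graph_closed => // e e0.
  have [N hN] : exists N : nat, ep N < e /\ 8 * 4^-1 ^+ N < e.
    have c1 : geometric 8 4^-1 @ \oo --> (0 : R).
      by apply: cvg_geometric; rewrite ger0_norm ?invr_ge0// invf_lt1// ltr1n.
    move/cvgrPdistC_lt : c1 => /(_ _ e0) [N _ HN]; exists N.
    have := HN N (leqnn N); rewrite /= subr0 => h.
    have {}h : 8 * 4^-1 ^+ N < e by apply: le_lt_trans h; exact: ler_norm.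
    split=> //; apply: le_lt_trans h; rewrite /ep ler_pM ?invr_ge0 ?exprn_ge0//.
    - lra.
    - by rewrite lerXn2r ?nnegrE ?invr_ge0// lef_pV2 ?posrE// ler_nat.
  exists (hf N).1, (hf N).2; split=> //; first by rewrite (nrm2BC ipP); exact: lt_trans (Dn N) hN.1.
  by rewrite l2BC; apply: le_lt_trans (Hg N) _; rewrite lte_fin hN.2.
move=> h; have [[f Gf]|nW] := pselect (W h); first by exists f.
exfalso; apply: nW; pose w := h - proj ip W h.
have w0 : w = 0.
  apply: tot => k; apply: (proj_orth ipP hcomp Wc).
  by exists (fun x => (\1_(A k) x : R)%:C); exact: graph_gen.
have -> : h = proj ip W h by apply/eqP; rewrite -subr_eq0 -/w w0.
exact: proj_in.
Qed.

(** The counterpart on the range side: preimages of an L^2-convergent sequence are Cauchy by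
    isometry, and completeness of the Hilbert space provides the limit. *)
Lemma graph_range_closed f : cmeasurable f ->
  (forall e : R, 0 < e -> exists h' f', graph h' f' /\ (l2 (fun x => f x - f' x)%R < e%:E)%E) ->
  exists h, graph h f.
Proof.
move=> mf H.
have hp k : (0 : R) < (k.+1%:R)^-1 by rewrite invr_gt0.
have /choice [hf Hhf] : forall n : nat, exists p : V * (X -> C), graph p.1 p.2 /\
    (l2 (fun x => f x - p.2 x)%R < (n.+1%:R^-1)%:E)%E.
  by move=> n; have [h' [f' ?]] := H _ (hp n); exists (h', f').
have Gn n := (Hhf n).1; have Dn n := (Hhf n).2.
have [h Hh] : exists l, hcvg ip (fun n => (hf n).1) l.
  apply: hcomp => e e0; have e4 : 0 < e ^+ 2 / 4 by rewrite divr_gt0// exprn_gt0.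
  have [N _ HN] := near_infty_natSinv_lt (PosNum e4).
  exists N => m' k /HN /= Nm /HN /= Nk; rewrite (hnorm_lt_sqrt ipP) ?ltW//.
  rewrite -lte_fin -(graph_dist (Gn m') (Gn k)).
  have -> : (fun x => (hf m').2 x - (hf k).2 x) =
      (fun x => ((hf m').2 x - f x) + (f x - (hf k).2 x)).
    by apply/funext => x; rewrite addrA subrK.
  apply: le_lt_trans (l2D_le _ _ _) _; try by apply: cmeasB => //; apply: graph_meas (Gn _).
  apply: lte_2sum; last by apply: lt_trans (Dn k) _; rewrite lte_fin.
  by rewrite l2BC; apply: lt_trans (Dn m') _; rewrite lte_fin.
exists h; apply: graph_closed => // e e0.
have [N1 HN1] : exists N, forall k, (N <= k)%N -> nrm2 (h - (hf k).1) < e.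
  have sp : 0 < Num.sqrt e by rewrite sqrtr_gt0.
  have [N HN] := Hh _ sp; exists N => k /HN; rewrite (hnorm_lt_sqrt ipP) ?sqrtr_ge0//.
  by rewrite sqr_sqrtr 1?ltW// (nrm2BC ipP).
have [N2 _ HN2] := near_infty_natSinv_lt (PosNum e0).
pose k := maxn N1 N2; exists (hf k).1, (hf k).2; split=> //; first by apply: HN1; exact: leq_maxl.
by apply: lt_trans (Dn k) _; rewrite lte_fin; apply: HN2; exact: leq_maxr.
Qed.

Lemma graph_sum (I : Type) (r : seq I) (F : I -> X -> C) :
  (forall i, exists h, graph h (F i)) -> exists h, graph h (fun x => \sum_(i <- r) F i x).
Proof.
move=> H; elim: r => [|i r [h Gh]].
  by exists 0; under eq_fun do rewrite big_nil; exact: graph0.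
have [k Gk] := H i; exists (k + h); under eq_fun do rewrite big_cons.
exact: graphD.
Qed.

Import HBNNSimple.

Lemma graph_onto :
  (forall B, measurable B -> (mu B < +oo)%E -> exists h, graph h (fun x => (\1_B x : R)%:C)) ->
  forall f, cL2 mu f -> exists h, graph h f.
Proof.
move=> Hind.
have nonneg (u : X -> R) : measurable_fun setT u -> (forall x, 0 <= u x) ->
    (l2 (fun x => (u x)%:C) < +oo)%E -> exists h, graph h (fun x => (u x)%:C).
  move=> mu_ u0 ufin.
  have meu : measurable_fun setT (EFin \o u) by exact/measurable_EFinP.
  pose s n : {nnsfun X >-> R} := nnsfun_approx measurableT meu n.
  have scv x : (fun n => s n x) @ \oo --> u x.
    have /fine_cvgP[_] := @cvg_nnsfun_approx _ _ _ _ measurableT _ meu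
      (fun x _ => u0 x : (0 <= (EFin \o u) x)%E) x Logic.I.
    exact.
  have sle n x : s n x <= u x.
    have nd : nondecreasing_seq (fun n => s n x).
      by move=> k l kl; have /lefP := nd_nnsfun_approx measurableT meu kl; exact.
    have -> : u x = limn (fun n => s n x) by apply/esym; apply: cvg_lim => //; exact: scv.
    by apply: nondecreasing_cvgn_le => //; apply/cvg_ex; exists (u x).
  have s0 n x : 0 <= s n x by [].
  have ms n : cmeasurable (fun x => (s n x)%:C).
    by apply: cmeas_real; exact: measurable_funP.
  apply: graph_range_closed; first exact: cmeas_real.
  move=> e e0.
  have [||N HN] := @l2_dominated _ _ _ mu (fun n x => (s n x)%:C) _ _ ms (cmeas_real mu_)
    (cmeas_real mu_) ufin _ _ e e0.
  - apply: nearW => x n; rewrite (_ : _ - _ = (s n x - u x)%:C); last by rewrite rmorphB.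
    rewrite !cnorm2_real -(real_normK (num_real (_ - _))) lerXn2r ?nnegrE//.
    by rewrite ler0_norm ?subr_le0// opprB gerBl.
  - apply: nearW => x.
    have c0 : (fun n => s n x - u x) @ \oo --> (0 : R).
      by rewrite -(subrr (u x)); apply: cvgB => //; exact: cvg_cst.
    have H := cvgM c0 c0; rewrite mulr0 in H.
    rewrite (_ : (fun n => cnorm2 _) = (fun n => (s n x - u x) * (s n x - u x))); first exact: H.
    apply/funext => n; rewrite (_ : _ - (u x)%:C = (s n x - u x)%:C); last by rewrite rmorphB.
    by rewrite cnorm2_real expr2.
  have [h Gh] : exists h, graph h (fun x => (s N x)%:C).
    have E x : (s N x)%:C = \sum_(y <- finmap.enum_fset (fset_set (range (s N))))
        y%:C * (\1_(s N @^-1` [set y]) x : R)%:C.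
      by rewrite {1}fimfunE fsbig_finite//= rmorph_sum; apply: eq_bigr => y _; rewrite rmorphM.
    rewrite (funext E).
    apply: graph_sum => y; set B := _ @^-1` _.
    have mB : measurable B by exact: measurable_sfunP.
    (* The level set of the value 0 may have infinite measure; those of nonzero values have finite
       measure by Chebyshev. *)
    have [->|yN0] := eqVneq y 0.
      by exists 0; under eq_fun do rewrite mul0r; exact: graph0.
    have Bfin : (mu B < +oo)%E.
      have y2 : 0 < y ^+ 2 by rewrite lt_neqAle eq_sym sqrf_eq0 yN0 sqr_ge0.
      have : ((y ^+ 2)%:E * mu B < +oo)%E.
        rewrite -l2_indic// -cnorm2_real -l2_scale; last exact: cmeas_indic.
        apply: le_lt_trans ufin; apply: l2_ae_le; [by apply: cmeasZ; exact: cmeas_indic|exact: cmeas_real|].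
        apply: nearW => x; rewrite cnorm2M !cnorm2_real indicE.
        have [xB|xB] := boolP (x \in B); last by rewrite expr0n mulr0 sqr_ge0.
        rewrite expr1n mulr1; move: xB; rewrite inE => /= <-.
        by rewrite lerXn2r ?nnegrE.
      case: (mu B) (measure_ge0 mu B) => [r _ _| |//]; first exact: ltry.
      by rewrite gt0_muley ?lte_fin.
    have [h Gh] := Hind B mB Bfin; exists (y%:C *: h); exact: graphZ.
  by exists h, (fun x => (s N x)%:C); split=> //; rewrite l2BC; apply: HN.
move=> f [[mR mI] lf].
have part (u : X -> R) : measurable_fun setT u -> (forall x, u x ^+ 2 <= cnorm2 (f x)) ->
    exists h, graph h (fun x => (u x)%:C).
  move=> mu_ ule.
  pose up x := Num.max (u x) 0; pose un x := Num.max (- u x) 0.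
  have mup : measurable_fun setT up by exact: measurable_maxr.
  have mun : measurable_fun setT un.
    by apply: measurable_maxr => //; exact: measurableT_comp.
  have fin (v : X -> R) : measurable_fun setT v -> (forall x, v x ^+ 2 <= u x ^+ 2) -> (l2 (fun x => (v x)%:C) < +oo)%E.
    move=> mv vu; apply: le_lt_trans lf; apply: (l2_ae_le (g := f) (cmeas_real mv) (conj mR mI)).
    by apply: nearW => x; rewrite cnorm2_real; apply: le_trans (vu x) (ule x).
  have [h1 G1] : exists h, graph h (fun x => (up x)%:C).
    apply: nonneg => //; first by move=> x; rewrite le_max lexx orbT.
    by apply: fin => // x; rewrite /up maxEle; case: ifP => _; rewrite ?expr0n ?sqr_ge0.
  have [h2 G2] : exists h, graph h (fun x => (un x)%:C).
    apply: nonneg => //; first by move=> x; rewrite le_max lexx orbT.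
    by apply: fin => // x; rewrite /un maxEle; case: ifP => _; rewrite ?sqrrN ?expr0n ?sqr_ge0.
  exists (h1 - h2); have := graphB G1 G2; congr (graph _ _); apply/funext => x.
  rewrite -rmorphB; congr (_%:C); rewrite /up /un; have [h|h] := leP (u x) 0.
    by rewrite max_l ?oppr_ge0// sub0r opprK.
  by rewrite max_r ?oppr_le0 ?ltW// subr0.
have [h1 G1] := part _ mR (fun x => ltac:(by rewrite lerDl sqr_ge0)).
have [h2 G2] := part _ mI (fun x => ltac:(by rewrite lerDr sqr_ge0)).
exists (h1 + 'i%C *: h2); have := graphD G1 (graphZ 'i%C G2).
by congr (graph _ _); apply/funext => x; apply: complexP;
  rewrite !ReImE /= ?mul0r ?mulr0 ?mul1r ?subr0 ?addr0 ?add0r.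
Qed.

End Isometry.

(** * The L2 model of a commuting family of projections *)

Section TreeMore.
Variables (R : realType) (V : lmodType R[i]) (ip : V -> V -> R[i]).
Hypothesis ipP : is_inner_product ip.
Variable P : nat -> V -> V.
Hypothesis Pproj : forall k, is_oproj ip (P k).
Hypothesis Pcomm : forall k l x, P k (P l x) = P l (P k x).
Local Notation E := (treeproj P).

Lemma treeproj_rcons k p b x : E k (rcons p b) x = branch P (k + size p) b (E k p x).
Proof.
elim: p k x => [|c p IH] k x /=; first by rewrite addn0.
by rewrite IH addSnnS.
Qed.

Lemma treeproj_split k p x : E k p x = E k (rcons p true) x + E k (rcons p false) x.
Proof. by rewrite !treeproj_rcons /branch addrC subrK. Qed.

Lemma proj_treeproj_deep l k p x : (l < size p)%N ->
  P (k + l) (E k p x) = if nth false p l then E k p x else 0.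
Proof.
elim: p k l x => //= b p IH k l x; rewrite ltnS; case: l => [_|l lp] /=.
  rewrite addn0 (branch_treeproj ipP Pproj Pcomm).
  have [lin idem _] := Pproj k.
  by case: b; rewrite /branch ?idem// (linopB lin) idem subrr.
by rewrite -addSnnS IH.
Qed.

(** P_k h is the sum of [E 0 p h] over the paths of length k + 1 whose last turn is [true]. The
    induction splits a node until its path is long enough to decide P_k. *)
Lemma tree_P_sub M h : subspace M -> (forall p, M (E 0 p h)) -> forall k, M (P k h).
Proof.
move=> Ms HM k.
have aux j p : (k.+1 - size p <= j)%N -> M (P k (E 0 p h)).
  elim: j p => [|j IH] p.
    rewrite leqn0 subn_eq0 => kp; rewrite -[k in P k]add0n proj_treeproj_deep//.
    by case: nth => //; exact: subspace0.
  move=> kp; rewrite treeproj_split; have [lin _ _] := Pproj k.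
  rewrite (linopD lin); apply: (subspaceD Ms); apply: IH; rewrite size_rcons subnS;
    by rewrite -subn1 leq_subLR add1n.
exact: (aux k.+1 [::]).
Qed.

End TreeMore.

Section Model.
Variables (R : realType) (V : lmodType R[i]) (ip : V -> V -> R[i]).
Hypothesis ipP : is_inner_product ip.
Hypothesis hcomp : hcomplete ip.
Local Notation C := R[i].
Local Notation nrm2 := (nrm2 ip).
Variable P : nat -> V -> V.
Hypothesis Pproj : forall k, is_oproj ip (P k).
Hypothesis Pcomm : forall k l x, P k (P l x) = P l (P k x).
Local Notation E := (treeproj P 0).
Local Notation I p v := (tree_itv ip P 0 p v).
Variable S : set V.
Hypothesis Sorth : forall u v p, S u -> S v -> u != v -> ip u (E p v) = 0.
Hypothesis Smax : forall w, (forall v p, S v -> ip w (E p v) = 0) -> w = 0.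

(** The empty set is added to make the family stable under intersection, as the Dynkin argument
    requires. *)
Definition tree_sets (v : V) : set (set R) := [set B | B = set0 \/ exists p, B = I p v].
Definition tree_top (v : V) : set R := I [::] v.

Lemma tree_itv_itv p v : I p v =
  `[tree_start ip P 0 p v, tree_start ip P 0 p v + nrm2 (E p v)[%classic.
Proof. by rewrite set_itvE. Qed.

Lemma tree_itv_leb p v : lebesgue_measure (I p v) = (nrm2 (E p v))%:E.
Proof.
rewrite tree_itv_itv lebesgue_measure_itv /= lte_fin ltrDl.
case: ltP => h; first by rewrite -EFinB addrC addKr.
by congr EFin; apply/eqP; rewrite eq_le (nrm2_ge0 ipP) h.
Qed.

Lemma tree_sets_meas v B : tree_sets v B -> measurable (B : set (measurableTypeR R)).
Proof.
move=> [->|[p ->]]; first exact: measurable0.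
by rewrite tree_itv_itv; exact: measurable_itv.
Qed.
Lemma tree_top_sets v : tree_sets v (tree_top v).
Proof. by right; exists [::]. Qed.
Lemma tree_top_fin v : (lebesgue_measure (tree_top v) < +oo)%E.
Proof. by rewrite tree_itv_leb ltry. Qed.
Lemma tree_itv_top p v : I p v `<=` tree_top v.
Proof.
move=> r /(tree_itv_sub ipP Pproj) h; apply/(tree_itvP ip P 0 [::] v r).
by rewrite /= add0r.
Qed.

Lemma tree_sets_setI v : setI_closed (tree_sets v).
Proof.
move=> B B' [->|[p ->]]; first by left; rewrite set0I.
move=> [->|[q ->]]; first by left; rewrite setI0.
have [[h _]|[h _]|[h _]] := tree_trichotomy ipP Pproj Pcomm 0 p q v.
- by right; exists p; apply/setIidPl.
- by right; exists q; apply/setIidPr.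
- by left.
Qed.

Definition mX := bundle (0 : V) tree_sets.
Definition mmu : {measure set mX -> \bar R} :=
  @bundle_mu V 0 R tree_sets tree_sets_meas S tree_top tree_top_sets.
Arguments mmu : simpl never.

Definition gen := {t : V * seq bool | S t.1}.
Definition gvec (k : gen) : V := E (sval k).2 (sval k).1.
Definition gset (k : gen) : set mX := [set (sval k).1] `*` I (sval k).2 (sval k).1.
Definition gm (k l : gen) : R := complex.Re (ip (gvec k) (gvec l)).

Lemma tree_itv_sig p v : <<s tree_sets v >> (I p v).
Proof. by apply: sub_gen_smallest; right; exists p. Qed.

Lemma gset_meas k : measurable (gset k).
Proof. by apply: measurable_fiber; exact: tree_itv_sig. Qed.

Lemma mmu_fiber v (B : set R) : S v -> <<s tree_sets v >> B ->
  mmu ([set v] `*` B) = lebesgue_measure (B `&` tree_top v).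
Proof. exact: bundle_measure_fiber. Qed.

Lemma mmu_itv p v : S v -> mmu ([set v] `*` I p v) = (nrm2 (E p v))%:E.
Proof.
move=> Sv; rewrite mmu_fiber//; last exact: tree_itv_sig.
by have /setIidPl -> := @tree_itv_top p v; rewrite tree_itv_leb.
Qed.

Lemma ip_treeproj p x : ip x (E p x) = (nrm2 (E p x))%:C.
Proof.
have [_ i a] := treeproj_oproj ipP Pproj Pcomm 0 p.
by rewrite -{1}i -a (ip_self ipP).
Qed.

(** Different fibres are disjoint and the corresponding cyclic subspaces orthogonal; within one
    fibre the trichotomy reduces both sides to a single node. In particular the inner products are
    real. *)
Lemma itv_inter v p w q : S v -> S w -> exists r : R, ip (E p v) (E q w) = r%:C /\
  mmu (([set v] `*` I p v) `&` ([set w] `*` I q w)) = r%:E.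
Proof.
move=> Sv Sw; have [_ _ a] := treeproj_oproj ipP Pproj Pcomm 0 p.
have [evw|vw] := eqVneq v w; last first.
  exists 0; split.
    rewrite a; have [[_ ->]|[_ ->]|[_ ->]] := tree_trichotomy ipP Pproj Pcomm 0 p q w.
    - exact: Sorth.
    - exact: Sorth.
    - exact: (ip0r ipP).
  have -> : ([set v] `*` I p v) `&` ([set w] `*` I q w) = set0.
    rewrite -subset0 => -[u r] [[e1 _] [e2 _]].
    by rewrite -[v]e1 -[w]e2 eqxx in vw.
  by rewrite measure0.
rewrite -evw a -(setXI [set v]) setIid.
have [[h ->]|[h ->]|[h ->]] := tree_trichotomy ipP Pproj Pcomm 0 p q v.
- by move/setIidPl : h => ->; exists (nrm2 (E p v)); rewrite ip_treeproj mmu_itv.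
- by move/setIidPr : h => ->; exists (nrm2 (E q v)); rewrite ip_treeproj mmu_itv.
- by exists 0; rewrite (ip0r ipP) h setX0 measure0.
Qed.

Lemma gen_inter k l : ip (gvec k) (gvec l) = (gm k l)%:C /\
  mmu (gset k `&` gset l) = (gm k l)%:E.
Proof.
suff [r [h1 h2]] : exists r : R, ip (gvec k) (gvec l) = r%:C /\ mmu (gset k `&` gset l) = r%:E.
  by rewrite /gm h1 h2.
by case: k l => [[v p] Sv] [[w q] Sw]; exact: itv_inter.
Qed.

Definition mgraph := graph ip mmu gvec gset.
Let ipE k l := (gen_inter k l).1.
Let muE k l := (gen_inter k l).2.

Lemma mgraph_total h : exists f, mgraph h f.
Proof.
apply: (graph_total ipP hcomp gset_meas ipE muE) => w Hw.
by apply: Smax => v p Sv; exact: (Hw (exist _ (v, p) Sv)).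
Qed.
Lemma mgraph_isom h f : mgraph h f -> l2 mmu f = (nrm2 h)%:E.
Proof. exact: (graph_isom ipP gset_meas ipE muE). Qed.
Lemma mgraph_dist h f k g : mgraph h f -> mgraph k g ->
  l2 mmu (fun x => f x - g x) = (nrm2 (h - k))%:E.
Proof. exact: (graph_dist ipP gset_meas ipE muE). Qed.
Lemma mgraph_uniq h f g : mgraph h f -> mgraph h g -> {ae mmu, forall x, f x = g x}.
Proof. exact: (graph_fun_uniq ipP gset_meas ipE muE). Qed.

Lemma mgraph0 : mgraph 0 (fun=> 0). Proof. exact: (graph0 ipP). Qed.
Lemma mgraphD h f k g : mgraph h f -> mgraph k g -> mgraph (h + k) (fun x => f x + g x).
Proof. exact: (graphD ipP gset_meas). Qed.
Lemma mgraphZ a h f : mgraph h f -> mgraph (a *: h) (fun x => a * f x).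
Proof. exact: (graphZ ipP gset_meas). Qed.
Lemma mgraphB h f k g : mgraph h f -> mgraph k g -> mgraph (h - k) (fun x => f x - g x).
Proof. exact: (graphB ipP gset_meas). Qed.
Lemma mgraph_closed h f : cmeasurable f ->
  (forall e : R, 0 < e -> exists h' f', [/\ mgraph h' f', nrm2 (h - h') < e &
     (l2 mmu (fun x => f x - f' x)%R < e%:E)%E]) -> mgraph h f.
Proof. exact: (graph_closed ipP gset_meas). Qed.
Lemma mgraph_ae h f g : mgraph h f -> cmeasurable g -> {ae mmu, forall x, f x = g x} ->
  mgraph h g.
Proof. exact: (graph_ae ipP gset_meas). Qed.
Lemma mgraph_meas h f : mgraph h f -> cmeasurable f. Proof. by case. Qed.

(** Both N and multiplication by g are contractive, so agreement on the generators passes to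
    combinations and then to limits. *)
Lemma graph_op (N : V -> V) (g : mX -> C) : linear_op N ->
  (forall x, nrm2 (N x) <= nrm2 x) -> cmeasurable g ->
  {ae mmu, forall x, cnorm2 (g x) <= 1} ->
  (forall k, mgraph (N (gvec k)) (fun x => g x * (\1_(gset k) x : R)%:C)) ->
  forall h f, mgraph h f -> mgraph (N h) (fun x => g x * f x).
Proof.
move=> Nl Nle mg g1 Hg h f Gf.
have gl s : mgraph (N (lvec gvec s)) (fun x => g x * lfun gset s x).
  elim: s => [|[a k] s IH].
    rewrite /lvec big_nil (linop0 Nl); under eq_fun do rewrite /lfun big_nil mulr0.
    exact: graph0.
  rewrite /lvec big_cons Nl.
  have -> : (fun x => g x * lfun gset ((a, k) :: s) x) =
      (fun x => a * (g x * (\1_(gset k) x : R)%:C) + g x * lfun gset s x).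
    by apply/funext => x; rewrite /lfun big_cons mulrDr mulrCA.
  exact: (graphD ipP gset_meas (graphZ ipP gset_meas a (Hg k)) IH).
have mf := graph_meas Gf.
apply: (graph_closed ipP gset_meas); first exact: cmeasM.
move=> e e0; have [s [s1 s2]] := Gf.2 e e0.
exists (N (lvec gvec s)), (fun x => g x * lfun gset s x); split; first exact: gl.
  by rewrite -(linopB Nl); apply: le_lt_trans (Nle _) s1.
apply: le_lt_trans s2; have ml := cmeasB mf (lfun_meas gset_meas s).
have -> : (fun x => g x * f x - g x * lfun gset s x) = (fun x => g x * (f x - lfun gset s x)).
  by apply/funext => x; rewrite mulrBr.
apply: l2_ae_le => //; first exact: cmeasM.
by apply: filterS g1 => x h1; rewrite cnorm2M ler_piMl// cnorm2_ge0.
Qed.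

Definition tree_region p : set mX := [set x | I p x.1 x.2].

Lemma tree_region_meas p : measurable (tree_region p).
Proof. by rewrite bundle_measurableE => j; exact: tree_itv_sig. Qed.

Lemma gset_gen v p (Sv : S v) : gset (exist _ (v, p) Sv) = [set v] `*` I p v.
Proof. by []. Qed.

Lemma mgraph_itv v p : S v -> mgraph (E p v) (fun x => (\1_([set v] `*` I p v) x : R)%:C).
Proof. by move=> Sv; exact: (graph_gen ipP mmu gvec gset_meas (exist _ (v, p) Sv)). Qed.

(** On generators this is the trichotomy: E_p E_q v is E_p v, E_q v or 0 exactly as the two
    intervals intersect. *)
Lemma graph_tree p h f : mgraph h f ->
  mgraph (E p h) (fun x => (\1_(tree_region p) x : R)%:C * f x).
Proof.
have Op := treeproj_oproj ipP Pproj Pcomm 0 p; have [l _ _] := Op.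
apply: graph_op => //.
- by move=> x; rewrite -(hnorm_le ipP); exact: (oproj_le ipP Op).
- exact: (@cmeas_indic _ mX _ _ (tree_region_meas p)).
- by apply: nearW => x; rewrite cnorm2_real indicE; case: (_ \in _); rewrite ?expr1n ?expr0n//= ler01.
- move=> [[v q] /= Sv]; rewrite /gvec gset_gen /=.
  have -> : (fun x : mX => (\1_(tree_region p) x : R)%:C * (\1_([set v] `*` I q v) x : R)%:C) =
      (fun x => (\1_([set v] `*` (I p v `&` I q v)) x : R)%:C).
    apply/funext => -[u r]; rewrite -rmorphM; congr (_%:C).
    have -> : \1_(tree_region p) (u, r) * \1_([set v] `*` I q v) (u, r) =
       \1_(tree_region p `&` ([set v] `*` I q v)) (u, r) :> R by rewrite indicI.
    congr (\1_ _ _); apply/seteqP; split.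
      by move=> [u' r'] [h1 [/= h2 h3]]; split=> //=; split=> //; move: h1; rewrite /tree_region /= h2.
    by move=> [u' r'] [/= h1 [h2 h3]]; split=> //=; rewrite /tree_region /= h1.
  have [[h' ->]|[h' ->]|[h' ->]] := tree_trichotomy ipP Pproj Pcomm 0 p q v.
  - by move/setIidPl : h' => ->; exact: mgraph_itv.
  - by move/setIidPr : h' => ->; exact: mgraph_itv.
  - rewrite h'; under eq_fun do rewrite setX0 indic0 /=.
    exact: mgraph0.
Qed.

Definition fiber (v : V) : set mX := [set v] `*` setT.

Lemma measurable_fiber_set v (B : set R) : <<s tree_sets v >> B ->
  measurable ([set v] `*` B : set mX).
Proof. exact: measurable_fiber. Qed.

Lemma setT_sig v : <<s tree_sets v >> setT.
Proof.
have : <<s tree_sets v >> (setT `\` set0) by apply: sigma_algebraCD; exact: sigma_algebra0.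
by rewrite setD0.
Qed.

Lemma fiber_meas v : measurable (fiber v).
Proof. exact: (measurable_fiber_set (@setT_sig v)). Qed.

Lemma mmu_slices (B : set mX) :
  mmu B = 0%E <-> forall v, S v -> lebesgue_measure ([set r : R | B (v, r)] `&` tree_top v) = 0%E.
Proof. exact: bundle_measure0P. Qed.

(** An uncountable union of null sets is unavoidable here. One null set is chosen per fibre and only
    its part in that fibre is kept; the result is measurable and null because both are conditions on
    slices. Fibres over indices outside S carry no mass and are thrown in whole. *)
Lemma ae_slices (Q : mX -> Prop) :
  (forall v, S v -> {ae mmu, forall x : mX, x.1 = v -> Q x}) -> {ae mmu, forall x, Q x}.
Proof.
move=> H.
have /choice [Z HZ] : forall v, exists Z : set mX, measurable Z /\
    (S v -> mmu Z = 0%E /\ ~` [set x : mX | x.1 = v -> Q x] `<=` Z).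
  move=> v; have [Sv|nSv] := pselect (S v); last by exists set0; split.
  by have [Z [mZ Z0 ZQ]] := H v Sv; exists Z.
pose B' : set mX := [set x | Z x.1 x].
exists (B' `|` [set x | ~ S x.1]); split.
- apply: measurableU.
    rewrite bundle_measurableE => v; have := (HZ v).1; rewrite bundle_measurableE => /(_ v).
    by congr (<<s _ >> _); apply/seteqP.
  rewrite bundle_measurableE => v; have [Sv|nSv] := pselect (S v).
    rewrite (_ : slice _ v = set0); first exact: sigma_algebra0.
    by rewrite -subset0 => r h; exact: h.
  rewrite (_ : slice _ v = setT); first exact: setT_sig.
  by apply/seteqP; split=> r _ //; exact: nSv.
- apply/mmu_slices => v Sv; have [h _] := (HZ v).2 Sv.
  move/mmu_slices : h => /(_ v Sv); congr (lebesgue_measure (_ `&` _) = _).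
  by apply/seteqP; split=> [r h'|r [//|/(_ Sv)]//]; left.
- move=> x nQ; have [Sv|nSv] := pselect (S x.1); last by right.
  by left; apply: ((HZ x.1).2 Sv).2 => /(_ erefl).
Qed.

Lemma mgraph_fiber v : S v -> mgraph v (fun x => (\1_(fiber v) x : R)%:C).
Proof.
move=> Sv; apply: (mgraph_ae (mgraph_itv [::] Sv)).
  exact: (@cmeas_indic _ mX _ _ (fiber_meas v)).
have mC : <<s tree_sets v >> (~` I [::] v).
  have : <<s tree_sets v >> (setT `\` I [::] v) by apply: sigma_algebraCD; exact: tree_itv_sig.
  by rewrite setTD.
exists ([set v] `*` (~` I [::] v)); split.
- exact: measurable_fiber_set.
- by rewrite mmu_fiber// setICl measure0.
- move=> x nx; apply: contrapT => h; apply: nx => /=; congr (_%:C).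
  rewrite !indicE; congr ((nat_of_bool _)%:R); apply/idP/idP; rewrite !inE.
    by move=> [h1 h2]; split.
  move=> [h1 h2]; split=> //; apply: contrapT => h3; exact: h.
Qed.

Lemma indic_fiber_itv v p (x : mX) : (\1_(tree_region p) x : R)%:C * (\1_(fiber v) x : R)%:C =
  (\1_([set v] `*` I p v) x : R)%:C :> C.
Proof.
rewrite -rmorphM; congr (_%:C).
have -> : \1_(tree_region p) x * \1_(fiber v) x = \1_(tree_region p `&` fiber v) x :> R.
  by rewrite indicI.
congr (\1_ _ _); apply/seteqP; split=> -[u r].
  by move=> [h1 [h2 h3]]; split=> //; rewrite -[v]h2; exact: h1.
by move=> [h1 h2]; split=> //; rewrite /tree_region /= [u]h1.
Qed.

(** * Operators that act as multiplications *)

Section Multiplier.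
Variable N : V -> V.
Hypothesis Nlin : linear_op N.
Hypothesis Nle : forall x, nrm2 (N x) <= nrm2 x.
Hypothesis PN : forall k x, P k (N x) = N (P k x).
Hypothesis Ninv : forall W, closed_subspace ip W -> (forall k x, W x -> W (P k x)) ->
  forall x, W x -> W (N x).

(** The vectors whose functions vanish off the fibre of v form a closed subspace invariant under all
    P_k and containing v; by hypothesis it is then invariant under N. *)
Lemma multiplier_off_fiber v f : S v -> mgraph (N v) f ->
  {ae mmu, forall x : mX, x.1 != v -> f x = 0}.
Proof.
move=> Sv Gf.
pose W h := exists f, mgraph h f /\ {ae mmu, forall x : mX, x.1 != v -> f x = 0}.
suff [f' [Gf' f'0]] : W (N v).
  by apply: filterS (ae_and f'0 (mgraph_uniq Gf Gf')) => x [h ->].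
have Ws : subspace W.
  split; first by exists (fun=> 0); split; [exact: mgraph0|exact: nearW].
  move=> a x y [f1 [G1 h1]] [f2 [G2 h2]]; exists (fun x => a * f1 x + f2 x).
  split; first by apply: mgraphD => //; exact: mgraphZ.
  by apply: filterS (ae_and h1 h2) => z [e1 e2] zv; rewrite e1// e2// mulr0 addr0.
have Wtree p h : W h -> W (E p h).
  move=> [f1 [G1 h1]]; exists (fun x => (\1_(tree_region p) x : R)%:C * f1 x).
  by split; [exact: graph_tree|apply: filterS h1 => x e xv; rewrite e// mulr0].
apply: Ninv.
- split=> // u l ul Wu; have [fl Gl] := mgraph_total l; exists fl; split=> //.
  pose c (x : mX) : C := (\1_(~` fiber v) x : R)%:C.
  have mc : cmeasurable c by exact: (@cmeas_indic _ mX _ _ (measurableC (fiber_meas v))).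
  have c1 x : cnorm2 (c x) <= 1.
    by rewrite cnorm2_real indicE; case: (_ \in _); rewrite ?expr1n ?expr0n//= ler01.
  have cv x : x.1 != v -> c x = 1.
    move=> xv; rewrite /c indicE mem_set// => -[e _]; move: xv.
    by rewrite (_ : x.1 = v) ?eqxx.
  have c0 x : x.1 = v -> c x = 0.
    by move=> xv; rewrite /c indicE memNset//= => h; apply: h.
  have mfl := mgraph_meas Gl.
  have l0 : l2 mmu (fun x => c x * fl x) = 0%E.
    apply/eqP; rewrite eq_le l2_ge0 andbT; apply/lee_addgt0Pr => e e0; rewrite add0e.
    have sp : 0 < Num.sqrt e by rewrite sqrtr_gt0.
    have [M HM] := ul _ sp; have := HM _ (leqnn M).
    rewrite (hnorm_lt_sqrt ipP) ?sqrtr_ge0// sqr_sqrtr ?(ltW e0)// (nrm2BC ipP) => hM.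
    have [fM [GM h0]] := Wu M; have mfM := mgraph_meas GM.
    apply: (@le_trans _ _ (l2 mmu (fun x => c x * (fl x - fM x)))%R).
      rewrite le_eqVlt; apply/orP; left; apply/eqP; apply: l2_ae.
      - exact: cmeasM.
      - by apply: cmeasM => //; exact: cmeasB.
      - apply: filterS h0 => x h; have [/c0 ->|xv] := eqVneq x.1 v; first by rewrite !mul0r.
        by rewrite h// subr0.
    apply: (@le_trans _ _ (l2 mmu (fun x => fl x - fM x)))%R; last first.
      by rewrite (mgraph_dist Gl GM) lee_fin ltW.
    apply: l2_ae_le; [by apply: cmeasM => //; exact: cmeasB|exact: cmeasB|].
    by apply: nearW => x; rewrite cnorm2M ler_piMl// cnorm2_ge0.
  apply: filterS (l2_eq0 (cmeasM mc mfl) l0) => x + xv.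
  by rewrite cv// mul1r.
- move=> k x Wx; apply: (tree_P_sub ipP Pproj Pcomm Ws) => p; exact: Wtree.
- exists (fun x => (\1_(fiber v) x : R)%:C); split; first exact: mgraph_fiber.
  apply: nearW => x xv; rewrite indicE memNset// => -[e _]; move: xv.
  by rewrite (_ : x.1 = v) ?eqxx.
Qed.

(** The tree intervals are stable under intersection and generate the sigma-algebra of the fibre, so
    the identity extends from them by the pi-lambda theorem. The preimage of the indicator is
    carried along because it is not known in advance to exist. *)
Lemma fiber_dynkin (g : mX -> C) v (B : set R) : cmeasurable g -> S v ->
  (forall p, mgraph (N (E p v)) (fun x => g x * (\1_([set v] `*` I p v) x : R)%:C)) ->
  mgraph (N v) (fun x => g x * (\1_(fiber v) x : R)%:C) ->
  <<s tree_sets v >> B ->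
  exists k, mgraph k (fun x => (\1_([set v] `*` B) x : R)%:C) /\
    mgraph (N k) (fun x => g x * (\1_([set v] `*` B) x : R)%:C).
Proof.
move=> mg Sv gI gT.
pose Q (B : set R) := exists k, mgraph k (fun x => (\1_([set v] `*` B) x : R)%:C) /\
    mgraph (N k) (fun x => g x * (\1_([set v] `*` B) x : R)%:C).
pose T := g_sigma_algebraType (tree_sets v).
have mind (A : set R) : <<s tree_sets v >> A ->
    cmeasurable (fun x : mX => (\1_([set v] `*` A) x : R)%:C).
  by move=> mA; exact: (@cmeas_indic _ mX _ _ (measurable_fiber_set mA)).
have Q0 : Q set0.
  exists 0; rewrite (linop0 Nlin) setX0; split.
    by under eq_fun do rewrite indic0 /=; exact: mgraph0.
  by under eq_fun do rewrite indic0 /= mulr0; exact: mgraph0.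
apply: (@dynkin_induction _ T (tree_sets v) Q) => //.
- exact: tree_sets_setI.
- by exists v; split; [exact: mgraph_fiber|].
- move=> A [->|[p ->]] //; exists (E p v); split; [exact: mgraph_itv|exact: gI].
- move=> A mA [k [G1 G2]]; exists (v - k).
  have cE (x : mX) : (\1_([set v] `*` ~` A) x : R)%:C =
      (\1_(fiber v) x : R)%:C - (\1_([set v] `*` A) x : R)%:C :> C.
    rewrite -rmorphB; congr (_%:C); case: x => u r.
    have [->|uv] := eqVneq u v.
      have [Ar|nAr] := pselect (A r).
        rewrite !indicE [_ \in _ `*` ~` A]memNset; last by move=> [].
        by rewrite !mem_set// subrr.
      rewrite !indicE [_ \in _ `*` A]memNset; last by move=> [].
      by rewrite !mem_set// subr0.
    by rewrite !indicE !memNset ?subrr// => -[/= e _]; rewrite e eqxx in uv.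
  split.
    under eq_fun do rewrite cE; apply: mgraphB => //; exact: mgraph_fiber.
  rewrite (linopB Nlin); under eq_fun do rewrite cE mulrBr.
  exact: mgraphB.
- move=> F mF tF QF; have /choice [k Hk] := QF.
  pose U n := \bigcup_(i < n) F i.
  pose B' := \bigcup_i F i.
  have mU n : <<s tree_sets v >> (U n).
    by apply: (@bigcup_measurable _ T) => i _; exact: mF.
  have mB' : <<s tree_sets v >> B'.
    by apply: (@bigcupT_measurable _ T).
  pose kn n := \sum_(0 <= i < n) k i.
  have UE n (x : mX) : (\1_([set v] `*` U n.+1) x : R)%:C =
      (\1_([set v] `*` U n) x : R)%:C + (\1_([set v] `*` F n) x : R)%:C :> C.
    rewrite -rmorphD; congr (_%:C); case: x => u r.
    have [->|uv] := eqVneq u v; last first.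
      by rewrite !indicE !memNset ?addr0// => -[/= e _]; rewrite e eqxx in uv.
    have [Fr|nFr] := pselect (F n r).
      have nU : ~ U n r.
        move=> [i /= ni Fi]; have e : i = n by apply: (tF i n Logic.I Logic.I); exists r.
        by rewrite e ltnn in ni.
      rewrite !indicE [_ \in _ `*` U n]memNset; last by move=> [].
      rewrite !mem_set ?add0r//; first by split=> //; exists n => /=.
    rewrite !indicE [_ \in _ `*` F n]memNset ?addr0; last by move=> [].
    congr ((nat_of_bool _)%:R); apply/idP/idP; rewrite !inE => -[h1 [i /= ni Fi]]; split=> //.
      by exists i => //=; move: ni; rewrite ltnS leq_eqVlt => /orP[/eqP e|//]; rewrite e in Fi.
    by exists i => //=; exact: ltnW.
  have Gn n : mgraph (kn n) (fun x => (\1_([set v] `*` U n) x : R)%:C) /\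
      mgraph (N (kn n)) (fun x => g x * (\1_([set v] `*` U n) x : R)%:C).
    elim: n => [|n [IH1 IH2]].
      rewrite /kn big_geq// (linop0 Nlin).
      have -> : U 0%N = set0 by rewrite /U bigcup_mkord big_ord0.
      rewrite setX0; split.
        by under eq_fun do rewrite indic0 /=; exact: mgraph0.
      by under eq_fun do rewrite indic0 /= mulr0; exact: mgraph0.
    have [k1 k2] := Hk n; rewrite /kn big_nat_recr//= -/(kn n) (linopD Nlin); split.
      by under eq_fun do rewrite UE; exact: mgraphD.
    by under eq_fun do rewrite UE mulrDr; exact: mgraphD.
  have ev (x : mX) : exists M, forall n, (M <= n)%N ->
      (\1_([set v] `*` U n) x : R)%:C = (\1_([set v] `*` B') x : R)%:C :> C.
    have [[h1 [i _ Fi]]|nB] := pselect (([set v] `*` B') x).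
      exists i.+1 => n ni; rewrite !indicE !mem_set//; first by split=> //; exists i.
      by split=> //; exists i.
    exists 0%N => n _; rewrite !indicE !memNset// => -[h1 [i _ Fi]].
    by apply: nB; split=> //; exists i.
  have dom n (x : mX) : cnorm2 ((\1_([set v] `*` U n) x : R)%:C - (\1_([set v] `*` B') x : R)%:C)
      <= cnorm2 ((\1_(fiber v) x : R)%:C : C).
    rewrite -rmorphB !cnorm2_real.
    have [xv|nxv] := pselect (fiber v x).
      rewrite [\1_(fiber v) x]indicE mem_set// expr1n !indicE.
      by case: (_ \in _); case: (_ \in _); rewrite /= ?subrr ?subr0 ?sub0r ?sqrrN ?expr1n ?expr0n.
    rewrite !indicE !memNset ?subrr// => -[h1 _]; apply: nxv; split=> //.
  have mfib : cmeasurable (fun x => (\1_(fiber v) x : R)%:C : C).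
    exact: (@cmeas_indic _ mX _ _ (fiber_meas v)).
  have L1 : forall e : R, 0 < e -> exists M, forall n, (M <= n)%N ->
      (l2 mmu (fun x => (\1_([set v] `*` U n) x : R)%:C - (\1_([set v] `*` B') x : R)%:C)%R < e%:E)%E.
    apply: (l2_dominated (fun n => mind _ (mU n)) (mind _ mB') mfib).
    - by rewrite (mgraph_isom (mgraph_fiber Sv)) ltry.
    - by apply: nearW => x n; exact: dom.
    - apply: nearW => x; have [M HM] := ev x; apply: cvg_near_cst; exists M => // n Mn /=.
      by rewrite HM// subrr cnorm20.
  (* At this stage g is not known to be bounded; the dominating function g times the indicator of
     the fibre is square-integrable because it represents N v. *)
  have L2' : forall e : R, 0 < e -> exists M, forall n, (M <= n)%N ->
      (l2 mmu (fun x => g x * (\1_([set v] `*` U n) x : R)%:C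
         - g x * (\1_([set v] `*` B') x : R)%:C)%R < e%:E)%E.
    apply: (l2_dominated (fun n => cmeasM mg (mind _ (mU n))) (cmeasM mg (mind _ mB'))
      (cmeasM mg mfib)).
    - by rewrite (mgraph_isom gT) ltry.
    - apply: nearW => x n; rewrite -mulrBr !cnorm2M ler_wpM2l ?cnorm2_ge0//; exact: dom.
    - apply: nearW => x; have [M HM] := ev x; apply: cvg_near_cst; exists M => // n Mn /=.
      by rewrite HM// subrr cnorm20.
  have [h Gh] : exists h, mgraph h (fun x => (\1_([set v] `*` B') x : R)%:C).
    apply: (graph_range_closed ipP hcomp gset_meas ipE muE); first exact: mind.
    move=> e e0; have [M HM] := L1 e e0; exists (kn M), (fun x => (\1_([set v] `*` U M) x : R)%:C).
    by split; [exact: (Gn M).1|rewrite l2BC; exact: HM].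
  exists h; split=> //; apply: mgraph_closed; first by apply: cmeasM => //; exact: mind.
  move=> e e0; have [M1 HM1] := L1 e e0; have [M2 HM2] := L2' e e0; pose M := maxn M1 M2.
  exists (N (kn M)), (fun x => g x * (\1_([set v] `*` U M) x : R)%:C); split.
  - exact: (Gn M).2.
  - rewrite -(linopB Nlin); apply: le_lt_trans (Nle _) _.
    rewrite -lte_fin -(mgraph_dist Gh (Gn M).1) l2BC; apply: HM1; exact: leq_maxl.
  - rewrite l2BC; apply: HM2; exact: leq_maxr.
Qed.

(** Since v is represented by the indicator of its fibre, the multiplier there can only be the
    function of N v. These functions are glued over all v. *)
Lemma multiplier : exists g : mX -> C, [/\ cmeasurable g,
  {ae mmu, forall x, cnorm2 (g x) <= 1} &
  forall h f, mgraph h f -> mgraph (N h) (fun x => g x * f x)].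
Proof.
have /choice [F HF] : forall v, exists f, mgraph (N v) f by move=> v; exact: mgraph_total.
pose g (x : mX) := F x.1 x.
have mg : cmeasurable g.
  split.
  - apply: (@measurable_diag _ 0 _ tree_sets _ _ (fun v x => complex.Re (F v x))) => v.
    by have [] := mgraph_meas (HF v).
  - apply: (@measurable_diag _ 0 _ tree_sets _ _ (fun v x => complex.Im (F v x))) => v.
    by have [] := mgraph_meas (HF v).
have mfib v : cmeasurable (fun x => (\1_(fiber v) x : R)%:C : C).
  exact: (@cmeas_indic _ mX _ _ (fiber_meas v)).
have gT v : S v -> mgraph (N v) (fun x => g x * (\1_(fiber v) x : R)%:C).
  move=> Sv; apply: (mgraph_ae (HF v)); first by apply: cmeasM.
  apply: filterS (multiplier_off_fiber Sv (HF v)) => x off.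
  have [xv|xv] := eqVneq x.1 v.
    rewrite indicE mem_set; last by split.
    by rewrite mulr1 /g xv.
  rewrite off// indicE memNset ?mulr0// => -[e _]; move: xv.
  by rewrite (_ : x.1 = v) ?eqxx.
have gI v p : S v -> mgraph (N (E p v)) (fun x => g x * (\1_([set v] `*` I p v) x : R)%:C).
  move=> Sv; rewrite -(treeproj_comm 0 p v Nlin PN).
  have := graph_tree p (gT v Sv); congr (mgraph _ _); apply/funext => x.
  by rewrite mulrCA indic_fiber_itv.
have g1 : {ae mmu, forall x, cnorm2 (g x) <= 1}.
  pose B : set mX := [set x | 1 < cnorm2 (g x)].
  have mB : measurable B.
    have := measurable_cnorm2 mg measurableT (measurable_itv `]1, +oo[%R).
    by rewrite setTI; congr measurable; apply/seteqP; split=> x; rewrite /B /= in_itv /= andbT.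
  apply: ae_slices => v Sv.
  have mBv : <<s tree_sets v >> [set r | B (v, r)] by exact: mB.
  pose A : set mX := [set v] `*` [set r | B (v, r)].
  have mA : measurable A by exact: measurable_fiber_set.
  have [k [G1 G2]] := fiber_dynkin mg Sv (fun p => gI v p Sv) (gT v Sv) mBv.
  (* The excess of |g|^2 over 1 on A. If k represents the indicator of A, then the integral of u
     plus the finite measure of A is |N k|^2 <= |k|^2, which is the measure of A; so u vanishes
     a.e. *)
  pose u x := (cnorm2 (g x) - 1) * \1_A x : R.
  have AB x : A x -> B x by case: x => w r [/= -> h].
  have u0 x : 0 <= u x.
    rewrite /u indicE; have [xA|xA] := boolP (x \in A); last by rewrite mulr0.
    by rewrite mulr1 subr_ge0 ltW//; apply: AB; move: xA; rewrite inE.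
  have mu_ : measurable_fun setT u.
    apply: measurable_funM; last exact: (@measurable_indic _ mX).
    by apply: measurable_funB => //; exact: measurable_cnorm2.
  have iu : (\int[mmu]_x (u x)%:E = 0)%E.
    have : (\int[mmu]_x (u x)%:E + mmu A <= mmu A)%E.
      have <- : l2 mmu (fun x => g x * (\1_A x : R)%:C) = (\int[mmu]_x (u x)%:E + mmu A)%E.
        rewrite -(@l2_indic _ _ _ mmu A mA) /l2 -ge0_integralD//.
        - apply: eq_integral => x _; rewrite cnorm2M !cnorm2_real -EFinD /u; congr EFin.
          by rewrite indicE; case: (_ \in _); rewrite /= ?expr1n ?expr0n /=; ring.
        - by move=> x _; rewrite lee_fin.
        - exact/measurable_EFinP.
        - by move=> x _; rewrite lee_fin cnorm2_ge0.
        - exact/measurable_ecnorm2/(@cmeas_indic _ mX _ _ mA).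
      by rewrite -[leRHS](@l2_indic _ _ _ mmu A mA) (mgraph_isom G2) (mgraph_isom G1) lee_fin.
    rewrite -(@l2_indic _ _ _ mmu A mA) (mgraph_isom G1).
    have : (0 <= \int[mmu]_x (u x)%:E)%E by apply: integral_ge0 => x _; rewrite lee_fin.
    case: (\int[mmu]_x _)%E => [r| |] i0 //.
    rewrite -EFinD !lee_fin in i0 * => h; congr EFin; lra.
  have : ae_eq mmu setT (fun x => (u x)%:E) (cst 0%E).
    apply/ae_eq_integral_abs => //; first exact/measurable_EFinP.
    by rewrite -[RHS]iu; apply: eq_integral => x _; rewrite gee0_abs ?lee_fin.
  apply: filterS => x /(_ Logic.I) /= [ux] xv; rewrite leNgt; apply/negP => Bx.
  have xA : A x by split=> //=; rewrite /B /= -xv; case: (x) Bx.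
  move: ux; rewrite /u indicE mem_set// mulr1 => /eqP; rewrite subr_eq0 => /eqP e1.
  by rewrite e1 ltxx in Bx.
exists g; split=> //; apply: graph_op => //.
by move=> [[v p] Sv]; exact: gI.
Qed.

End Multiplier.

(** [fiber_dynkin] for the identity operator with multiplier 1. *)
Lemma mgraph_fiber_indic v (B : set R) : S v -> <<s tree_sets v >> B ->
  exists k, mgraph k (fun x => (\1_([set v] `*` B) x : R)%:C).
Proof.
move=> Sv mB.
have gI p : mgraph (id (E p v)) (fun x => 1 * (\1_([set v] `*` I p v) x : R)%:C).
  by under eq_fun do rewrite mul1r; exact: mgraph_itv.
have gT : mgraph (id v) (fun x => 1 * (\1_(fiber v) x : R)%:C).
  by under eq_fun do rewrite mul1r; exact: mgraph_fiber.
have lid : linear_op (@id V) by [].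
have [k [Gk _]] := fiber_dynkin lid (fun x => lexx (nrm2 x)) (cmeas_cst 1) Sv gI gT mB.
by exists k.
Qed.

Lemma mgraph_finite_indic (B : set mX) (s : seq V) : measurable B ->
  (forall v, v \in s -> S v) ->
  exists h, mgraph h (fun x => (\1_(B `&` [set x : mX | x.1 \in s]) x : R)%:C).
Proof.
move=> mB; elim: s => [|v s IH] Ss.
  exists 0; rewrite (_ : B `&` _ = set0); last by rewrite -subset0 => x [].
  by under eq_fun do rewrite indic0 /=; exact: mgraph0.
have [|h Gh] := IH; first by move=> u us; apply: Ss; rewrite inE us orbT.
have [vs|vs] := boolP (v \in s).
  exists h; move: Gh; congr (mgraph _ _); apply/funext => x; congr (\1_ _ _)%:C.
  congr (_ `&` _); apply/seteqP; split=> y /=; rewrite inE; first by move=> ->; rewrite orbT.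
  by case/orP => // /eqP ->.
have mBv : <<s tree_sets v >> [set r | B (v, r)] by exact: mB.
have Sv : S v by apply: Ss; rewrite inE eqxx.
have [k Gk] := mgraph_fiber_indic Sv mBv.
exists (k + h); have := mgraphD Gk Gh; congr (mgraph _ _); apply/funext => -[u r].
rewrite -rmorphD; congr (_%:C); rewrite !indicE.
have [uv|uv] := eqVneq u v.
  rewrite [_ \in _ `&` [set x | x.1 \in s]]memNset; last by move=> [_ /=]; rewrite uv; apply/negP.
  rewrite addr0; congr ((nat_of_bool _)%:R); apply/idP/idP; rewrite !inE.
    by move=> [h1 h2]; split=> /=; [rewrite uv; exact: h2|rewrite inE uv eqxx].
  by move=> [h1 h2]; split=> //=; rewrite -uv.
rewrite [_ \in [set v] `*` _]memNset; last by move=> [/= e _]; rewrite e eqxx in uv.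
rewrite add0r; congr ((nat_of_bool _)%:R); apply/idP/idP; rewrite !inE => -[h1 h2]; split=> //.
  by rewrite /= inE h2 orbT.
by move: h2; rewrite /= inE (negbTE uv).
Qed.

Lemma mgraph_onto f : cL2 mmu f -> exists h, mgraph h f.
Proof.
apply: (graph_onto ipP hcomp gset_meas ipE muE) => B mB Bfin.
apply: (graph_range_closed ipP hcomp gset_meas ipE muE).
  exact: (@cmeas_indic _ mX _ _ mB).
move=> e e0.
have [F [/finite_seqP [s Fs] FS] hF] := bundle_measure_finite_approx mB e0 Bfin.
have mF : measurable [set x : mX | x.1 \in s].
  rewrite bundle_measurableE => v; have [vs|vs] := boolP (v \in s).
    rewrite (_ : slice _ v = setT); first exact: setT_sig.
    by apply/seteqP; split=> r.
  rewrite (_ : slice _ v = set0); first exact: sigma_algebra0.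
  by rewrite -subset0 => r /= h; rewrite /slice /= in h; rewrite h in vs.
have [h Gh] : exists h, mgraph h (fun x => (\1_(B `&` [set x : mX | x.1 \in s]) x : R)%:C).
  by apply: mgraph_finite_indic => // v vs; apply: FS; rewrite Fs.
exists h, (fun x => (\1_(B `&` [set x : mX | x.1 \in s]) x : R)%:C); split=> //.
have mD : measurable (B `\` [set x : mX | x.1 \in s]) by exact: measurableD.
have -> : (fun x : mX => (\1_B x : R)%:C - (\1_(B `&` [set x : mX | x.1 \in s]) x : R)%:C) =
    (fun x => (\1_(B `\` [set x : mX | x.1 \in s]) x : R)%:C : C).
  apply/funext => x; rewrite -rmorphB; congr (_%:C); rewrite !indicE in_setD in_setI.
  by case: (_ \in B); case: (_ \in _); rewrite /= ?subrr ?subr0.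
rewrite (@l2_indic _ _ _ mmu _ mD); apply: le_lt_trans hF; rewrite le_eqVlt; apply/orP; left.
apply/eqP; congr (bundle_measure _ _ _); congr (B `\` _); rewrite Fs.
by apply/seteqP; split=> [x h'|x [h' _]].
Qed.

Lemma mmu_semifinite : semifinite mmu.
Proof.
exact: (@bundle_semifinite V 0 R tree_sets tree_sets_meas S tree_top tree_top_sets tree_top_fin).
Qed.

End Model.

(** * The integral of a damped semigroup *)

Section DampedIntegral.
Variables (R : realType) (V : lmodType R[i]) (ip : V -> V -> R[i]).
Hypothesis ipP : is_inner_product ip.
Hypothesis hcomp : hcomplete ip.
Local Notation hn := (hnorm ip).
Variable T : R -> V -> V.
Hypothesis HT : contractive_semigroup ip T.

Definition dyad (m : nat) : R := 2^-1 ^+ m.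

Lemma dyad_gt0 m : 0 < dyad m. Proof. by rewrite exprn_gt0 ?invr_gt0. Qed.
Lemma dyad_ge0 m : 0 <= dyad m. Proof. exact/ltW/dyad_gt0. Qed.
Lemma dyadS m : dyad m.+1 + dyad m.+1 = dyad m.
Proof. by rewrite /dyad exprS; field. Qed.
Lemma dyad_le M m : (M <= m)%N -> dyad m <= dyad M.
Proof. by move=> h; apply: ler_wiXn2l => //; rewrite ?invr_ge0// invf_le1// ler1n. Qed.
Lemma dyad_small (e : R) : 0 < e -> exists M, dyad M < e.
Proof.
move=> e0; exists (Num.trunc e^-1).
rewrite /dyad exprVn -[ltRHS]invrK ltf_pV2 ?posrE ?exprn_gt0 ?invr_gt0//.
apply: lt_le_trans (truncnS_gt _) _; rewrite -natrX ler_nat; exact: ltn_expl.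
Qed.

(* damping by e^{-s} makes the integral over [0, 1] injective *)
Definition damp (s : R) (x : V) : V := (expR (- s))%:C *: T s x.

Let Tlin s : 0 <= s -> linear_op (T s). Proof. by case: HT => h *; exact: h. Qed.
Let Tle s x : 0 <= s -> hn (T s x) <= hn x. Proof. by case: HT => _ h *; exact: h. Qed.
Let TD s t x : 0 <= s -> 0 <= t -> T (s + t) x = T s (T t x).
Proof. by case: HT => _ _ _ h *; exact: h. Qed.

Lemma damp_lin s : 0 <= s -> linear_op (damp s).
Proof.
by move=> s0 a x y; rewrite /damp (Tlin s0) scalerDr !scalerA mulrC.
Qed.
Lemma damp_le s x : 0 <= s -> hn (damp s x) <= hn x.
Proof.
move=> s0; rewrite /damp (hnormZr ipP) ger0_norm ?expR_ge0//.
apply: le_trans (_ : 1 * hn x <= _); last by rewrite mul1r.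
by apply: ler_pM; rewrite ?expR_ge0 ?hnorm_ge0 ?Tle// -expR0 ler_expR oppr_le0.
Qed.
Lemma dampD s t x : 0 <= s -> 0 <= t -> damp (s + t) x = damp s (damp t x).
Proof.
move=> s0 t0; rewrite /damp (linopZ (Tlin s0)) scalerA TD//; congr (_ *: _).
by rewrite -rmorphM -expRD opprD.
Qed.
Lemma damp0 x : damp 0 x = x.
Proof. by case: HT => _ _ h _ _; rewrite /damp h oppr0 expR0 scale1r. Qed.
Lemma dampC s t x : 0 <= s -> 0 <= t -> damp s (damp t x) = damp t (damp s x).
Proof. by move=> s0 t0; rewrite -!dampD// addrC. Qed.

Lemma damp_cont x (e : R) : 0 < e -> exists M, forall s, 0 <= s <= dyad M -> hn (damp s x - x) <= e.
Proof.
move=> e0; have e2 : 0 < e / 2 by rewrite divr_gt0.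
have [_ _ T0 _ Tc] := HT; have [d d0 Hd] := Tc x 0 (lexx 0) _ e2.
have h1 : 0 < hn x + 1 by rewrite ltr_wpDl ?hnorm_ge0.
have mn : 0 < Num.min d (e / 2 / (hn x + 1)) by rewrite lt_min d0 divr_gt0.
have [M HM] := dyad_small mn.
move: HM; rewrite lt_min => /andP[M1 M2].
exists M => s /andP[s0 sM].
have := Hd s s0; rewrite subr0 ger0_norm// T0 => /(_ (le_lt_trans sM M1)) hT.
have -> : damp s x - x = (expR (- s) - 1)%:C *: T s x + (T s x - x).
  by rewrite rmorphB scalerBl scale1r addrA subrK.
apply: le_trans (hnorm_triangle ipP _ _) _; rewrite (hnormZr ipP).
have : `|expR (- s) - 1| * hn (T s x) <= e / 2.
  have a : `|expR (- s) - 1| <= s.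
    rewrite ler0_norm; last by rewrite subr_le0 -expR0 ler_expR oppr_le0.
    by have := expR_ge1Dx (- s); lra.
  apply: (@le_trans _ _ (s * (hn x + 1))).
    apply: ler_pM => //; rewrite ?hnorm_ge0//; have := Tle x s0; lra.
  by rewrite -ler_pdivlMr// ltW// (le_lt_trans sM).
lra.
Qed.

(* [damp_avg 0 m] is the m-th dyadic Riemann sum of the integral of [damp] over [0, 1] *)
Fixpoint damp_avg (M l : nat) (x : V) : V :=
  if l is l'.+1 then damp_avg M l' ((2^-1 : R)%:C *: (x + damp (dyad (M + l)) x)) else x.
Local Notation Q := damp_avg.

Let half_lin M : linear_op (fun x => (2^-1 : R)%:C *: (x + damp (dyad M) x)).
Proof.
move=> a x y; rewrite (damp_lin (dyad_ge0 _)) addrACA -[a *: x + _]scalerDr [LHS]scalerDr.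
by rewrite !scalerA mulrC.
Qed.

Lemma avg_lin M l : linear_op (Q M l).
Proof. by elim: l => //= l IH a x y; rewrite (half_lin (M + l.+1)) IH. Qed.

Lemma avg_le M l x : hn (Q M l x) <= hn x.
Proof.
elim: l x => //= l IH x; apply: le_trans (IH _) _.
rewrite (hnormZr ipP) ger0_norm ?invr_ge0//.
have := hnorm_triangle ipP x (damp (dyad (M + l.+1)) x).
have := damp_le x (dyad_ge0 (M + l.+1)); lra.
Qed.

Lemma avg_comm M l S x : linear_op S -> (forall m x, S (damp (dyad m) x) = damp (dyad m) (S x)) ->
  Q M l (S x) = S (Q M l x).
Proof.
move=> Sl SD; elim: l x => //= l IH x.
by rewrite -IH (linopZ Sl) (linopD Sl) SD.
Qed.

Lemma avg_damp M l s x : 0 <= s -> Q M l (damp s x) = damp s (Q M l x).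
Proof.
move=> s0; apply: avg_comm; first exact: damp_lin.
by move=> m y; rewrite dampC// dyad_ge0.
Qed.

(** As a product of factors (1 + damp 2^-i) / 2, the Riemann sum of mesh 2^-(M + l) over [0, 1] is
    the one of mesh 2^-M applied to the average over [0, 2^-M]. Refinement therefore only perturbs
    the argument. *)
Lemma avg_split M l x : Q 0 (M + l) x = Q 0 M (Q M l x).
Proof.
elim: l x => [|l IH] x; first by rewrite addn0.
by rewrite addnS /= IH add0n addnS.
Qed.

(** The geometric sum: with D = damp 2^-m, (D - 1) (D + 1) = D^2 - 1 is the same expression one
    level up. *)
Lemma avg_telescope m x : damp (dyad m) (Q 0 m x) - Q 0 m x =
  (dyad m)%:C *: (damp (dyad 0) x - x).
Proof.
elim: m x => [|m IH] x; first by rewrite /= /dyad expr0 scale1r.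
have d0 := dyad_ge0 m.+1; set D := damp (dyad m.+1).
have -> : D (Q 0 m.+1 x) - Q 0 m.+1 x = Q 0 m ((2^-1 : R)%:C *: (damp (dyad m) x - x)).
  rewrite /= add0n /D -(avg_damp 0 m _ d0) -(linopB (avg_lin 0 m)); congr (Q 0 m _).
  rewrite (linopZ (damp_lin d0)) (linopD (damp_lin d0)) -dampD// dyadS -scalerBr -/D.
  by congr (_ *: _); rewrite opprD [D x + _]addrC addrACA subrr addr0.
rewrite (linopZ (avg_lin 0 m)) (linopB (avg_lin 0 m)) avg_damp ?dyad_ge0// IH.
by rewrite scalerA -rmorphM /dyad exprS.
Qed.

(** The shift s is what makes the induction close: the sampling times s + j 2^-(M + l) stay within
    [0, 2^-M] as long as s is at most one mesh. *)
Lemma avg_osc M x (e : R) : (forall s, 0 <= s <= dyad M -> hn (damp s x - x) <= e) ->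
  forall l s, 0 <= s <= dyad (M + l) -> hn (Q M l (damp s x) - x) <= e.
Proof.
move=> H; elim=> [|l IH] s; first by rewrite addn0; exact: H.
move=> /andP[s0 sl]; rewrite addnS in sl; have d0 := dyad_ge0 (M + l).+1.
have dS := dyadS (M + l).
rewrite /= addnS -dampD// (linopZ (avg_lin M l)) (linopD (avg_lin M l)).
have h1 : hn (Q M l (damp s x) - x) <= e by apply: IH; rewrite s0 /=; lra.
have h2 : hn (Q M l (damp (dyad (M + l).+1 + s) x) - x) <= e.
  by apply: IH; rewrite addr_ge0//=; lra.
set a := Q M l (damp s x) in h1 *; set b := Q M l _ in h2 *.
have -> : (2^-1 : R)%:C *: (a + b) - x = (2^-1 : R)%:C *: ((a - x) + (b - x)).
  rewrite [(a - x) + _]addrACA -opprD scalerBr; congr (_ - _).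
  rewrite -mulr2n -[x *+ 2]scaler_nat scalerA [X in X *: _](_ : _ = 1) ?scale1r//.
  by apply: complexP => /=; lra.
rewrite (hnormZr ipP) ger0_norm ?invr_ge0//; have := hnorm_triangle ipP (a - x) (b - x); lra.
Qed.

Lemma avg_near M x (e : R) l : (forall s, 0 <= s <= dyad M -> hn (damp s x - x) <= e) ->
  hn (Q M l x - x) <= e.
Proof.
by move=> H; have := avg_osc H (l := l) (s := 0); rewrite damp0; apply; rewrite lexx dyad_ge0.
Qed.

Lemma damped_integral : exists B : V -> V,
  [/\ linear_op B, forall x, hn (B x) <= hn x,
      forall S (K : R), linear_op S -> (forall x, hn (S x) <= K * hn x) ->
        (forall m x, S (T (dyad m) x) = T (dyad m) (S x)) -> forall x, S (B x) = B (S x),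
      forall W, closed_subspace ip W -> (forall m x, W x -> W (T (dyad m) x)) ->
        forall x, W x -> W (B x) &
      forall x, hcvg ip (fun m => ((dyad m)^-1)%:C *: (damp (dyad m) (B x) - B x))
                  (damp 1 x - x)].
Proof.
have /choice [B HB] : forall x, exists l, hcvg ip (fun m => Q 0 m x) l.
  move=> x; apply: hcomp => e e0; have e4 : 0 < e / 4 by rewrite divr_gt0.
  have [M HM] := damp_cont x e4; exists M.
  have near m : (M <= m)%N -> hn (Q 0 m x - Q 0 M x) <= e / 4.
    move=> Mm; rewrite -(subnKC Mm) avg_split -(linopB (avg_lin 0 M)).
    by apply: le_trans (avg_le _ _ _) _; exact: avg_near.
  move=> m k /near h1 /near h2; apply: le_lt_trans (hnorm_triB ipP _ (Q 0 M x) _) _.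
  rewrite (hnormBC ipP (Q 0 M x)); lra.
have Blin : linear_op B.
  move=> a x y; apply: (hcvg_unique ipP (HB _)).
  have := hcvgD ipP (hcvgZ ipP a (HB x)) (HB y).
  by rewrite (_ : (fun k => _) = (fun k => Q 0 k (a *: x + y)))//; apply/funext => k; rewrite avg_lin.
exists B; split=> //.
- by move=> x; apply: (hcvg_hnorm_le ipP (HB x)) => k; exact: avg_le.
- move=> S K Sl SK ST x; apply: (hcvg_unique ipP (hcvg_bounded (linopB Sl) SK (HB x))).
  rewrite (_ : (fun k => S (Q 0 k x)) = (fun k => Q 0 k (S x))); first exact: HB.
  apply/funext => k; rewrite avg_comm// => m y.
  by rewrite /damp (linopZ Sl) ST.
- move=> W [Ws Wc] WT x Wx; apply: (Wc _ _ (HB x)) => m.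
  elim: m x Wx => //= m IH x Wx; apply: IH; apply: (subspaceZ Ws); apply: (subspaceD Ws) => //.
  by apply: (subspaceZ Ws); exact: WT.
(* For fixed M the difference quotient of the Riemann sum [Q 0 (M + l) x] equals [Q M l y] exactly,
   by telescoping. This is close to y uniformly in l, and letting l grow replaces the Riemann sum by
   B x. *)
- move=> x; set y := damp 1 x - x; move=> e e0; have e2 : 0 < e / 2 by rewrite divr_gt0.
  have [N HN] := damp_cont y e2; exists N => M NM.
  have osc s : 0 <= s <= dyad M -> hn (damp s y - y) <= e / 2.
    by move=> /andP[s0 sM]; apply: HN; rewrite s0 (le_trans sM)// dyad_le.
  pose A z := ((dyad M)^-1)%:C *: (damp (dyad M) z - z).
  have dl := damp_lin (dyad_ge0 M).
  have AB u w : A (u - w) = A u - A w.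
    rewrite /A (linopB dl) -[RHS]scalerBr; congr (_ *: _).
    by rewrite !opprB [LHS]addrACA [RHS]addrACA; congr (_ + _); exact: addrC.
  have AK z : hn (A z) <= ((dyad M)^-1 * 2) * hn z.
    rewrite /A (hnormZr ipP) ger0_norm ?invr_ge0 ?dyad_ge0// -mulrA ler_pM2l ?invr_gt0 ?dyad_gt0//.
    apply: le_trans (hnormB_le ipP _ _) _; have := damp_le z (dyad_ge0 M); lra.
  have H1 : hcvg ip (fun l => Q 0 (M + l) x) (B x).
    move=> f f0; have [L HL] := HB x f f0; exists L => k Lk; apply: HL.
    exact: leq_trans Lk (leq_addl _ _).
  have H2 := hcvgD ipP (hcvg_bounded AB AK H1) (hcvg_cst ipP (- y)).
  apply: (@le_lt_trans _ _ (e / 2)); last lra.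
  apply: (hcvg_hnorm_le ipP H2) => l.
  suff -> : A (Q 0 (M + l) x) = Q M l y by exact: avg_near.
  rewrite /A avg_split avg_telescope scalerA -rmorphM mulVf ?gt_eqF ?dyad_gt0// scale1r.
  by rewrite /y (linopB (avg_lin M l)) avg_damp ?ler01// /dyad expr0.
Qed.

End DampedIntegral.

(** * Recovering the generator pointwise *)

Section Pointwise.
Variable R : realType.
Local Notation C := R[i].
Local Notation dyad := (@dyad R).
Implicit Types z w : C.

Definition cabs z : R := Num.sqrt (cnorm2 z).

Lemma cabs_ge0 z : 0 <= cabs z. Proof. exact: sqrtr_ge0. Qed.
Lemma cabs2 z : cabs z ^+ 2 = cnorm2 z.
Proof. by rewrite sqr_sqrtr ?cnorm2_ge0. Qed.
Lemma cabsM z w : cabs (z * w) = cabs z * cabs w.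
Proof. by rewrite /cabs cnorm2M sqrtrM ?cnorm2_ge0. Qed.
Lemma cabsN z : cabs (- z) = cabs z. Proof. by rewrite /cabs cnorm2N. Qed.
Lemma cabsX z n : cabs (z ^+ n) = cabs z ^+ n.
Proof.
elim: n => [|n IH]; first by rewrite !expr0 /cabs cnorm21 sqrtr1.
by rewrite !exprS cabsM IH.
Qed.
Lemma cabs_real (r : R) : cabs r%:C = `|r|.
Proof. by rewrite /cabs cnorm2_real sqrtr_sqr. Qed.
Lemma cabs_le1 z : (cabs z <= 1) = (cnorm2 z <= 1).
Proof. by rewrite -cabs2 expr_le1 ?cabs_ge0. Qed.
Lemma cabs_triangle z w : cabs (z + w) <= cabs z + cabs w.
Proof.
rewrite -(@ler_pXn2r _ 2) ?nnegrE ?addr_ge0 ?cabs_ge0// sqrrD !cabs2.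
set p := complex.Re z * complex.Re w + complex.Im z * complex.Im w.
have -> : cnorm2 (z + w) = cnorm2 z + p *+ 2 + cnorm2 w.
  by rewrite /p /cnorm2 !ReImE; ring.
rewrite lerD2r lerD2l lerMn2r /= -cabsM.
apply: le_trans (ler_norm _) _.
rewrite -(@ler_pXn2r _ 2) ?nnegrE ?cabs_ge0// cabs2 real_normK ?num_real// cnorm2M /p /cnorm2.
have := sqr_ge0 (complex.Re z * complex.Im w - complex.Im z * complex.Re w).
lra.
Qed.
Lemma cabs_eq0 z : cabs z = 0 -> z = 0.
Proof. by move=> h; apply: cnorm2_eq0; rewrite -cabs2 h expr0n. Qed.
Lemma Re_le_cabs z : `|complex.Re z| <= cabs z.
Proof.
rewrite -(@ler_pXn2r _ 2) ?nnegrE ?cabs_ge0// cabs2 real_normK ?num_real//.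
by rewrite lerDl sqr_ge0.
Qed.
Lemma cabs_le_ReIm z : cabs z <= `|complex.Re z| + `|complex.Im z|.
Proof.
rewrite -(@ler_pXn2r _ 2) ?nnegrE ?cabs_ge0 ?addr_ge0// cabs2 sqrrD !real_normK ?num_real//.
by rewrite addrAC lerDl mulrn_wge0// mulr_ge0.
Qed.

Lemma cabs_expB n z w : cabs z <= 1 -> cabs w <= 1 ->
  cabs (z ^+ n - w ^+ n) <= n%:R * cabs (z - w).
Proof.
move=> z1 w1; elim: n => [|n IH]; first by rewrite !expr0 subrr mul0r cabs_real normr0.
have -> : z ^+ n.+1 - w ^+ n.+1 = z * (z ^+ n - w ^+ n) + (z - w) * w ^+ n.
  by rewrite !exprS; ring.
apply: le_trans (cabs_triangle _ _) _; rewrite !cabsM cabsX -natr1 mulrDl mul1r.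
apply: lerD; first by apply: le_trans IH; rewrite ler_piMl ?cabs_ge0.
by rewrite ler_piMr ?cabs_ge0// exprn_ile1 ?cabs_ge0.
Qed.

Lemma cexpD z w : cexp (z + w) = cexp z * cexp w.
Proof.
case: z w => [a b] [c d]; rewrite /cexp /= expRD cosD sinD.
apply: complexP => /=; ring.
Qed.
Lemma cexpMn n z : cexp (n%:R%:C * z) = cexp z ^+ n.
Proof.
elim: n => [|n IH].
  rewrite expr0 mul0r; apply: complexP => /=; rewrite expR0 ?cos0 ?sin0; ring.
by rewrite exprS -IH -cexpD -natr1 rmorphD mulrDl rmorph1 mul1r addrC.
Qed.
Lemma cabs_cexp z : cabs (cexp z) = expR (complex.Re z).
Proof.
rewrite /cabs /cnorm2 /= !exprMn -mulrDr cos2Dsin2 mulr1 sqrtr_sqr ger0_norm// expR_ge0.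
Qed.

Lemma dyad_derive (f : R -> R) (l : R) : is_derive (0 : R) (1 : R) f l ->
  forall e : R, 0 < e -> exists M, forall m, (M <= m)%N ->
    `|(dyad m)^-1 * (f (dyad m) - f 0) - l| < e.
Proof.
move=> [df <-] e e0.
have /cvgrPdistC_lt /(_ _ e0) [d /= d0 Hd] := df.
have [M HM] := dyad_small d0; exists M => m Mm.
have := Hd (dyad m); rewrite /= /ball /= sub0r normrN ger0_norm ?dyad_ge0//.
rewrite addr0 /GRing.scale /= mulr1; apply.
  by apply: le_lt_trans HM; exact: dyad_le.
by rewrite gt_eqF ?dyad_gt0.
Qed.

Lemma is_derive_scale (r : R) : is_derive (0 : R) (1 : R) (fun t => t * r) r.
Proof.
have h := @is_deriveZ R R R id r 0 1 1 (is_derive_id (0 : R) (1 : R)).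
rewrite (_ : (fun t => t * r) = r \*: id); last by apply/funext => t /=; rewrite mulrC.
by rewrite /GRing.scale /= mulr1 in h.
Qed.

Lemma is_derive_expcos (al be : R) :
  is_derive (0 : R) (1 : R) (fun t => expR (t * al) * cos (t * be)) al.
Proof.
have la := is_derive_scale al; have lb := is_derive_scale be.
have dexp : is_derive (0 : R) (1 : R) (expR \o (fun t => t * al)) (expR (0 * al) * al).
  exact: is_derive1_comp.
have dcos : is_derive (0 : R) (1 : R) (cos \o (fun t => t * be)) (- sin (0 * be) * be).
  exact: is_derive1_comp.
have := is_deriveM dexp dcos.
by rewrite /= !mul0r expR0 cos0 sin0 oppr0 mul0r scaler0 add0r mul1r /GRing.scale /= mul1r.
Qed.

Lemma is_derive_expsin (al be : R) :
  is_derive (0 : R) (1 : R) (fun t => expR (t * al) * sin (t * be)) be.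
Proof.
have la := is_derive_scale al; have lb := is_derive_scale be.
have dexp : is_derive (0 : R) (1 : R) (expR \o (fun t => t * al)) (expR (0 * al) * al).
  exact: is_derive1_comp.
have dsin : is_derive (0 : R) (1 : R) (sin \o (fun t => t * be)) (cos (0 * be) * be).
  exact: is_derive1_comp.
have := is_deriveM dexp dsin.
by rewrite /= !mul0r expR0 cos0 sin0 mul1r scale0r addr0 /GRing.scale /= mul1r.
Qed.

Lemma cexp_derive (a : C) (e : R) : 0 < e -> exists M, forall m, (M <= m)%N ->
  cabs ((dyad m)^-1%:C * (cexp ((dyad m)%:C * a) - 1) - a) < e.
Proof.
move=> e0; have e2 : 0 < e / 2 by rewrite divr_gt0.
pose al := complex.Re a; pose be := complex.Im a.
have d1 := is_derive_expcos al be; have d2 := is_derive_expsin al be.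
have [M1 H1] := dyad_derive d1 e2; have [M2 H2] := dyad_derive d2 e2.
exists (maxn M1 M2) => m; rewrite geq_max => /andP[/H1 h1 /H2 h2].
apply: le_lt_trans (cabs_le_ReIm _) _.
move: h1 h2; rewrite !mul0r expR0 cos0 sin0 mul1r mulr0 subr0 => h1 h2.
have -> : complex.Re ((dyad m)^-1%:C * (cexp ((dyad m)%:C * a) - 1) - a) =
  (dyad m)^-1 * (expR (dyad m * al) * cos (dyad m * be) - 1) - al.
  rewrite /cexp !ReImE /= !mul0r !subr0 !addr0 //.
have -> : complex.Im ((dyad m)^-1%:C * (cexp ((dyad m)%:C * a) - 1) - a) =
  (dyad m)^-1 * (expR (dyad m * al) * sin (dyad m * be)) - be.
  rewrite /cexp !ReImE /= !mul0r !subr0 !addr0 ?oppr0 ?addr0 //.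
lra.
Qed.

Lemma expRN_dyad_quot (e : R) : 0 < e -> exists M, forall m, (M <= m)%N ->
  `|(dyad m)^-1 * (expR (- dyad m) - 1) + 1| < e.
Proof.
move=> e0; have [M HM] := dyad_derive (is_derive_expcos (-1) 0) e0; exists M => m /HM.
by rewrite !mulr0 !mul0r expR0 cos0 !mulr1 mulrN1 opprK.
Qed.

Lemma cexp_near0 (a : C) (e : R) : 0 < e -> exists M, forall s : R, 0 <= s <= dyad M ->
  cabs (cexp (s%:C * a) - 1) < e.
Proof.
move=> e0; have e2 : 0 < e / 2 by rewrite divr_gt0.
have near (f : R -> R) (l : R) : is_derive (0 : R) (1 : R) f l ->
    exists M, forall s : R, 0 <= s <= dyad M -> `|f s - f 0| < e / 2.
  move=> [/derivable1_diffP/differentiable_continuous /cvgrPdistC_lt /(_ _ e2) [r /= r0 Hr] _].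
  have [M HM] := dyad_small r0; exists M => s /andP[s0 sM]; apply: Hr.
  by rewrite /ball /= sub0r normrN ger0_norm// (le_lt_trans sM).
have [M1 H1] := near _ _ (is_derive_expcos (complex.Re a) (complex.Im a)).
have [M2 H2] := near _ _ (is_derive_expsin (complex.Re a) (complex.Im a)).
exists (maxn M1 M2) => s /andP[s0 sM].
have /H1 h1 : 0 <= s <= dyad M1 by rewrite s0 (le_trans sM)// dyad_le// leq_maxl.
have /H2 h2 : 0 <= s <= dyad M2 by rewrite s0 (le_trans sM)// dyad_le// leq_maxr.
move: h1 h2; rewrite !mul0r expR0 cos0 sin0 mul1r mulr0 subr0 => h1 h2.
apply: le_lt_trans (cabs_le_ReIm _) _.
have -> : complex.Re (cexp (s%:C * a) - 1) =
  expR (s * complex.Re a) * cos (s * complex.Im a) - 1.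
  by rewrite /cexp !ReImE /= !mul0r !subr0 !addr0.
have -> : complex.Im (cexp (s%:C * a) - 1) =
  expR (s * complex.Re a) * sin (s * complex.Im a).
  by rewrite /cexp !ReImE /= !mul0r !subr0 !addr0.
lra.
Qed.

(** Here z m, b and c stand for the values at one point of the multipliers of T_{2^-m}, B and e^{-1}
    T_1 - 1. The relation z_{m+1}^2 = z_m leaves a sign open at each step; the limit of the
    difference quotient, needed only along a subsequence, fixes them all. *)
Lemma pointwise_generator (z : nat -> C) (b c : C) :
  (forall m, z m.+1 ^+ 2 = z m) -> (forall m, cnorm2 (z m) <= 1) ->
  c = (expR (- 1))%:C * z 0%N - 1 ->
  (forall k N, exists m, (N <= m)%N /\
    cnorm2 ((dyad m)^-1%:C * ((expR (- dyad m))%:C * z m - 1) * b - c) < k.+1%:R^-1) ->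
  [/\ b != 0, c != 0, complex.Re (c / b + 1) <= 0 &
      forall m, z m = cexp ((dyad m)%:C * (c / b + 1))].
Proof.
move=> zz z1 cE H.
have small (e : R) N : 0 < e -> exists m, (N <= m)%N /\
    cabs ((dyad m)^-1%:C * ((expR (- dyad m))%:C * z m - 1) * b - c) < e.
  move=> e0; have e20 : 0 < e ^+ 2 by rewrite exprn_gt0.
  have [k _ Hk] := near_infty_natSinv_lt (PosNum e20).
  have [m [Nm hm]] := H k N; exists m; split=> //.
  rewrite -(@ltr_pXn2r _ 2) ?nnegrE ?cabs_ge0 ?ltW// cabs2.
  by apply: lt_trans hm _; exact: (Hk k (leqnn k)).
have z1' m : cabs (z m) <= 1 by rewrite cabs_le1.
have e1 : expR (- 1) < 1 :> R by rewrite -expR0 ltr_expR oppr_lt0.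
have cN0 : c != 0.
  apply/eqP => c0; have : cabs ((expR (- 1))%:C * z 0%N) = 1.
    have -> : (expR (- 1))%:C * z 0%N = 1 by apply/eqP; rewrite -subr_eq0 -cE c0.
    by rewrite /cabs cnorm21 sqrtr1.
  rewrite cabsM cabs_real ger0_norm ?expR_ge0// => h.
  have := ler_wpM2l (expR_ge0 (-1 : R)) (z1' 0%N); rewrite h mulr1 => h'.
  by have := lt_le_trans e1 h'; rewrite ltxx.
have bN0 : b != 0.
  apply/eqP => b0; move: cN0; have -> : c = 0; last by rewrite eqxx.
  apply: cabs_eq0; apply/eqP; rewrite eq_le cabs_ge0 andbT.
  apply/ler_addgt0Pl => e e0; rewrite addr0.
  by have [m [_]] := small e 0%N e0; rewrite b0 mulr0 sub0r cabsN => /ltW.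
(* c / b is the value of the damped generator A - 1; adding 1 undoes the damping. *)
set a := c / b + 1.
have conv (e : R) N : 0 < e -> exists m, (N <= m)%N /\
    cabs ((dyad m)^-1%:C * (z m - 1) - a) < e.
  move=> e0.
  have bp : 0 < cabs b.
    rewrite lt_neqAle cabs_ge0 andbT eq_sym; apply/eqP => /cabs_eq0 b0.
    by rewrite b0 eqxx in bN0.
  pose K := cabs a + 2.
  have K0 : 0 < K by rewrite ltr_wpDl ?cabs_ge0.
  (* d <= 1/2 keeps the damping factor E above 1/2; the errors below add up to less than d K, so
     after division by E they stay below 2 d K <= e / 4. *)
  pose d := Num.min 2^-1 (e / (8 * K)).
  have d0 : 0 < d by rewrite lt_min invr_gt0 ltr0n divr_gt0// mulr_gt0.
  have d1 : d <= 2^-1 by rewrite ge_min lexx.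
  have dK : d * (8 * K) <= e by rewrite -ler_pdivlMr ?mulr_gt0// ge_min lexx orbT.
  have [M1 HM1] := expRN_dyad_quot d0; have [M2 HM2] := dyad_small d0.
  have [m [Nm hm]] := small (d * cabs b) (maxn N (maxn M1 M2)) (mulr_gt0 d0 bp).
  move: Nm; rewrite !geq_max => /and3P[Nm /HM1 h1 M2m]; exists m; split=> //.
  have dm : dyad m < d by apply: le_lt_trans HM2; exact: dyad_le.
  set w := (dyad m)^-1%:C * ((expR (- dyad m))%:C * z m - 1) in hm.
  have hw : cabs (w - c / b) < d.
    rewrite -(ltr_pM2r bp) -cabsM; apply: le_lt_trans hm.
    by rewrite mulrBl divfK.
  set E := expR (- dyad m) in w hm hw h1 *.
  have E0 : 0 < E by exact: expR_gt0.
  have E1 : 1 - dyad m <= E by have := expR_ge1Dx (- dyad m); rewrite -/E; lra.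
  have E1' : E <= 1 by rewrite /E -expR0 ler_expR oppr_le0 dyad_ge0.
  have dN0 : dyad m != 0 by rewrite gt_eqF ?dyad_gt0.
  (* Separates the undamped quotient into the given damped limit, the derivative -1 of e^{-s} at 0,
     and a term of order 1 - E. *)
  have key : E%:C * ((dyad m)^-1%:C * (z m - 1) - a) =
     (w - c / b) - ((dyad m)^-1 * (E - 1) + 1)%:C + (1 - E)%:C * a.
    by rewrite /w /a; case: (z m) => zr zi; case: (c / b) => cr ci;
      apply: complexP; rewrite !ReImE /=; ring.
  have : cabs (E%:C * ((dyad m)^-1%:C * (z m - 1) - a)) < d + d + d * cabs a.
    rewrite key; apply: le_lt_trans (cabs_triangle _ _) _.
    have t1 := cabs_triangle (w - c / b) (- ((dyad m)^-1 * (E - 1) + 1)%:C).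
    rewrite cabsN [cabs ((dyad m)^-1 * _ + 1)%:C]cabs_real in t1.
    have t2 : cabs ((1 - E)%:C * a) <= d * cabs a.
      rewrite cabsM cabs_real ler_wpM2r ?cabs_ge0// ger0_norm ?subr_ge0//; lra.
    lra.
  rewrite cabsM cabs_real gtr0_norm// => h3.
  set Y := cabs _ in h3 *; have Y0 : 0 <= Y by exact: cabs_ge0.
  have hE : 2^-1 * Y <= E * Y by rewrite ler_wpM2r//; lra.
  have dK' : d * K = d + d + d * cabs a by rewrite /K; ring.
  lra.
(* Inherited from Re (z m - 1) <= 0, as |z m| <= 1. *)
have a0 : complex.Re a <= 0.
  apply/ler_addgt0Pl => e e0; rewrite addr0.
  have [m [_ hm]] := conv e 0%N e0.
  have := Re_le_cabs ((dyad m)^-1%:C * (z m - 1) - a).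
  have r1 : complex.Re (z m) <= 1.
    by apply: le_trans (ler_norm _) _; apply: le_trans (Re_le_cabs _) (z1' m).
  have r2 : complex.Re ((dyad m)^-1%:C * (z m - 1)) <= 0.
    rewrite cReM /= mul0r subr0 pmulr_rle0 ?invr_gt0 ?dyad_gt0// cReD cReN /=; lra.
  rewrite cReD cReN ler_norml => /andP[h1 h2]; lra.
split=> // m0; apply/eqP; rewrite -subr_eq0; apply/eqP/cabs_eq0/eqP.
rewrite eq_le cabs_ge0 andbT; apply/ler_addgt0Pl => e e0; rewrite addr0.
have e2 : 0 < e / 2 by rewrite divr_gt0.
have [M HM] := cexp_derive a e2.
have [m [Nm hm]] := conv (e / 2) (maxn m0 M) e2.
move: Nm; rewrite geq_max => /andP[m0m /HM h2].
(* Both z m0 and the exponential are 2^(m - m0)-th powers of points of the unit disk at level m.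
   Taking powers multiplies the distance by at most 2^(m - m0) = 2^-m0 / 2^-m, which turns it into a
   difference of difference quotients. *)
have zpow l : z m0 = z (m0 + l)%N ^+ (2 ^ l).
  elim: l => [|l IH]; first by rewrite addn0 expr1.
  by rewrite IH addnS -zz -exprM expnS.
have dpow : dyad m0 = (2 ^ (m - m0))%:R * dyad m.
  rewrite /dyad -{2}(subnKC m0m) exprD natrX mulrCA -exprMn mulfV ?pnatr_eq0// expr1n mulr1//.
have -> : cexp ((dyad m0)%:C * a) = cexp ((dyad m)%:C * a) ^+ (2 ^ (m - m0)).
  by rewrite dpow rmorphM -mulrA cexpMn.
rewrite (zpow (m - m0)%N) subnKC//.
have cx1 : cabs (cexp ((dyad m)%:C * a)) <= 1.
  rewrite cabs_cexp -expR0 ler_expR cReM /= mul0r subr0.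
  by rewrite mulr_ge0_le0// dyad_ge0.
apply: le_trans (cabs_expB _ (z1' m) cx1) _.
set q := cexp _ in h2 *.
have -> : z m - q = (dyad m)%:C * (((dyad m)^-1%:C * (z m - 1) - a) - ((dyad m)^-1%:C * (q - 1) - a)).
  have dC : (dyad m)%:C * (dyad m)^-1%:C = 1 :> C.
    by rewrite -rmorphM mulfV// gt_eqF ?dyad_gt0.
  transitivity ((dyad m)%:C * (dyad m)^-1%:C * (z m - q)); first by rewrite dC mul1r.
  ring.
rewrite cabsM cabs_real ger0_norm ?dyad_ge0// mulrA -dpow.
have dm1 : dyad m0 <= 1 by rewrite exprn_ile1 ?invr_ge0// invf_le1// ler1n.
have t := cabs_triangle ((dyad m)^-1%:C * (z m - 1) - a) (- ((dyad m)^-1%:C * (q - 1) - a)).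
rewrite cabsN in t.
apply: (@le_trans _ _ (1 * e)); last by rewrite mul1r.
apply: ler_pM; rewrite ?dyad_ge0 ?cabs_ge0//; lra.
Qed.

End Pointwise.

(** * Almost everywhere consequences of L^2 convergence *)

Section LiminfAe.
Context {d : measure_display} {X : measurableType d} {R : realType}.
Variable mu : {measure set X -> \bar R}.
Local Notation C := R[i].

(** Chebyshev: the set where |u_m|^2 stays above a = 1 / (k + 1) for all m >= N is null, as a times
    its indicator is dominated by every such u_m (a^2 <= a). The good indices may depend on the
    point, so no common subsequence is extracted. *)
Lemma liminf_ae (u : nat -> X -> C) : (forall m, cmeasurable (u m)) ->
  (forall e : R, 0 < e -> exists N, forall m, (N <= m)%N -> (l2 mu (u m) < e%:E)%E) ->
  {ae mu, forall x, forall k N, exists m, (N <= m)%N /\ cnorm2 (u m x) < k.+1%:R^-1}.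
Proof.
move=> mu_ H; apply/ae_foralln => k; apply/ae_foralln => N.
pose B := [set x | forall m, (N <= m)%N -> k.+1%:R^-1 <= cnorm2 (u m x)].
have mB : measurable B.
  have -> : B = \bigcap_(m in [set m | (N <= m)%N]) [set x | k.+1%:R^-1 <= cnorm2 (u m x)].
    by apply/seteqP; split=> x h m /= => [Nm|Nm]; exact: h.
  apply: bigcap_measurable; first by exists N => /=.
  move=> m _; have := measurable_cnorm2 (mu_ m) measurableT (measurable_itv `[k.+1%:R^-1, +oo[%R).
  by rewrite setTI; congr measurable; apply/seteqP; split=> x; rewrite /= in_itv /= andbT.
pose a : R := k.+1%:R^-1.
have a0 : 0 < a by rewrite invr_gt0.
have a1 : a <= 1 by rewrite invf_le1// ler1n.
have aB : ((cnorm2 (a%:C : C))%:E * mu B)%E = 0%E.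
  apply/eqP; rewrite eq_le; apply/andP; split; last by rewrite mule_ge0// lee_fin cnorm2_ge0.
  apply/lee_addgt0Pr => e e0; rewrite add0e.
  have [M HM] := H e e0; pose m := maxn N M.
  rewrite -l2_indic// -l2_scale; last exact: cmeas_indic.
  apply: le_trans (ltW (HM m (leq_maxr _ _))).
  apply: l2_ae_le => //; first by apply: cmeasZ; exact: cmeas_indic.
  apply: aeW => x; rewrite cnorm2M !cnorm2_real indicE.
  have [xB|xB] := boolP (x \in B); last by rewrite expr0n mulr0 cnorm2_ge0.
  rewrite expr1n mulr1; move: xB; rewrite inE => /(_ m (leq_maxl _ _)) h.
  apply: le_trans h; rewrite -/a expr2; exact: ler_piMr (ltW a0) a1.
have B0 : mu B = 0%E.
  move: aB => /eqP; rewrite mule_eq0 => /orP[|/eqP//].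
  by rewrite cnorm2_real eqe sqrf_eq0 gt_eqF.
exists B; split=> // x nx m Nm; rewrite leNgt; apply/negP => h; apply: nx.
by exists m.
Qed.

End LiminfAe.

(** * From multipliers to the functional model of one semigroup *)

Section SemigroupModel.
Variables (R : realType) (V : lmodType R[i]) (ip : V -> V -> R[i]).
Hypothesis ipP : is_inner_product ip.
Local Notation C := R[i].
Local Notation hn := (hnorm ip).
Local Notation nrm2 := (nrm2 ip).
Local Notation dyad := (@dyad R).
Context {d : measure_display} {X : measurableType d}.
Variable mu : {measure set X -> \bar R}.

Variable Gr : V -> (X -> C) -> Prop.
Hypothesis Gr_meas : forall h f, Gr h f -> cmeasurable f.
Hypothesis GrD : forall h f k g, Gr h f -> Gr k g -> Gr (h + k) (fun x => f x + g x).
Hypothesis GrZ : forall a h f, Gr h f -> Gr (a *: h) (fun x => a * f x).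
Hypothesis Gr_isom : forall h f, Gr h f -> l2 mu f = (nrm2 h)%:E.

Variables (S : set V) (Fib : V -> set X).
Hypothesis GrF : forall v, S v -> Gr v (fun x => (\1_(Fib v) x : R)%:C).
Hypothesis Fib_ae : forall Q : X -> Prop,
  (forall v, S v -> {ae mu, forall x, Fib v x -> Q x}) -> {ae mu, forall x, Q x}.

Variable T : R -> V -> V.
Hypothesis HT : contractive_semigroup ip T.
Variable g : nat -> X -> C.
Hypothesis gmeas : forall m, cmeasurable (g m).
Hypothesis g_le1 : forall m, {ae mu, forall x, cnorm2 (g m x) <= 1}.
Hypothesis gG : forall m h f, Gr h f -> Gr (T (dyad m) h) (fun x => g m x * f x).
Variable B : V -> V.
Hypothesis Blim : forall x,
  hcvg ip (fun m => ((dyad m)^-1)%:C *: (damp T (dyad m) (B x) - B x)) (damp T 1 x - x).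
Variable b : X -> C.
Hypothesis bmeas : cmeasurable b.
Hypothesis bG : forall h f, Gr h f -> Gr (B h) (fun x => b x * f x).

Let GrB h f k g' : Gr h f -> Gr k g' -> Gr (h - k) (fun x => f x - g' x).
Proof.
move=> Gf /(GrZ (-1)); rewrite scaleN1r => /(GrD Gf).
by under eq_fun do rewrite mulN1r.
Qed.

Let Gr_uniq h f g' : Gr h f -> Gr h g' -> {ae mu, forall x, f x = g' x}.
Proof.
move=> Gf Gg; have G := GrB Gf Gg; have := Gr_isom G.
rewrite subrr (nrm20 ipP) => /(l2_eq0 (Gr_meas G)); apply: filterS => x /eqP.
by rewrite subr_eq0 => /eqP.
Qed.

(** Identities between multipliers are read off from the vectors of S: the function of such a vector
    is 1 on its fibre. *)
Lemma multiplier_sqr : {ae mu, forall x, forall m, g m.+1 x ^+ 2 = g m x}.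
Proof.
apply/ae_foralln => m; apply: Fib_ae => v Sv.
have G1 := gG m (GrF Sv); have G2 := gG m.+1 (gG m.+1 (GrF Sv)).
have [_ _ _ TD _] := HT; rewrite -TD ?dyad_ge0// dyadS in G2.
apply: filterS (Gr_uniq G1 G2) => x h xv; move: h.
by rewrite indicE mem_set//= !mulr1 expr2.
Qed.

(** The multiplier of e^{-1} T_1 - 1. The function [q m] below it is the defect at step 2^-m in (A -
    1) B = e^{-1} T_1 - 1, with A the generator. *)
Let c x : C := (expR (- 1))%:C * g 0%N x - 1.
Let q m x : C := (dyad m)^-1%:C * ((expR (- dyad m))%:C * g m x - 1) * b x - c x.

Lemma generator_liminf : {ae mu, forall x, forall k N, exists m, (N <= m)%N /\
  cnorm2 (q m x) < k.+1%:R^-1}.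
Proof.
apply: Fib_ae => v Sv; pose ch x : C := (\1_(Fib v) x : R)%:C.
have Gv : Gr v ch := GrF Sv.
have G m : Gr (((dyad m)^-1)%:C *: (damp T (dyad m) (B v) - B v) - (damp T 1 v - v))
    (fun x => q m x * ch x).
  have Gb := bG Gv.
  have H1 := GrZ ((dyad m)^-1)%:C (GrB (GrZ (expR (- dyad m))%:C (gG m Gb)) Gb).
  have H2 := GrB (GrZ (expR (- dyad 0))%:C (gG 0 Gv)) Gv.
  have := GrB H1 H2; rewrite /damp (_ : dyad 0 = 1)//; congr (Gr _ _).
  by apply/funext => x; rewrite /q /c; ring.
have : {ae mu, forall x, forall k N, exists m, (N <= m)%N /\ cnorm2 (q m x * ch x) < k.+1%:R^-1}.
  apply: liminf_ae; first by move=> m; exact: Gr_meas (G m).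
  move=> e e0; have sp : 0 < Num.sqrt e by rewrite sqrtr_gt0.
  have [N HN] := Blim v sp; exists N => m /HN; rewrite (hnorm_lt_sqrt ipP) ?sqrtr_ge0//.
  by rewrite sqr_sqrtr ?(ltW e0)// (Gr_isom (G m)) lte_fin.
apply: filterS => x h xv k N; have [m [Nm hm]] := h k N; exists m; split=> //.
by move: hm; rewrite /ch indicE mem_set//= mulr1.
Qed.

Lemma generator_ae : {ae mu, forall x,
  [/\ b x != 0, c x != 0, complex.Re (c x / b x + 1) <= 0 &
      forall m, g m x = cexp ((dyad m)%:C * (c x / b x + 1))]}.
Proof.
have g1 : {ae mu, forall x, forall m, cnorm2 (g m x) <= 1} by exact/ae_foralln.
apply: filterS (ae_and multiplier_sqr (ae_and g1 generator_liminf)) => x [h1 [h2 h3]].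
exact: (@pointwise_generator _ (fun m => g m x)).
Qed.

(* With A the generator, b / c is the value of the resolvent (A - 1)^-1, so this is
   the Cayley transform (A + 1) / (A - 1). *)
Definition cogen (x : X) : C := 1 + 2%:R * (b x / c x).

Lemma cogen_meas : cmeasurable cogen.
Proof.
have mc : cmeasurable c.
  by apply: cmeasB; [apply: cmeasZ|exact: cmeas_cst].
apply: cmeasD; first exact: cmeas_cst.
apply: cmeasZ; apply: cmeasM => //.
(* Expresses the inverse through a measurable real power. At zeros of c the conjugate factor
   vanishes, in agreement with the convention 0^-1 = 0. *)
have cV x : (c x)^-1 = (cnorm2 (c x) `^ (-1))%:C * (c x)^*.
  have [->|cx0] := eqVneq (c x) 0.
    by rewrite invr0 rmorph0 mulr0.
  apply: (mulfI cx0); rewrite mulfV// mulrCA mulr_conj powR_inv1 ?cnorm2_ge0//.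
  rewrite -rmorphM mulVf//; apply/eqP => /cnorm2_eq0 c0.
  by rewrite c0 eqxx in cx0.
under eq_fun do rewrite cV.
apply: cmeasM.
  apply: cmeas_real; apply: (measurableT_comp (measurable_powR _)).
  exact: measurable_cnorm2.
case: mc => m1 m2; split; first by under eq_fun do rewrite cRe_conj.
by under eq_fun do rewrite cIm_conj; exact: measurableT_comp.
Qed.

(** With a = cx / bx + 1, the number 1 + 2 bx / cx is w = (a + 1) / (a - 1). The Cayley transform is
    its own inverse, misses the value 1, and |a + 1| <= |a - 1| exactly when Re a <= 0. *)
Lemma cayley (bx cx : C) : bx != 0 -> cx != 0 ->
  [/\ 1 + 2%:R * (bx / cx) != 1 :> C,
   (1 + 2%:R * (bx / cx) + 1) / (1 + 2%:R * (bx / cx) - 1) = cx / bx + 1 &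
   complex.Re (cx / bx + 1) <= 0 -> cnorm2 (1 + 2%:R * (bx / cx)) <= 1].
Proof.
move=> b0 c0; have two : 2%:R != 0 :> C by rewrite pnatr_eq0.
have w1 : 1 + 2%:R * (bx / cx) != 1 :> C.
  by rewrite -subr_eq0 addrAC subrr add0r !mulf_neq0 ?invr_neq0.
split=> //.
  have -> : 1 + 2%:R * (bx / cx) + 1 = 2%:R * (bx / cx) * (cx / bx + 1) :> C.
    by field; rewrite b0 c0.
  rewrite [1 + _ - 1]addrAC subrr add0r mulrAC divff ?mul1r//.
  by rewrite !mulf_neq0 ?invr_neq0.
move=> a0; set a := cx / bx + 1 in a0.
have aw : (a - 1) * (1 + 2%:R * (bx / cx)) = a + 1.
  by rewrite /a; field; rewrite b0 c0.
have a1 : 0 < cnorm2 (a - 1).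
  rewrite lt_neqAle cnorm2_ge0 andbT eq_sym; apply/eqP => /cnorm2_eq0.
  rewrite /a addrK => /eqP; rewrite mulf_eq0 invr_eq0 (negbTE b0) (negbTE c0) //.
clearbody a; rewrite -(ler_pM2l a1) mulr1 -cnorm2M aw /cnorm2 !ReImE /=.
lra.
Qed.

Lemma cogen_props : Linf_ball mu cogen /\ mu [set x | cogen x = 1] = 0%E.
Proof.
have H := generator_ae.
have h1 : {ae mu, forall x, cnorm2 (cogen x) <= 1}.
  by apply: filterS H => x [b0 c0 a0 _]; have [_ _] := cayley b0 c0; exact.
split; first by split=> //; exact: cogen_meas.
have [M1 M2] := cogen_meas.
have mE : measurable [set x | cogen x = 1].
  have -> : [set x | cogen x = 1] =
    (setT `&` (fun x => complex.Re (cogen x)) @^-1` [set 1]) `&`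
    (setT `&` (fun x => complex.Im (cogen x)) @^-1` [set 0]).
    rewrite !setTI; apply/seteqP; split=> x /=; first by move=> ->.
    by move=> [r1 r2]; exact: complexP.
  by apply: measurableI; [apply: M1|apply: M2] => //; exact: measurable_set1.
apply/measure_negligible => //.
apply: negligibleS (_ : mu.-negligible _); last exact: H.
move=> x /= e1 [b0 c0 _ _]; have [] := cayley b0 c0.
by rewrite -/(cogen x) e1 eqxx.
Qed.

Lemma semigroup_iter m k h : T (k%:R * dyad m) h = iter k (T (dyad m)) h.
Proof.
have [_ _ T0 TD _] := HT; elim: k => [|k IH]; first by rewrite mul0r T0.
by rewrite -natr1 mulrDl mul1r addrC TD ?dyad_ge0 ?mulr_ge0 ?dyad_ge0// IH.
Qed.

(** The exponential formula is known at dyadic steps. Strong continuity carries it to t on the side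
    of the vectors, continuity of the exponential on the side of the functions. The exceptional null
    set may depend on t and h. *)
Lemma semigroup_phi t h f F : 0 <= t -> Gr h f -> Gr (T t h) F ->
  {ae mu, forall x, F x = phi t (cogen x) * f x}.
Proof.
move=> t0 Gf GF.
(* The largest multiple of 2^-m not exceeding t; approximation from below keeps t - s m nonnegative,
   so that [cexp_near0] applies. *)
pose k m := Num.trunc (t / dyad m); pose s m : R := (k m)%:R * dyad m.
have sle m : 0 <= t - s m <= dyad m.
  have dp := dyad_gt0 R m.
  have /andP[h1 h2] : (k m)%:R <= t / dyad m < (k m).+1%:R.
    by apply: truncn_itv; rewrite divr_ge0// ltW.
  rewrite ler_pdivlMr// in h1; rewrite ltr_pdivrMr// -natr1 mulrDl mul1r in h2.
  by rewrite /s; apply/andP; split; lra.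
have Gm m : Gr (T (s m) h) (fun x => g m x ^+ k m * f x).
  rewrite semigroup_iter; elim: (k m) => [|j IH].
    by under eq_fun do rewrite expr0 mul1r.
  by under eq_fun do rewrite exprS -mulrA; exact: gG.
pose u m x := F x - g m x ^+ k m * f x.
have Gu m : Gr (T t h - T (s m) h) (u m) by exact: GrB.
have ul : {ae mu, forall x, forall k N, exists m, (N <= m)%N /\ cnorm2 (u m x) < k.+1%:R^-1}.
  apply: liminf_ae => [m|e e0]; first exact: Gr_meas (Gu m).
  have sp : 0 < Num.sqrt e by rewrite sqrtr_gt0.
  have [_ _ _ _ Tc] := HT; have [r r0 Hr] := Tc h t t0 _ sp.
  have [M HM] := dyad_small r0; exists M => m Mm.
  rewrite (Gr_isom (Gu m)) lte_fin (nrm2BC ipP).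
  have /andP[s1 s2] := sle m.
  have := Hr (s m); rewrite (hnorm_lt_sqrt ipP) ?sqrtr_ge0// sqr_sqrtr ?(ltW e0)//; apply.
    by rewrite mulr_ge0// dyad_ge0.
  by rewrite distrC ger0_norm//; apply: le_lt_trans s2 _; apply: le_lt_trans HM; exact: dyad_le.
apply: filterS (ae_and generator_ae ul) => x [[b0 c0 a0 ga] hu].
have [w1 wa _] := cayley b0 c0.
rewrite /phi (negbTE w1) wa; set a := c x / b x + 1 in a0 ga *.
apply/eqP; rewrite -subr_eq0; apply/eqP/cabs_eq0/eqP; rewrite eq_le cabs_ge0 andbT.
apply/ler_addgt0Pl => e e0; rewrite addr0.
have e2 : 0 < e / 2 by rewrite divr_gt0.
have f1 : 0 < cabs (f x) + 1 by rewrite ltr_wpDl ?cabs_ge0.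
have [M HM] := cexp_near0 a (divr_gt0 e2 f1).
have e20 : 0 < (e / 2) ^+ 2 by rewrite exprn_gt0.
have [j _ Hj] := near_infty_natSinv_lt (PosNum e20).
have [m [Mm hm]] := hu j M.
have {}hm : cabs (u m x) < e / 2.
  rewrite -(@ltr_pXn2r _ 2) ?nnegrE ?cabs_ge0 ?ltW// cabs2.
  by apply: lt_trans hm _; exact: (Hj j (leqnn j)).
have /andP[s1 s2] := sle m.
have gk : g m x ^+ k m = cexp ((s m)%:C * a).
  by rewrite ga -cexpMn mulrA -rmorphM.
have te : cexp (t%:C * a) = cexp ((s m)%:C * a) * cexp ((t - s m)%:C * a).
  by rewrite -cexpD -mulrDl -rmorphD addrC subrK.
have -> : F x - cexp (t%:C * a) * f x =
    u m x - cexp ((s m)%:C * a) * (cexp ((t - s m)%:C * a) - 1) * f x.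
  by rewrite /u gk te; ring.
apply: le_trans (cabs_triangle _ _) _; rewrite cabsN !cabsM.
have h1 : cabs (cexp ((s m)%:C * a)) <= 1.
  rewrite cabs_cexp -expR0 ler_expR cReM /= mul0r subr0.
  by rewrite mulr_ge0_le0// mulr_ge0// dyad_ge0.
have h2 : cabs (cexp ((t - s m)%:C * a) - 1) < e / 2 / (cabs (f x) + 1).
  by apply: HM; rewrite s1 (le_trans s2)// dyad_le.
have h3 : cabs (cexp ((s m)%:C * a)) * cabs (cexp ((t - s m)%:C * a) - 1) * cabs (f x) <= e / 2.
  apply: (@le_trans _ _ (cabs (cexp ((t - s m)%:C * a) - 1) * (cabs (f x) + 1))).
    apply: ler_pM; rewrite ?mulr_ge0 ?cabs_ge0//; last by rewrite lerDl.
    by rewrite ler_piMl ?cabs_ge0.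
  by rewrite -ler_pdivlMr// ltW.
lra.
Qed.

End SemigroupModel.

(** * Commutation at different dyadic times *)

Section Commutation.
Variables (R : realType) (V : lmodType R[i]) (ip : V -> V -> R[i]).

Lemma semigroup_dyad_comm (T : R -> V -> V) (A : V -> V) m l :
  contractive_semigroup ip T ->
  (forall x, A (T (dyad R (m + l)) x) = T (dyad R (m + l)) (A x)) ->
  forall x, A (T (dyad R m) x) = T (dyad R m) (A x).
Proof.
move=> [_ _ _ TD _]; elim: l => [|l IH] H; first by move: H; rewrite addn0.
apply: IH => x; rewrite -dyadS -addnS !TD ?dyad_ge0//.
by rewrite !H.
Qed.

(** Both operators are powers of the operators at the common time 2^-(m1 + m2), where commutation is
    assumed. *)
Lemma semigroups_comm_dyad (T1 T2 : R -> V -> V) :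
  contractive_semigroup ip T1 -> contractive_semigroup ip T2 ->
  semigroups_commute T1 T2 ->
  forall m1 m2 x, T1 (dyad R m1) (T2 (dyad R m2) x) = T2 (dyad R m2) (T1 (dyad R m1) x).
Proof.
move=> H1 H2 H m1 m2 x; symmetry.
apply: (semigroup_dyad_comm (l := m2) H1) => {}x; symmetry; rewrite addnC.
apply: (semigroup_dyad_comm (l := m1) H2) => {}x.
by apply: H; exact: dyad_ge0.
Qed.

End Commutation.

Theorem mainTheorem9 (R : realType) (V : lmodType R[i]) (ip : V -> V -> R[i])
    (HV : is_hilbert ip) (n : nat) (T : 'I_n -> R -> V -> V)
    (HT : forall j, normal_contractive_semigroup ip (T j))
    (Hcomm : forall i j, semigroups_commute (T i) (T j)) :
  exists (d : measure_display) (X : measurableType d)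
         (mu : {measure set X -> \bar R}) (psi : 'I_n -> X -> R[i])
         (gamma : V -> X -> R[i]),
    [/\ semifinite mu,
        (forall j, Linf_ball mu (psi j)),
        (forall j, mu [set x | psi j x = 1] = 0%E),
        unitary_to_L2 mu ip gamma &
        (forall j t (h : V), 0 <= t ->
           {ae mu, forall x, gamma (T j t h) x = phi t (psi j x) * gamma h x})].
Proof.
have [ipP hcomp] := HV.
have Tsg j : contractive_semigroup ip (T j) := (HT j).1.
pose N (i : 'I_n * nat) := T i.1 (dyad R i.2).
have Nlin i : linear_op (N i) by have [L _ _ _ _] := Tsg i.1; apply: L; exact: dyad_ge0.
have Nnor i : normal_op ip (N i) by apply: (HT i.1).2; exact: dyad_ge0.
have Nle i x : hnorm ip (N i x) <= hnorm ip x.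
  by have [_ L _ _ _] := Tsg i.1; apply: L; exact: dyad_ge0.
have Ncomm i i' x : N i (N i' x) = N i' (N i x).
  exact: (semigroups_comm_dyad (Tsg _) (Tsg _) (Hcomm _ _)).
have [P [Pproj Pcomm PN Pinv]] := spectral_family ipP hcomp Nlin Nnor Nle Ncomm.
have [S [Sorth Smax]] := max_orth_family ipP Pproj Pcomm.
have mult := multiplier ipP hcomp Pproj Pcomm Sorth Smax.
pose Gr : V -> (mX ip P -> R[i]) -> Prop := @mgraph R V ip P S.
have gE (i : 'I_n * nat) : exists g : mX ip P -> R[i], [/\ cmeasurable g,
    {ae mmu ip P S, forall x : mX ip P, cnorm2 (g x) <= 1} &
    forall h f, Gr h f -> Gr (N i h) (fun x => g x * f x)].
  apply: mult => //; first by move=> x; rewrite -(hnorm_le ipP).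
  by move=> W cW WP x; exact: Pinv.
have /choice[g gP] := gE.
have /choice[B BP] : forall j, exists B : V -> V, _ := fun j => damped_integral ipP hcomp (Tsg j).
have bE j : exists b : mX ip P -> R[i], [/\ cmeasurable b,
    {ae mmu ip P S, forall x : mX ip P, cnorm2 (b x) <= 1} &
    forall h f, Gr h f -> Gr (B j h) (fun x => b x * f x)].
  (* B_j is not a member of the family that produced the projections; as a limit of combinations of
     products of its members it inherits commutation with each P_k and preservation of the invariant
     closed subspaces. *)
  have [Blin Ble Bcomm Binv _] := BP j; apply: mult => //.
  - by move=> x; rewrite -(hnorm_le ipP).
  - move=> k x; have [Plin _ _] := Pproj k; apply: (Bcomm _ 1) => //.
      by move=> y; rewrite mul1r; exact: (oproj_le ipP).
    by move=> m y; exact: (PN k (j, m)).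
  - move=> W cW WP; apply: Binv => // m x.
    exact: (Pinv W cW WP (j, m)).
have /choice[b bP] := bE.
have /choice[gamma gammaP] := mgraph_total ipP hcomp Pproj Pcomm Sorth Smax.
have Gmeas (h : V) (f : mX ip P -> R[i]) : Gr h f -> cmeasurable f.
  exact: mgraph_meas.
have GD h (f : mX ip P -> R[i]) k f' : Gr h f -> Gr k f' ->
  Gr (h + k) (fun x => f x + f' x) by exact: mgraphD.
have GZ a h (f : mX ip P -> R[i]) : Gr h f -> Gr (a *: h) (fun x => a * f x).
  exact: mgraphZ.
have Gisom h (f : mX ip P -> R[i]) : Gr h f -> l2 (mmu ip P S) f = (nrm2 ip h)%:E.
  exact: mgraph_isom.
have Guniq h (f f' : mX ip P -> R[i]) : Gr h f -> Gr h f' ->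
  {ae mmu ip P S, forall x : mX ip P, f x = f' x} by exact: mgraph_uniq.
have GF (v : V) (Sv : S v) := mgraph_fiber ipP P Sv.
have Fib_ae (Q : mX ip P -> Prop) :
    (forall v, S v -> {ae mmu ip P S, forall x : mX ip P, fiber v x -> Q x}) ->
    {ae mmu ip P S, forall x : mX ip P, Q x}.
  move=> H; apply: ae_slices => v Sv; apply: filterS (H v Sv) => x xQ xv.
  by apply: xQ; split.
have gm j m := let: And3 h _ _ := gP (j, m) in h.
have g1 j m := let: And3 _ h _ := gP (j, m) in h.
have gG j m := let: And3 _ _ h := gP (j, m) in h.
have bm j := let: And3 h _ _ := bP j in h.
have bG j := let: And3 _ _ h := bP j in h.
have Blim j := let: And5 _ _ _ _ h := BP j in h.
have props j := cogen_props ipP Gmeas GD GZ Gisom GF Fib_ae (Tsg j) (gm j) (g1 j) (gG j)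
  (Blim j) (bm j) (bG j).
exists _, (mX ip P), (mmu ip P S), (fun j => cogen (fun m => g (j, m)) (b j)), gamma; split.
- exact: mmu_semifinite.
- by move=> j; have [] := props j.
- by move=> j; have [] := props j.
- split.
  + move=> h; split; first exact: Gmeas (gammaP h).
    by have := Gisom _ _ (gammaP h); rewrite /l2 => ->; exact: ltry.
  + move=> a h k; apply: Guniq (gammaP _) _.
    exact: GD (GZ a _ _ (gammaP h)) (gammaP k).
  + by move=> h; rewrite (hnorm2 ipP); exact: (Gisom _ _ (gammaP h)).
  + move=> f /(mgraph_onto ipP hcomp Pproj Pcomm Sorth)[h hf]; exists h.
    exact: Guniq (gammaP h) hf.
- move=> j t h t0.
  exact: (semigroup_phi ipP Gmeas GD GZ Gisom GF Fib_ae (Tsg j) (g1 j) (gG j)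
    (Blim j) (bG j) t0 (gammaP h) (gammaP _)).
Qed.
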